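(* Let $H\in(\frac14,\frac12)$ be the Hurst parameter. Then the stochastic convolution $\int_0^t S(t-s)\,dB^H(s)$ is well defined for every $t>0$; that is, the series $\sum_{n=1}^\infty \int_0^t S(t-s)e_n\,d\beta_n^H(s)$ defining it converges in $L^2(\Omega;\mathbf H)$.
   Context: Let $\mathcal O=(0,\pi)\times(0,\pi)$ and $\mathcal V=\{\phi\in (C_0^\infty(\mathcal O))^2:\nabla\cdot\phi=0\}$. $\mathbf H$ is the closure of $\mathcal V$ in $(L^2(\mathcal O))^2$, with inner product $(\cdot,\cdot)$ and norm $|\cdot|$; $V$ is the closure of $\mathcal V$ in $(H^2(\mathcal O))^2$; $V'$ is the dual of $V$, with $V\subset \mathbf H\equiv \mathbf H'\subset V'$. The operator $A:V\to V'$ is given by $\langle Au,v\rangle=\frac12(\Delta u,\Delta v)$ for $u,v\in V$. It is self-adjoint and positive in $\mathbf H$ with compact inverse, so there are an orthonormal basis $\{e_n\}_{n\ge1}$ of $\mathbf H$ and $0<\lambda_1\le\lambda_2\le\cdots\to\infty$ with $Ae_n=\lambda_ne_n$. Let $S(t)=e^{-tA}$, $t\ge 0$. A one-dimensional fractional Brownian motion $\beta^H$ with Hurst parameter $H$ is a centered Gaussian process with covariance $R(t,s)=\frac12(t^{2H}+s^{2H}-|t-s|^{2H})$. Wiener integrals $\int\varphi\,d\beta^H$ of deterministic functions are defined for step functions by $\int 1_{(a,b]}d\beta^H=\beta^H(b)-\beta^H(a)$ and linearity, and extended by isometry to the closure of the step functions under the scalar product $\langle 1_{[0,t]},1_{[0,s]}\rangle=R(t,s)$;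 for scalar $\varphi$ and $h\in\mathbf H$, $\int \varphi h\,d\beta^H=(\int\varphi\,d\beta^H)h$. The standard cylindrical fractional Brownian motion on $\mathbf H$ is the formal series $B^H(t)=\sum_n\beta_n^H(t)e_n$ with $\{\beta_n^H\}$ independent one-dimensional fractional Brownian motions with Hurst parameter $H$ on a complete probability space $(\Omega,\mathcal F,P)$. The stochastic convolution is by definition $\int_0^tS(t-s)\,dB^H(s)=\sum_{n=1}^\infty\int_0^tS(t-s)e_n\,d\beta_n^H(s)$. *)

(* Defs.v *)
From HB Require Import structures.
From mathcomp Require Import all_boot all_order all_algebra.
From mathcomp Require Import all_classical all_reals all_analysis.

Set Implicit Arguments.
Unset Strict Implicit.
Unset Printing Implicit Defensive.

Import Order.TTheory GRing.Theory Num.Theory.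
Import numFieldNormedType.Exports.

Local Open Scope classical_set_scope.
Local Open Scope ring_scope.

Section function_spaces.
Context {R : realType}.

Local Notation leb2 := (@lebesgue_measure R \x @lebesgue_measure R)%E.

Definition dom : set (R * R) := `]0, pi[ `*` `]0, pi[.

Definition axis (i : 'I_2) : R * R := if i == ord0 then (1, 0) else (0, 1).

Fixpoint Ck (k : nat) (f : R * R -> R) : Prop :=
  if k is k'.+1 then
    continuous f /\
    forall i, (forall x, derivable f x (axis i)) /\ Ck k' ('D_(axis i) f)
  else continuous f.

(* C_0^oo(dom), its elements being extended by 0 to the whole plane. *)
Definition test_fun (f : R * R -> R) : Prop :=
  [/\ forall k, Ck k f,
      compact (closure [set x | f x != 0]) &
      closure [set x | f x != 0] `<=` dom].

Definition partial (a b : nat) (f : R * R -> R) : R * R -> R :=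
  iter a (fun g => 'D_(axis ord0) g) (iter b (fun g => 'D_(axis ord_max) g) f).

(* Elements of L^2(dom) are represented by functions on the plane, of which
   only the values almost everywhere on dom matter. *)
Definition L2dom (f : R * R -> R) : Prop :=
  measurable_fun dom f /\ leb2.-integrable dom (fun x => ((f x) ^+ 2)%:E).

Definition is_weak_partial (a b : nat) (f g : R * R -> R) : Prop :=
  L2dom g /\
  forall psi, test_fun psi ->
    \int[leb2]_(x in dom) (f x * partial a b psi x) =
    (-1) ^+ (a + b) * \int[leb2]_(x in dom) (g x * psi x).

Definition weak_partial (a b : nat) (f : R * R -> R) : R * R -> R :=
  xget (fun=> 0) (is_weak_partial a b f).

Definition H2dom (f : R * R -> R) : Prop :=
  L2dom f /\
  forall a b, (a + b <= 2)%N -> exists g, is_weak_partial a b f g.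

Definition vfield := 'I_2 -> R * R -> R.

Definition dotL2 (u v : vfield) : R :=
  \sum_i \int[leb2]_(x in dom) (u i x * v i x).

Definition normL2 (u : vfield) : R := Num.sqrt (dotL2 u u).

Definition vpartial (a b : nat) (u : vfield) : vfield :=
  fun i => weak_partial a b (u i).

Definition normH2 (u : vfield) : R :=
  Num.sqrt (\sum_(a < 3) \sum_(b < 3 | (a + b <= 2)%N)
    normL2 (vpartial a b u) ^+ 2).

Definition laplacian (u : vfield) : vfield := vpartial 2 0 u + vpartial 0 2 u.

Definition calV (phi : vfield) : Prop :=
  (forall i, test_fun (phi i)) /\
  forall x, \sum_i 'D_(axis i) (phi i) x = 0.

Definition spaceH (u : vfield) : Prop :=
  (forall i, L2dom (u i)) /\
  forall eps : R, 0 < eps -> exists2 phi, calV phi & normL2 (u - phi) < eps.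

Definition spaceV (u : vfield) : Prop :=
  (forall i, H2dom (u i)) /\
  forall eps : R, 0 < eps -> exists2 phi, calV phi & normH2 (u - phi) < eps.

(* Elements of V' are represented as functionals on V; through H = H', a field
   u in H is the functional (u, .). *)
Definition opA (u : vfield) : vfield -> R :=
  fun v => 2^-1 * dotL2 (laplacian u) (laplacian v).

Definition eigenpairA (u : vfield) (lam : R) : Prop :=
  spaceV u /\ forall v, spaceV v -> opA u v = lam * dotL2 u v.

Definition cvgL2 (u : nat -> vfield) (v : vfield) : Prop :=
  normL2 (u n - v) @[n --> \oo] --> (0 : R).

Definition orthonormal_basisH (e : nat -> vfield) : Prop :=
  [/\ forall n, spaceH (e n),
      forall m n, dotL2 (e m) (e n) = (m == n)%:R &
      forall u, spaceH u -> cvgL2 (fun n => \sum_(k < n) dotL2 u (e k) *: e k) u].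

(* S(t) = exp(-tA), by spectral calculus in the eigenbasis (e, lam) of A. *)
Definition semigroup (e : nat -> vfield) (lam : nat -> R) (t : R) (u : vfield)
    : vfield :=
  xget 0 [set v | spaceH v /\
    cvgL2 (fun n => \sum_(k < n) (expR (- t * lam k) * dotL2 u (e k)) *: e k) v].

Definition openH (U : set vfield) : Prop :=
  U `<=` spaceH /\
  forall u, U u -> exists2 eps : R, 0 < eps &
    forall v, spaceH v -> normL2 (v - u) < eps -> U v.

End function_spaces.

Arguments vfield : clear implicits.

Section processes.
Context {R : realType} {d : measure_display} {T : measurableType d}.
Variable P : probability T R.

(* The law of X is normal, possibly degenerate; normal_prob m 0 is not the
   Dirac mass at m, hence the separate case. *)
Definition gaussian (X : T -> R) : Prop :=
  exists m sigma : R, forall B : set R, measurable B ->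
    P (X @^-1` B) = if sigma == 0 then \d_m B else normal_prob m sigma B.

Definition fbm_cov (H t s : R) : R :=
  2^-1 * (t `^ (2 * H) + s `^ (2 * H) - `|t - s| `^ (2 * H)).

(* Processes are indexed by the reals, but only their values at nonnegative
   times are ever considered. *)
Definition is_fbm (H : R) (beta : R -> {RV P >-> R}) : Prop :=
  [/\ forall (n : nat) (a s : 'I_n -> R), (forall i, 0 <= s i) ->
        gaussian (fun w => \sum_i a i * beta (s i) w),
      forall t, 0 <= t -> ('E_P[beta t] = 0)%E &
      forall t s, 0 <= t -> 0 <= s ->
        ('E_P[fun w => (beta t w * beta s w)%R] = (fbm_cov H t s)%:E)%E].

Definition sigma_process (beta : R -> {RV P >-> R}) : set (set T) :=
  <<s [set A | exists t B, [/\ 0 <= t, measurable B & A = beta t @^-1` B]] >>.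

Definition independent_processes (beta : nat -> R -> {RV P >-> R}) : Prop :=
  forall (J : seq nat) (A : nat -> set T), uniq J ->
    (forall n, n \in J -> sigma_process (beta n) (A n)) ->
    P (\bigcap_(n in [set` J]) A n) = (\prod_(n <- J) P (A n))%E.

(* The list of the (c, (a, b)) stands for the sum of the c 1_{(a,b]}. *)
Definition stepfun := seq (R * (R * R)).

Definition step_within (t : R) (f : stepfun) : Prop :=
  forall p, p \in f -> 0 <= p.2.1 /\ p.2.1 <= p.2.2 /\ p.2.2 <= t.

Definition step_eval (f : stepfun) (s : R) : R :=
  \sum_(p <- f) p.1 * \1_`]p.2.1, p.2.2] s.

Definition step_sub (f g : stepfun) : stepfun :=
  f ++ [seq (- p.1, p.2) | p <- g].

(* The bilinear form with <1_{[0,t]}, 1_{[0,s]}> = fbm_cov H t s. *)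
Definition step_dot (H : R) (f g : stepfun) : R :=
  \sum_(p <- f) \sum_(q <- g) p.1 * q.1 *
    (fbm_cov H p.2.2 q.2.2 - fbm_cov H p.2.2 q.2.1
     - fbm_cov H p.2.1 q.2.2 + fbm_cov H p.2.1 q.2.1).

Definition step_integral (beta : R -> {RV P >-> R}) (f : stepfun) (w : T) : R :=
  \sum_(p <- f) p.1 * (beta p.2.2 w - beta p.2.1 w).

Definition step_cauchy (H : R) (f : nat -> stepfun) : Prop :=
  forall eps : R, 0 < eps -> exists N, forall m n, (N <= m)%N -> (N <= n)%N ->
    step_dot H (step_sub (f m) (f n)) (step_sub (f m) (f n)) < eps.

(* phi belongs to the closure of the step functions on [0,t] under step_dot,
   as witnessed by f. For H < 1/2 the closure embeds in L^2(0,t), and a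
   function is identified with an element of the closure when it is the
   L^2(0,t) limit of the corresponding Cauchy sequence. *)
Definition step_approx (H t : R) (f : nat -> stepfun) (phi : R -> R) : Prop :=
  [/\ forall n, step_within t (f n),
      step_cauchy H f,
      measurable_fun `[0, t] phi &
      (\int[lebesgue_measure]_(s in `[0%R, t])
         ((step_eval (f n) s - phi s) ^+ 2)%:E)%E @[n --> \oo] --> 0%E].

Definition is_wiener_integral (H : R) (beta : R -> {RV P >-> R}) (t : R)
    (phi : R -> R) (X : T -> R) : Prop :=
  measurable_fun setT X /\
  exists2 f, step_approx H t f phi &
    (\int[P]_w ((step_integral beta (f n) w - X w) ^+ 2)%:E)%E
      @[n --> \oo] --> 0%E.

(* Integral over [0,t] of an H-valued integrand of the form phi(s) h. *)
Definition is_wiener_integralH (H : R) (beta : R -> {RV P >-> R}) (t : R)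
    (Phi : R -> vfield R) (Y : T -> vfield R) : Prop :=
  exists phi : R -> R, exists h : vfield R, exists X : T -> R,
    [/\ spaceH h,
        forall s, 0 <= s <= t ->
          spaceH (Phi s) /\ normL2 (Phi s - phi s *: h) = 0,
        is_wiener_integral H beta t phi X &
        forall w, Y w = X w *: h].

Definition sqnormL2H (Z : T -> vfield R) : \bar R :=
  (\int[P]_w ((normL2 (Z w)) ^+ 2)%:E)%E.

Definition L2H (Z : T -> vfield R) : Prop :=
  [/\ forall w, spaceH (Z w),
      forall U, openH U -> measurable (Z @^-1` U) &
      (sqnormL2H Z < +oo)%E].

Definition series_cvgL2H (Y : nat -> T -> vfield R) : Prop :=
  exists2 Z, L2H Z &
    sqnormL2H (fun w => \sum_(k < n) Y k w - Z w) @[n --> \oo] --> 0%E.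

End processes.

(* Main.v *)
Require Import Defs.
From HB Require Import structures.
From mathcomp Require Import all_boot all_order all_algebra.
From mathcomp Require Import all_classical all_reals all_analysis.
From mathcomp Require Import measurable_realfun ring lra.

(** The integral of [exp (- (t - s) lam_n)] against a fractional Brownian motion
    has a second moment of order [lam_n ^ (- 2 H)], and since the [e_n] are
    orthonormal, the distance from a partial sum of the series to its sum is a
    tail of the series of these second moments. The operator has order four in
    dimension two, so that [lam_n] grows at least like [n ^ 2]: everything is
    dominated by the sum of the [n ^ (- 4 H)], finite for [H > 1/4].

    The growth of the eigenvalues ([eigenvalue_growth]) comes from Agmon's
    inequality [sup |phi|^2 <= C |phi| |Delta phi|] for test functions ([agmon]),
    which rests on integrations by parts alone. Apply it at a point [x] to the
    combination of [e_0, ..., e_n] with coefficients [e_k(x)]: since the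
    Laplacians of the [e_k] are orthogonal with square norms [2 lam_k], this
    bounds the sum of the [|e_k(x)|^2] by a multiple of [sqrt lam_n], and
    integrating over the square yields [n + 1 <= C' sqrt lam_n]. The argument is
    run on test fields close to the [e_k] in the norm of [V], and the norms of
    combinations are controlled by duality, by pairing with test fields.

    For the second moments, the exponential is approximated by dyadic step
    functions. Summation by parts and Minkowski's inequality bound the norm of
    their integrals by [4 lam ^ (- H)] ([dyadic_norm]), and successive
    refinements differ by increments over half cells, so the integrals converge
    ([dyadic_cauchy]). That any other approximating sequence has the same limit
    norm is the closability of the covariance form in [L^2(0, t)]
    ([step_dot_closable]): pairing with a fixed step function is continuous in
    [L^2] because [|s - a| ^ (2 H - 1)] is square integrable near [a], again for
    [H > 1/4] ([pow_pairing_bounded]).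

    The sum of the series is defined pathwise, by the completeness of [L^2], on
    the event where the squared coefficients are summable, and the error is
    computed by Parseval's identity ([orthogonal_series_cvg]). *)

Set Implicit Arguments.
Unset Strict Implicit.
Unset Printing Implicit Defensive.

Import Order.TTheory GRing.Theory Num.Theory.
Import numFieldNormedType.Exports.

Local Open Scope classical_set_scope.
Local Open Scope ring_scope.

(** * Semi-inner products *)

(** Functions are not identified when they agree almost everywhere, hence a form
    that is only positive semi-definite, on a subset of a space of functions. *)
Record semi_dot (R : realType) (V : lmodType R) (S : set V) (b : V -> V -> R)
    : Prop := SemiDot {
  sd0 : S 0;
  sdL : forall a u v, S u -> S v -> S (a *: u + v);
  sdC : forall u v, b u v = b v u;
  sd_linear : forall a u v w, S u -> S v -> S w ->
    b (a *: u + v) w = a * b u w + b v w;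
  sd_ge0 : forall u, 0 <= b u u }.


Section SemiDotTheory.
Context {R : realType} {V : lmodType R} {S : set V} {b : V -> V -> R}.
Hypothesis sd : semi_dot S b.

Definition snorm (c : V -> V -> R) (u : V) : R := Num.sqrt (c u u).

Local Notation nrm := (snorm b).
Implicit Types (u v w : V) (a : R).

Lemma sdD u v : S u -> S v -> S (u + v).
Proof. by move=> su sv; rewrite -[u]scale1r; exact: (sdL sd). Qed.

Lemma sdZ a u : S u -> S (a *: u).
Proof. by move=> su; rewrite -[_ *: _]addr0; apply: (sdL sd) => //; exact: (sd0 sd). Qed.

Lemma sdN u : S u -> S (- u).
Proof. by move=> su; rewrite -scaleN1r; exact: sdZ. Qed.

Lemma sdB u v : S u -> S v -> S (u - v).
Proof. by move=> su sv; apply: sdD => //; exact: sdN. Qed.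

Lemma sd_sum (I : Type) (r : seq I) (P : pred I) (F : I -> V) :
  (forall i, P i -> S (F i)) -> S (\sum_(i <- r | P i) F i).
Proof.
by move=> SF; apply: (big_ind S) => //; [exact: (sd0 sd) | exact: sdD].
Qed.

Lemma dotDl u v w : S u -> S v -> S w -> b (u + v) w = b u w + b v w.
Proof.
by move=> su sv sw; rewrite -{1}[u]scale1r (sd_linear sd)// mul1r.
Qed.

Lemma dot0l w : S w -> b 0 w = 0.
Proof.
move=> sw; have s0 := sd0 sd.
have := dotDl s0 s0 sw; rewrite addr0 => /eqP.
by rewrite -subr_eq0 opprD addrA subrr sub0r oppr_eq0 => /eqP.
Qed.

Lemma dotZl a u w : S u -> S w -> b (a *: u) w = a * b u w.
Proof.
by move=> su sw; rewrite -[a *: u]addr0 (sd_linear sd) ?dot0l ?addr0//; exact: (sd0 sd).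
Qed.

Lemma dotNl u w : S u -> S w -> b (- u) w = - b u w.
Proof. by move=> su sw; rewrite -scaleN1r dotZl// mulN1r. Qed.

Lemma dotBl u v w : S u -> S v -> S w -> b (u - v) w = b u w - b v w.
Proof. by move=> su sv sw; rewrite dotDl ?dotNl//; exact: sdN. Qed.

Lemma dotDr u v w : S u -> S v -> S w -> b u (v + w) = b u v + b u w.
Proof. by move=> su sv sw; rewrite (sdC sd) dotDl// !(sdC sd u). Qed.

Lemma dotZr a u w : S u -> S w -> b u (a *: w) = a * b u w.
Proof. by move=> su sw; rewrite (sdC sd) dotZl// (sdC sd u). Qed.

Lemma dotNr u w : S u -> S w -> b u (- w) = - b u w.
Proof. by move=> su sw; rewrite (sdC sd) dotNl// (sdC sd u). Qed.

Lemma dotBr u v w : S u -> S v -> S w -> b u (v - w) = b u v - b u w.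
Proof. by move=> su sv sw; rewrite dotDr ?dotNr//; exact: sdN. Qed.

Lemma dot_suml (I : Type) (r : seq I) (P : pred I) (F : I -> V) w :
  (forall i, P i -> S (F i)) -> S w ->
  b (\sum_(i <- r | P i) F i) w = \sum_(i <- r | P i) b (F i) w.
Proof.
move=> SF sw; elim: r => [|i r ih]; first by rewrite !big_nil dot0l.
rewrite !big_cons; case: ifP => // Pi.
by rewrite dotDl ?ih//; [exact: SF | exact: sd_sum].
Qed.

Lemma dot_sumr (I : Type) (r : seq I) (P : pred I) (F : I -> V) w :
  (forall i, P i -> S (F i)) -> S w ->
  b w (\sum_(i <- r | P i) F i) = \sum_(i <- r | P i) b w (F i).
Proof.
move=> SF sw; rewrite (sdC sd) dot_suml//.
by apply: eq_bigr => i _; exact: (sdC sd).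
Qed.

Lemma snorm_ge0 u : 0 <= nrm u. Proof. exact: sqrtr_ge0. Qed.

Lemma snorm_sqr u : nrm u ^+ 2 = b u u.
Proof. by rewrite sqr_sqrtr// (sd_ge0 sd). Qed.

Lemma snorm0 : nrm 0 = 0.
Proof. by rewrite /snorm dot0l ?sqrtr0//; exact: (sd0 sd). Qed.

Lemma snormZ a u : S u -> nrm (a *: u) = `|a| * nrm u.
Proof.
move=> su; rewrite /snorm dotZl ?dotZr//; last exact: sdZ.
by rewrite mulrA -expr2 sqrtrM ?sqr_ge0// sqrtr_sqr.
Qed.

Lemma snormN u : S u -> nrm (- u) = nrm u.
Proof. by move=> su; rewrite -scaleN1r snormZ// normrN1 mul1r. Qed.

Lemma snorm_subC u v : S u -> S v -> nrm (u - v) = nrm (v - u).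
Proof. by move=> su sv; rewrite -opprB snormN//; exact: sdB. Qed.

(** The polynomial [b (r u + v) (r u + v)] of degree two in [r] is nonnegative.
    Its minimum gives the inequality; when [b u u = 0] it is affine, hence
    constant. *)
Lemma cauchy_schwarz u v : S u -> S v -> `|b u v| <= nrm u * nrm v.
Proof.
move=> su sv.
have quad r : 0 <= r ^+ 2 * b u u + 2 * r * b u v + b v v.
  have sru : S (r *: u) by exact: sdZ.
  have := sd_ge0 sd (r *: u + v).
  rewrite (sd_linear sd)//; last exact: sdD.
  rewrite !dotDr// ?dotZr// ?dotZl// (sdC sd v u); congr (_ <= _); ring.
have uu := sd_ge0 sd u; have vv := sd_ge0 sd v.
rewrite -ler_sqr ?nnegrE ?normr_ge0 ?mulr_ge0 ?snorm_ge0//.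
rewrite exprMn !snorm_sqr real_normK ?num_real//.
have [u0|u0] := eqVneq (b u u) 0.
  have [->|c0] := eqVneq (b u v) 0; first by rewrite expr0n/= u0 mul0r.
  have := quad (- (b v v + 1) / (2 * b u v)).
  rewrite u0 mulr0 add0r.
  have -> : 2 * (- (b v v + 1) / (2 * b u v)) * b u v + b v v = -1.
    by field.
  by rewrite ler0N1.
have up : 0 < b u u by rewrite lt_neqAle eq_sym u0.
have := quad (- b u v / b u u).
have -> : (- b u v / b u u) ^+ 2 * b u u + 2 * (- b u v / b u u) * b u v + b v v
   = (b u u * b v v - b u v ^+ 2) / b u u by field.
by rewrite pmulr_lge0 ?invr_gt0// subr_ge0.
Qed.

Lemma dot_le u v : S u -> S v -> b u v <= nrm u * nrm v.
Proof. by move=> su sv; apply: le_trans (ler_norm _) (cauchy_schwarz su sv). Qed.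

Lemma snormD u v : S u -> S v -> nrm (u + v) <= nrm u + nrm v.
Proof.
move=> su sv; rewrite -ler_sqr ?nnegrE ?addr_ge0 ?snorm_ge0//.
rewrite snorm_sqr dotDl ?dotDr//; last exact: sdD.
rewrite sqrrD !snorm_sqr (sdC sd v u).
have := dot_le su sv; set x := b u v; set y := _ * _ => xy.
by rewrite (_ : y *+ 2 = y + y)//; lra.
Qed.

Lemma snormB u v : S u -> S v -> nrm (u - v) <= nrm u + nrm v.
Proof. by move=> su sv; rewrite -(snormN sv); apply: snormD => //; exact: sdN. Qed.

Lemma sdist_triangle u v w : S u -> S v -> S w ->
  nrm (u - w) <= nrm (u - v) + nrm (v - w).
Proof.
move=> su sv sw; rewrite -[u - w](subrKA v); apply: snormD; exact: sdB.
Qed.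

Lemma snorm_sum (I : Type) (r : seq I) (P : pred I) (F : I -> V) :
  (forall i, P i -> S (F i)) ->
  nrm (\sum_(i <- r | P i) F i) <= \sum_(i <- r | P i) nrm (F i).
Proof.
move=> SF; elim: r => [|i r ih]; first by rewrite !big_nil snorm0.
rewrite !big_cons; case: ifP => // Pi.
apply: le_trans (snormD _ _) _; [exact: SF | exact: sd_sum |].
by rewrite lerD2l.
Qed.

End SemiDotTheory.


Section SemiDotFamilies.
Context {R : realType} {V : lmodType R} {S : set V} {b : V -> V -> R}.
Hypothesis sd : semi_dot S b.
Local Notation nrm := (snorm b).
Implicit Types (I : finType).

Lemma snorm_orthogonal I (a mu : I -> R) (G : I -> V) :
  (forall k, S (G k)) -> (forall k l, b (G k) (G l) = mu k * (k == l)%:R) ->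
  nrm (\sum_k a k *: G k) ^+ 2 = \sum_k mu k * a k ^+ 2.
Proof.
move=> SG oG; have SaG k : S (a k *: G k) by exact: (sdZ sd).
rewrite (snorm_sqr sd) (dot_suml sd)//; last exact: (sd_sum sd).
apply: eq_bigr => k _; rewrite (dot_sumr sd)//.
rewrite (bigD1 k)//= big1 => [|l lk]; rewrite (dotZl sd)// (dotZr sd)// oG.
  by rewrite eqxx mulr1; ring.
by rewrite eq_sym (negPf lk) !mulr0.
Qed.

(** The norm of a combination is its pairing with itself divided by that norm;
    so nothing but the pairing of [G k - F k] with the combination needs to be
    controlled. *)
Lemma snorm_sum_dual I (a : I -> R) (F G : I -> V) (eps : R) : 0 <= eps ->
  (forall k, S (F k)) -> (forall k, S (G k)) ->
  (forall k, `|b (G k - F k) (\sum_l a l *: F l)| <= eps * nrm (\sum_l a l *: F l)) ->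
  nrm (\sum_k a k *: F k) <= nrm (\sum_k a k *: G k) + eps * \sum_k `|a k|.
Proof.
move=> eps0 SF SG h; set Phi := \sum_k a k *: F k in h *.
have SaF k : S (a k *: F k) by exact: (sdZ sd).
have SaG k : S (a k *: G k) by exact: (sdZ sd).
have SPhi : S Phi by exact: (sd_sum sd).
have SSG : S (\sum_k a k *: G k) by exact: (sd_sum sd).
set c := _ + _; have c0 : 0 <= c.
  by rewrite addr_ge0 ?snorm_ge0// mulr_ge0// sumr_ge0.
have [->//|P0] := eqVneq (nrm Phi) 0.
have Pp : 0 < nrm Phi by rewrite lt_neqAle eq_sym P0 snorm_ge0.
rewrite -(ler_pM2r Pp) -expr2 (snorm_sqr sd).
have -> : b Phi Phi = b (\sum_k a k *: G k) Phi - \sum_k a k * b (G k - F k) Phi.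
  rewrite [X in _ = X - _](dot_suml sd)// {1}/Phi [LHS](dot_suml sd)// -sumrB.
  by apply: eq_bigr => k _; rewrite !(dotZl sd)// (dotBl sd)//; ring.
rewrite mulrDl lerD//; first exact: (dot_le sd).
rewrite -sumrN mulrAC mulr_sumr ler_sum// => k _.
apply: le_trans (ler_norm _) _; rewrite normrN normrM mulrC.
by rewrite ler_wpM2r.
Qed.

End SemiDotFamilies.
(** * Square-integrable functions *)

Section SquareIntegrable.
Context d (T : measurableType d) (R : realType).
Variables (mu : {measure set T -> \bar R}) (D : set T).

Definition sqint (f : T -> R) : Prop :=
  measurable_fun D f /\ mu.-integrable D (fun x => ((f x) ^+ 2)%:E).

Definition ip (f g : T -> R) : R := \int[mu]_(x in D) (f x * g x).

Hypothesis mD : measurable D.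

Lemma Rintegral_sum (I : Type) (r : seq I) (F : I -> T -> R) :
  (forall i, mu.-integrable D (EFin \o F i)) ->
  mu.-integrable D (EFin \o (fun x => \sum_(i <- r) F i x)) /\
  \int[mu]_(x in D) (\sum_(i <- r) F i x) = \sum_(i <- r) \int[mu]_(x in D) F i x.
Proof.
move=> iF; elim: r => [|i r [ih1 ih2]].
  have E : (fun x => \sum_(i <- [::]) F i x) = cst 0.
    by apply/funext => x; rewrite big_nil.
  rewrite E big_nil; split; first exact: integrable0.
  by rewrite /Rintegral integral0.
have E : (fun x => \sum_(j <- i :: r) F j x) = (fun x => F i x + \sum_(j <- r) F j x).
  by apply/funext => x; rewrite big_cons.
rewrite E big_cons; split; last by rewrite RintegralD// ih2.
exact: (integrableD mD (iF i) ih1).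
Qed.

Lemma sqint_lty (f : T -> R) : measurable_fun D f ->
  (\int[mu]_(x in D) ((f x) ^+ 2)%:E < +oo)%E -> sqint f.
Proof.
move=> mf If; split => //; apply/integrableP; split.
  by apply/measurable_EFinP; exact: measurable_funX.
apply: le_lt_trans If; apply: ge0_le_integral => //.
- do 2 apply: measurableT_comp => //; exact: measurable_funX.
- by apply/measurable_EFinP; exact: measurable_funX.
- by move=> x _; rewrite gee0_abs// lee_fin sqr_ge0.
Qed.

Lemma sqint_le (f g : T -> R) : measurable_fun D f -> sqint g ->
  (forall x, D x -> (f x) ^+ 2 <= (g x) ^+ 2) -> sqint f.
Proof.
move=> mf [mg ig] fg; split => //.
apply: (le_integrable mD _ _ ig) => //.
  by apply/measurable_EFinP; exact: measurable_funX.
by move=> x Dx /=; rewrite lee_fin !ger0_norm ?sqr_ge0//; exact: fg.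
Qed.

Lemma sqint_mul (f g : T -> R) : sqint f -> sqint g ->
  mu.-integrable D (fun x => (f x * g x)%:E).
Proof.
move=> [mf iF] [mg iG].
have iFG := integrableD mD iF iG.
apply: (le_integrable mD _ _ iFG) => //.
  by apply/measurable_EFinP; exact: measurable_funM.
move=> x Dx /=; rewrite lee_fin normrM.
rewrite (ger0_norm (addr_ge0 (sqr_ge0 _) (sqr_ge0 _))).
rewrite -(real_normK (num_real (f x))) -(real_normK (num_real (g x))).
have := sqr_ge0 (`|f x| - `|g x|).
have := mulr_ge0 (normr_ge0 (f x)) (normr_ge0 (g x)).
by nra.
Qed.

Lemma sqint0 : sqint 0.
Proof.
split; first exact: measurable_cst.
apply: (eq_integrable mD (cst 0%E)); last exact: integrable0.
by move=> x _ /=; rewrite expr0n.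
Qed.

Lemma sqint_linear (a : R) (f g : T -> R) : sqint f -> sqint g -> sqint (a *: f + g).
Proof.
move=> sf sg; have [mf iF] := sf; have [mg iG] := sg.
have iFG := sqint_mul sf sg; split.
  by apply: measurable_funD => //; apply: measurable_funM => //; exact: measurable_cst.
have i1 := integrableZl mD (a ^+ 2) iF.
have i2 := integrableZl mD (2 * a) iFG.
have i3 := integrableD mD (integrableD mD i1 i2) iG.
apply: eq_integrable i3 => // x _ /=.
rewrite -!EFinM -!EFinD; congr (_%:E).
rewrite [RHS](_ : _ = (a * f x + g x) ^+ 2)//; ring.
Qed.

Lemma ipC (f g : T -> R) : ip f g = ip g f.
Proof. by apply: eq_Rintegral => x _; rewrite mulrC. Qed.

Lemma ip_ge0 (f : T -> R) : 0 <= ip f f.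
Proof. by apply: Rintegral_ge0 => x _; rewrite -expr2 sqr_ge0. Qed.

Lemma ip_linear (a : R) (f g h : T -> R) : sqint f -> sqint g -> sqint h ->
  ip (a *: f + g) h = a * ip f h + ip g h.
Proof.
move=> sf sg sh; rewrite /ip -RintegralZl//; last exact: sqint_mul.
rewrite -RintegralD//; [|exact: integrableZl (sqint_mul sf sh)|exact: sqint_mul].
apply: eq_Rintegral => x _.
rewrite [X in X * _](_ : _ = a * f x + g x)//; ring.
Qed.

Lemma ip_semi_dot : semi_dot sqint ip.
Proof.
by split; [exact: sqint0 | exact: sqint_linear | exact: ipC | exact: ip_linear
  | exact: ip_ge0].
Qed.

Lemma integral_sqr (f : T -> R) : sqint f ->
  (\int[mu]_(x in D) ((f x) ^+ 2)%:E = ((snorm ip f) ^+ 2)%:E)%E.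
Proof.
move=> [mf iF]; rewrite (snorm_sqr ip_semi_dot) /ip /Rintegral.
rewrite fineK; last exact: integrable_fin_num.
by apply: eq_integral => x _; rewrite expr2.
Qed.

End SquareIntegrable.

Section RieszFischer.
Context d (T : measurableType d) (R : realType).
Variables (mu : {measure set T -> \bar R}) (D : set T).
Hypothesis mD : measurable D.
Local Notation S := (sqint mu D).
Local Notation nrm := (snorm (ip mu D)).
Let sd : semi_dot S (ip mu D) := ip_semi_dot mu mD.

Lemma geometric_increments_cvg (u : nat -> R) (M : R) :
  (forall j, `|u j.+1 - u j| <= M / 2 ^+ j) -> cvgn u.
Proof.
move=> uM; have -> : u = (fun n => series (fun j => u j.+1 - u j) n + u 0%N).
  apply/funext => n; rewrite /series/= telescope_sumr// subrK//.
apply: is_cvgD; last exact: is_cvg_cst.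
apply: normed_cvg.
apply: (@series_le_cvg _ _ (geometric M 2^-1)) => //.
- by move=> n; exact: normr_ge0.
- move=> n; rewrite /geometric/= exprVn; apply: le_trans (uM n); exact: normr_ge0.
- by move=> n; rewrite /geometric/= exprVn; exact: uM.
- by apply: is_cvg_geometric_series; rewrite ger0_norm// invf_lt1// ltr1n.
Qed.

(** Increments of size [8^-j] in squared norm leave room for the weights [4^j]:
    the weighted sum of squared increments is integrable, hence finite almost
    everywhere, which makes the sequence converge geometrically there; the norm
    of the limit is then controlled by Fatou's lemma. *)
Lemma rapidly_cauchy_cvg (g : nat -> T -> R) :
  (forall j, S (g j)) ->
  (forall j k, (j <= k)%N -> nrm (g k - g j) ^+ 2 <= (8 ^+ j)^-1) ->
  exists2 f, S f & forall j, nrm (g j - f) ^+ 2 <= (8 ^+ j)^-1.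
Proof.
move=> Sg gc.
have mg j : measurable_fun D (g j) by case: (Sg j).
pose w j x := (4 ^+ j * (g j.+1 x - g j x) ^+ 2)%:E : \bar R.
have w0 j x : (0 <= w j x)%E by rewrite lee_fin mulr_ge0 ?sqr_ge0 ?exprn_ge0.
have mw j : measurable_fun D (w j).
  apply/measurable_EFinP; apply: measurable_funM; first exact: measurable_cst.
  by apply: measurable_funX; exact: measurable_funB.
pose W x := (\sum_(0 <= j <oo) w j x)%E.
have mW : measurable_fun D W by apply: ge0_emeasurable_sum => // k x _ _; exact: w0.
have IW : (\int[mu]_(x in D) W x < +oo)%E.
  rewrite /W integral_nneseries//.
  apply: (@le_lt_trans _ _ (\sum_(0 <= j <oo) (geometric 1 2^-1 j)%:E)%E).
    apply: lee_nneseries => [j _ _|j _]; first exact: integral_ge0.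
    have -> : (\int[mu]_(x in D) w j x =
        (4 ^+ j * nrm (g j.+1 - g j) ^+ 2)%:E)%E.
      rewrite EFinM -integral_sqr//; last exact: (sdB sd).
      rewrite -ge0_integralZl_EFin ?exprn_ge0//.
        by move=> x _; rewrite lee_fin sqr_ge0.
      apply/measurable_EFinP; apply: measurable_funX; exact: measurable_funB.
    rewrite lee_fin /geometric/= mul1r.
    apply: le_trans (ler_wpM2l _ (gc _ _ (leqnSn j))) _; first exact: exprn_ge0.
    by rewrite -exprVn -exprMn (_ : 4 * 8^-1 = 2^-1 :> R)//; field.
  have gcv : cvgn (series (geometric (1:R) 2^-1)).
    by apply: is_cvg_geometric_series; rewrite ger0_norm// invf_lt1// ltr1n.
  rewrite (_ : (\sum_(0 <= j <oo) (geometric (1:R) 2^-1 j)%:E)%E =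
     (limn (series (geometric (1:R) 2^-1)))%:E) ?ltry//.
  rewrite -EFin_lim//; apply: congr_lim; apply/funext => n /=.
  by rewrite sumEFin.
pose A := D `&` [set x | W x < +oo]%E.
have mA : measurable A by exact: emeasurable_fun_infty_o.
have aeA : {ae mu, forall x, D x -> A x}.
  have iW : mu.-integrable D W.
    apply/integrableP; split => //; apply: le_lt_trans IW.
    apply: ge0_le_integral => //; first exact: measurableT_comp.
    by move=> x _; rewrite gee0_abs//; exact: nneseries_ge0.
  have := integrable_ae mD iW; apply: filterS => x xW Dx; split => //=.
  by have := xW Dx; rewrite fin_numElt => /andP[].
have cvgA x : A x -> cvgn (g ^~ x).
  move=> [Dx Wx].
  have W0 : (0 <= W x)%E by exact: nneseries_ge0.
  have Wfin : W x \is a fin_num by rewrite ge0_fin_numE.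
  pose m := fine (W x); have m0 : 0 <= m by exact: fine_ge0.
  apply: (@geometric_increments_cvg _ (Num.sqrt m)) => j.
  have : (w j x <= m%:E)%E.
    rewrite /m fineK// /W (@nneseries_split _ _ 0 j.+1)//.
    rewrite add0n big_nat_recr//= -addeA.
    rewrite -[leLHS]add0e leeD//; first by apply: sume_ge0 => i _; exact: w0.
    by rewrite leeDl//; apply: nneseries_ge0 => i _ _; exact: w0.
  rewrite lee_fin => wm.
  rewrite -ler_sqr ?nnegrE ?divr_ge0 ?sqrtr_ge0 ?exprn_ge0//.
  rewrite real_normK ?num_real// expr_div_n sqr_sqrtr//.
  rewrite ler_pdivlMr ?exprn_gt0// mulrC -exprM mulnC exprM.
  by rewrite (_ : 2 ^+ 2 = 4 :> R)//; ring.
pose f x := if pselect (A x) then limn (g ^~ x) else 0.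
have mf : measurable_fun D f.
  apply: (@measurable_fun_cvg _ _ _ D (fun j x => g j x * \1_A x)) => //.
    by move=> j; apply: measurable_funM => //; exact: measurable_indic.
  move=> x Dx; rewrite /f; case: pselect => Ax.
    rewrite indicE mem_set//= (_ : (fun j => _) = (g ^~ x)).
      exact: cvgA.
    by apply/funext => j; rewrite mulr1.
  rewrite indicE memNset//= (_ : (fun j => _) = cst 0); first exact: cvg_cst.
  by apply/funext => j; rewrite mulr0.
have fatouj j : (\int[mu]_(x in D) ((g j x - f x) ^+ 2)%:E <= ((8 ^+ j)^-1)%:E)%E.
  pose h k x := (((g j x - g k x) * \1_A x) ^+ 2)%:E : \bar R.
  have mh k : measurable_fun D (h k).
    apply/measurable_EFinP; apply: measurable_funX; apply: measurable_funM.
      exact: measurable_funB.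
    exact: measurable_indic.
  have hlim x : D x -> limn_einf (h ^~ x) = (((g j x - f x) * \1_A x) ^+ 2)%:E.
    move=> Dx.
    suff hc : h ^~ x @ \oo --> (((g j x - f x) * \1_A x) ^+ 2)%:E.
      by rewrite is_cvg_limn_einfE; [exact/cvg_lim | apply/cvg_ex; eexists; exact: hc].
    apply: cvg_EFin; first by near=> k.
    apply: (@cvg_comp _ _ _ (fun k => (g j x - g k x) * \1_A x) (fun y => y ^+ 2));
      last exact: exprn_continuous.
    rewrite /f; case: pselect => Ax.
      apply: cvgM; last exact: cvg_cst.
      by apply: cvgB; [exact: cvg_cst | exact: cvgA].
    rewrite indicE memNset//= mulr0 (_ : (fun k => _) = cst 0); first exact: cvg_cst.
    by apply/funext => k; rewrite mulr0.
  apply: (@le_trans _ _ (\int[mu]_(x in D) limn_einf (h ^~ x))%E).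
    rewrite (@eq_integral _ _ _ mu D (fun x => (((g j x - f x) * \1_A x) ^+ 2)%:E)
      (fun x => limn_einf (h ^~ x))); last by move=> x /set_mem; exact: hlim.
    apply: ae_ge0_le_integral => //.
    - by move=> x _; rewrite lee_fin sqr_ge0.
    - by apply/measurable_EFinP; apply: measurable_funX; exact: measurable_funB.
    - by move=> x _; rewrite lee_fin sqr_ge0.
    - apply/measurable_EFinP; apply: measurable_funX; apply: measurable_funM.
        exact: measurable_funB.
      exact: measurable_indic.
    - move: aeA; apply: filterS => x DA Dx.
      by rewrite indicE mem_set ?mulr1//; exact: DA.
  apply: (le_trans (fatou mu mD mh _)).
    by move=> n x _; rewrite lee_fin sqr_ge0.
  rewrite limn_einf_lim; apply: lime_le; first exact: is_cvg_einfs.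
  near=> n; apply: (@le_trans _ _ (\int[mu]_(x in D) h (maxn n j) x)%E).
    by apply: ereal_inf_lbound; exists (maxn n j) => //=; exact: leq_maxl.
  apply: (@le_trans _ _ (\int[mu]_(x in D) ((g (maxn n j) x - g j x) ^+ 2)%:E)%E).
    apply: ge0_le_integral => //.
    - by move=> x _; rewrite lee_fin sqr_ge0.
    - by apply/measurable_EFinP; apply: measurable_funX; exact: measurable_funB.
    - move=> x _; rewrite lee_fin exprMn indicE -natrX.
      rewrite -[leRHS]mulr1 -sqrrN opprB ler_wpM2l ?sqr_ge0//.
      by case: (_ \in _); rewrite ?expr1n ?expr0n.
  rewrite integral_sqr//; last exact: (sdB sd).
  by rewrite lee_fin; apply: gc; exact: leq_maxr.
have S1 j : S (g j - f).
  apply: sqint_lty => //; first exact: measurable_funB.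
  by apply: le_lt_trans (fatouj j) _; rewrite ltry.
exists f.
  by rewrite -[f](subKr (g 0%N)); exact: (sdB sd).
by move=> j; have := fatouj j; rewrite (integral_sqr mD (S1 j)) lee_fin.
Unshelve. all: end_near.
Qed.

Theorem riesz_fischer (g : nat -> T -> R) :
  (forall j, S (g j)) ->
  (forall eps : R, 0 < eps -> exists N, forall m n, (N <= m)%N -> (N <= n)%N ->
    nrm (g m - g n) < eps) ->
  exists2 f, S f & nrm (g n - f) @[n --> \oo] --> (0 : R).
Proof.
move=> Sg gC.
have /choice[N NP] (j : nat) : exists N, forall m n, (N <= m)%N -> (N <= n)%N ->
    nrm (g m - g n) < Num.sqrt ((8 ^+ j)^-1).
  by apply: gC; rewrite sqrtr_gt0 invr_gt0 exprn_gt0.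
pose M j := \max_(i < j.+1) N i.
have NM j : (N j <= M j)%N by rewrite /M (leq_bigmax (ord_max : 'I_j.+1)).
have MM j k : (j <= k)%N -> (M j <= M k)%N.
  move=> jk; apply/bigmax_leqP => i _.
  exact: (@leq_bigmax _ (fun i : 'I_k.+1 => N i) (widen_ord (jk : (j.+1 <= k.+1)%N) i)).
have [|f Sf fP] := @rapidly_cauchy_cvg (g \o M) (fun j => Sg (M j)).
  move=> j k jk; rewrite -[leRHS]sqr_sqrtr ?invr_ge0 ?exprn_ge0//.
  rewrite ler_sqr ?nnegrE ?sqrtr_ge0//; apply/ltW/NP => //.
  by apply: leq_trans (MM _ _ jk); exact: NM.
exists f => //; apply/cvgrPdist_le => /= eps eps0.
have [j jeps] : exists j, Num.sqrt ((8 ^+ j)^-1) <= eps / 2 :> R.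
  have : (8^-1 ^+ j @[j --> \oo] --> (0 : R)).
    by apply: cvg_expr; rewrite ger0_norm// invf_lt1// ltr1n.
  move=> /cvgrPdist_le /(_ ((eps / 2) ^+ 2)).
  rewrite exprn_gt0 ?divr_gt0// => /(_ isT)[j _ /(_ j (leqnn j))] /=.
  rewrite sub0r normrN ger0_norm ?exprn_ge0 ?invr_ge0// => h; exists j.
  rewrite -ler_sqr ?nnegrE ?sqrtr_ge0 ?divr_ge0 ?(ltW eps0)//.
  by rewrite sqr_sqrtr ?invr_ge0 ?exprn_ge0// -exprVn.
near=> n; rewrite sub0r normrN ger0_norm ?sqrtr_ge0//.
apply: le_trans (sdist_triangle sd (Sg n) (Sg (M j)) Sf) _.
rewrite [eps]splitr lerD//.
  apply: le_trans jeps; apply/ltW/NP; last exact: NM.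
  by near: n; exists (N j).
apply: le_trans jeps; rewrite -ler_sqr ?nnegrE ?sqrtr_ge0//.
by rewrite [leRHS]sqr_sqrtr ?invr_ge0 ?exprn_ge0//; exact: fP.
Unshelve. all: end_near.
Qed.

End RieszFischer.
(** * Square-integrable vector fields on the square *)

Section VectorFields.
Context {R : realType}.

Local Notation leb2 := (@lebesgue_measure R \x @lebesgue_measure R)%E.

Lemma measurable_dom : measurable (@dom R).
Proof. by apply: measurableX; exact: measurable_itv. Qed.

Definition L2field : set (vfield R) := [set u | forall i, L2dom (u i)].

Lemma dotL2E (u v : vfield R) : dotL2 u v = \sum_i ip leb2 dom (u i) (v i).
Proof. by []. Qed.

Lemma normL2E (u : vfield R) : normL2 u = snorm dotL2 u. Proof. by []. Qed.

Lemma dotL2_semi_dot : semi_dot L2field (@dotL2 R).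
Proof.
have sd := ip_semi_dot leb2 measurable_dom; split.
- by move=> i; exact: (sd0 sd).
- by move=> a u v Su Sv i; exact: (sdL sd a (Su i) (Sv i)).
- by move=> u v; apply: eq_bigr => i _; exact: (sdC sd (u i) (v i)).
- move=> a u v w Su Sv Sw; rewrite !dotL2E mulr_sumr -big_split.
  by apply: eq_bigr => i _; exact: (sd_linear sd a (Su i) (Sv i) (Sw i)).
- by move=> u; apply: sumr_ge0 => i _; exact: (sd_ge0 sd).
Qed.

Lemma ip_le_normL2 (u : vfield R) i : snorm (ip leb2 dom) (u i) <= normL2 u.
Proof.
have sd := ip_semi_dot leb2 measurable_dom.
rewrite ler_sqrt; last exact: (sd_ge0 dotL2_semi_dot).
rewrite dotL2E (bigD1 i)//= lerDl; apply: sumr_ge0 => j _; exact: (sd_ge0 sd).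
Qed.

Lemma L2field_complete (u : nat -> vfield R) :
  (forall n, L2field (u n)) ->
  (forall eps : R, 0 < eps -> exists N, forall m n, (N <= m)%N -> (N <= n)%N ->
    normL2 (u m - u n) < eps) ->
  exists2 v, L2field v & cvgL2 u v.
Proof.
move=> Su uC; have sd := ip_semi_dot leb2 measurable_dom.
have /choice[v vP] (i : 'I_2) : exists f, L2dom f /\
    snorm (ip leb2 dom) (u n i - f) @[n --> \oo] --> (0 : R).
  have [||f Sf fP] := riesz_fischer measurable_dom (g := fun n => u n i) (mu := leb2).
  - by move=> n; exact: Su.
  - move=> eps /uC[N NP]; exists N => m n Nm Nn.
    exact: le_lt_trans (ip_le_normL2 (u m - u n) i) (NP m n Nm Nn).
  - by exists f.
exists v; first by move=> i; case: (vP i).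
rewrite /cvgL2 -(@sqrtr0 R).
apply: (@cvg_comp _ _ _ (fun n => dotL2 (u n - v) (u n - v)) Num.sqrt);
  last exact: sqrt_continuous.
rewrite [X in X @ _ --> _](_ : _ = fun n => \sum_(i < 2)
    ip leb2 dom (u n i - v i) (u n i - v i)); last by apply/funext.
rewrite [X in _ --> X](_ : 0 = \sum_(i < 2) (0 : R)); last by rewrite big1.
apply: (cvg_big (op := +%R)) => [|i _]; first exact: add_continuous.
 have [_] := vP i.
rewrite (_ : (fun n => ip _ _ _ _) = fun n => snorm (ip leb2 dom) (u n i - v i) ^+ 2).
  move=> h; rewrite [X in _ --> X](_ : 0 = 0 ^+ 2); last by rewrite expr0n.
  by apply: (@cvg_comp _ _ _ _ (fun y : R => y ^+ 2)); [exact: h | exact: exprn_continuous].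
by apply/funext => n; rewrite (snorm_sqr sd).
Qed.

End VectorFields.
(** * Calculus of test functions on the square *)

(** The partial derivatives, locked so that distinct derivatives are told apart
    without unfolding the limits that define them. *)
HB.lock Definition d1 (R : realType) (f : R * R -> R) : R * R -> R :=
  'D_(axis ord0) f.
HB.lock Definition d2 (R : realType) (f : R * R -> R) : R * R -> R :=
  'D_(axis ord_max) f.

Section Axis.
Context {R : realType}.
Implicit Types f g : R * R -> R.

Lemma d1E f : d1 f = 'D_(axis ord0) f. Proof. by rewrite d1.unlock. Qed.
Lemma d2E f : d2 f = 'D_(axis ord_max) f. Proof. by rewrite d2.unlock. Qed.

Lemma axis0E : axis (ord0 : 'I_2) = (1, 0) :> R * R. Proof. by []. Qed.
Lemma axis1E : axis (ord_max : 'I_2) = (0, 1) :> R * R. Proof. by []. Qed.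

Lemma is_derive_fst f (s y : R) : derivable f (s, y) (axis ord0) ->
  is_derive s 1 (fun r => f (r, y)) (d1 f (s, y)).
Proof.
have E : (fun h : R => h^-1 *: ((f \o shift (s, y)) (h *: (axis ord0 : R * R)) - f (s, y))) =
    (fun h : R => h^-1 *: (((fun r => f (r, y)) \o shift s) (h *: 1) - f (s, y))).
  apply/funext => h /=; congr (_ *: (f _ - _)).
  by rewrite axis0E; congr (_, _) => /=; rewrite scaler0 add0r.
by move=> df; split; [move: df; rewrite /derivable E | rewrite ?d1E ?d2E /derive E].
Qed.

Lemma is_derive_snd f (x t : R) : derivable f (x, t) (axis ord_max) ->
  is_derive t 1 (fun r => f (x, r)) (d2 f (x, t)).
Proof.
have E : (fun h : R => h^-1 *: ((f \o shift (x, t)) (h *: (axis ord_max : R * R)) - f (x, t))) =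
    (fun h : R => h^-1 *: (((fun r => f (x, r)) \o shift t) (h *: 1) - f (x, t))).
  apply/funext => h /=; congr (_ *: (f _ - _)).
  by rewrite axis1E; congr (_, _) => /=; rewrite scaler0 add0r.
by move=> df; split; [move: df; rewrite /derivable E | rewrite ?d1E ?d2E /derive E].
Qed.

Lemma continuous_fst f (y : R) : continuous f -> continuous (fun s => f (s, y)).
Proof.
move=> cf s; apply: (@cvg_comp _ _ _ (fun r => (r, y)) f _ (nbhs (s, y))); last exact: cf.
exact: (@cvg_pair _ _ _ (nbhs (s : R)) (nbhs (s : R)) (nbhs (y : R)) _ _ _ (fun r => r)
  (fun=> y) cvg_id (cvg_cst _)).
Qed.

Lemma continuous_snd f (x : R) : continuous f -> continuous (fun t => f (x, t)).
Proof.
move=> cf s; apply: (@cvg_comp _ _ _ (fun r => (x, r)) f _ (nbhs (x, s))); last exact: cf.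
exact: (@cvg_pair _ _ _ (nbhs (s : R)) (nbhs (x : R)) (nbhs (s : R)) _ _ _ (fun=> x)
  (fun r => r) (cvg_cst _) cvg_id).
Qed.

(** An open set of the plane is a countable union of rational squares. *)
Lemma continuous2_measurable f : continuous f -> measurable_fun setT f.
Proof.
move=> /continuousP cf.
suff mO (O : set (R * R)) : open O -> measurable O.
  apply: (measurability _ (RGenOpens.measurableE R)) => _ [_ [a [b ->]] <-].
  by rewrite setTI; apply: mO; apply: cf; exact: interval_open.
move=> oO.
pose B (q : rat * rat * nat) : set (R * R) :=
  ball (ratr q.1.1 : R) q.2.+1%:R^-1 `*` ball (ratr q.1.2 : R) q.2.+1%:R^-1.
rewrite (_ : O = \bigcup_q (if `[< B q `<=` O >] then B q else set0)).
  apply: countable_bigcupT_measurable; first exact: countableP.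
  move=> q; case: asboolP => // _.
  by apply: measurableX; exact: measurable_ball.
apply/seteqP; split => [[x y] Oxy|p [q _]]; last by case: asboolP => // + Bp; exact.
move: oO; rewrite openE => /(_ _ Oxy); rewrite /interior/= => /nbhs_ballP[e e0 eO].
have [n ne] : exists n, (n.+1%:R^-1 : R) < e / 2.
  have e20 : 0 < e / 2 by exact: divr_gt0.
  have [n _ /(_ n (leqnn n))] := near_infty_natSinv_lt (PosNum e20).
  by exists n.
have n0 : 0 < (n.+1%:R^-1 : R) by rewrite invr_gt0.
have near_rat (r z : R) : 0 < r -> exists q : rat, ball (ratr q : R) r z.
  move=> r0; have [|q] := @rat_in_itvoo R (z - r) (z + r); first by lra.
  rewrite in_itv/= => /andP[zr rz]; exists q.
  by rewrite /ball/= ltr_norml; apply/andP; split; lra.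
have tri (r a b c : R) : r < e / 2 -> ball a r b -> ball a r c -> ball b e c.
  by rewrite /ball/= !ltr_norml => re /andP[? ?] /andP[? ?]; apply/andP; split; lra.
have [r1 xr] := near_rat _ x n0; have [r2 yr] := near_rat _ y n0.
exists (r1, r2, n) => //.
case: asboolP => [_|nB]; first by split.
exfalso; apply: nB => -[u v] [/= ur vr]; apply: eO.
by split => /=; [exact: tri ne xr ur | exact: tri ne yr vr].
Qed.

End Axis.

Section TestFunctions.
Context {R : realType}.
Implicit Types f g : R * R -> R.
Local Notation leb := (@lebesgue_measure R).
Local Notation leb2 := (@lebesgue_measure R \x @lebesgue_measure R)%E.

Lemma test_continuous f : test_fun f -> continuous f.
Proof. by case=> /(_ 0%N). Qed.

Lemma test_derivable f : test_fun f -> forall i x, derivable f x (axis i).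
Proof. by case=> /(_ 1%N)[_ h] _ _ i x; case: (h i). Qed.

Lemma test_outside f x : test_fun f -> ~ dom x -> f x = 0.
Proof.
move=> [_ _ fdom] ndx; apply/eqP; apply/negP => /negP fx.
by apply: ndx; apply: fdom; exact: subset_closure.
Qed.

Lemma test_D f i : test_fun f -> test_fun ('D_(axis i) f).
Proof.
move=> [fC fK fdom].
(* Off the closed support of f, f vanishes near the point. *)
have supp : closure [set x | 'D_(axis i) f x != 0] `<=` closure [set x | f x != 0].
  rewrite [X in _ `<=` X](closure_id _).1; last exact: closed_closure.
  apply: closure_subset => x /= Dfx; apply: contrapT => xK.
  have : nbhs x (~` closure [set x | f x != 0]).
    by apply: open_nbhs_nbhs; split => //; apply: closed_openC; exact: closed_closure.
  move=> fx0; move/eqP: Dfx; apply.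
  have fz : f x = 0.
    apply/eqP/negP => /negP nfx; apply: xK; exact: subset_closure.
  rewrite /derive; apply/cvg_lim => //.
  apply: cvg_near_cst.
  have : \forall h \near 0^', (~` closure [set x | f x != 0]) (h *: (axis i : R * R) + x).
    apply: (@cvg_within _ (nbhs 0)).
    have : (fun h : R => h *: (axis i : R * R) + x) h @[h --> (0 : R)]
        --> 0 *: (axis i : R * R) + x.
      by apply: cvgD; [apply: cvgZr_tmp; exact: cvg_id | exact: cvg_cst].
    by rewrite scale0r add0r => /(_ _ fx0).
  apply: filterS => h /= nK; rewrite fz subr0.
  suff -> : f (h *: axis i + x) = 0 by rewrite scaler0.
  by apply/eqP/negP => /negP nfx; apply: nK; exact: subset_closure.
split.
- by move=> k; case: (fC k.+1) => _ /(_ i)[].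
- by apply: subclosed_compact supp => //; exact: closed_closure.
- by apply: subset_trans supp fdom.
Qed.

Lemma Ck_linear k a f g : Ck k f -> Ck k g -> Ck k (a *: f + g).
Proof.
elim: k f g => [|k ih] f g /=.
  by move=> cf cg x; apply: cvgD; [apply: cvgZl_tmp; exact: cf | exact: cg].
move=> [cf Df] [cg Dg]; split.
  by move=> x; apply: cvgD; [apply: cvgZl_tmp; exact: cf | exact: cg].
move=> i; have [df Cf] := Df i; have [dg Cg] := Dg i; split.
  by move=> x; apply: derivableD => //; exact: derivableZ.
rewrite (_ : 'D_(axis i) _ = a *: 'D_(axis i) f + 'D_(axis i) g); first exact: ih.
by apply/funext => x; rewrite deriveD ?deriveZ//; exact: derivableZ.
Qed.

Lemma D_linear a f g i : test_fun f -> test_fun g ->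
  'D_(axis i) (a *: f + g) = a *: 'D_(axis i) f + 'D_(axis i) g.
Proof.
move=> tf tg; apply/funext => x.
have df : derivable f x (axis i) by exact: test_derivable.
have dg : derivable g x (axis i) by exact: test_derivable.
have dZ : derivable (a *: f) x (axis i) by exact: derivableZ.
by rewrite (deriveD dZ dg) (deriveZ _ df).
Qed.

Lemma test_linear a f g : test_fun f -> test_fun g -> test_fun (a *: f + g).
Proof.
move=> [fC fK fd] [gC gK gd].
have supp : closure [set x | (a *: f + g) x != 0] `<=`
    closure [set x | f x != 0] `|` closure [set x | g x != 0].
  rewrite -closureU; apply: closure_subset => x /= fgx.
  have [fx|] := eqVneq (f x) 0; last by left.
  have [gx|] := eqVneq (g x) 0; last by right.
  by move: fgx; rewrite -[X in X != 0]/(a * f x + g x) fx gx mulr0 addr0 eqxx.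
split; first by move=> k; exact: Ck_linear.
- by apply: subclosed_compact supp; [exact: closed_closure | exact: compactU].
- by apply: subset_trans supp _ => x [/fd|/gd].
Qed.

Lemma test0 : test_fun (0 : R * R -> R).
Proof.
have E : [set x | (0 : R * R -> R) x != 0] = set0.
  by apply/seteqP; split => x //=; rewrite eqxx.
split; rewrite ?E ?closure0; [|exact: compact0|by []].
elim=> [|k ih] /=; first by move=> x; exact: cvg_cst.
split; first by move=> x; exact: cvg_cst.
move=> i; split; first by move=> x; exact: derivable_cst.
rewrite (_ : 'D_(axis i) _ = 0)//; apply/funext => x; exact: derive_cst.
Qed.

Lemma test_sum (I : Type) (r : seq I) (c : I -> R) (F : I -> R * R -> R) :
  (forall i, test_fun (F i)) -> test_fun (\sum_(i <- r) c i *: F i).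
Proof.
move=> tF; elim: r => [|i r ih]; first by rewrite big_nil; exact: test0.
by rewrite big_cons; exact: test_linear.
Qed.

Lemma D_sum (I : Type) (r : seq I) (c : I -> R) (F : I -> R * R -> R) j :
  (forall i, test_fun (F i)) ->
  'D_(axis j) (\sum_(i <- r) c i *: F i) = \sum_(i <- r) c i *: 'D_(axis j) (F i).
Proof.
move=> tF; elim: r => [|i r ih].
  by rewrite !big_nil; apply/funext => x; exact: derive_cst.
by rewrite !big_cons D_linear ?ih//; exact: test_sum.
Qed.

Lemma test_bounded f : test_fun f -> exists M, forall x, `|f x| <= M.
Proof.
move=> tf; have [_ fK _] := tf.
have : compact (f @` closure [set x | f x != 0]).
  by apply: continuous_compact fK; exact: continuous_subspaceT (test_continuous tf).
move=> /compact_bounded[M [_ /(_ (M + 1))]].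
rewrite ltrDl ltr01 => /(_ isT) fM.
exists (Num.max 0 (M + 1)) => x; rewrite le_max.
have [->|fx] := eqVneq (f x) 0; first by rewrite normr0 lexx.
by apply/orP; right; apply: fM; exists x => //; exact: subset_closure.
Qed.

Lemma dom_area : (leb2 (@dom R) = (pi ^+ 2)%:E)%E.
Proof.
rewrite /dom product_measure1E//= !lebesgue_measure_itv/= lte_fin pi_gt0.
by rewrite -EFinD -EFinM subr0 expr2.
Qed.

Lemma dom_finite : (leb2 (@dom R) < +oo)%E.
Proof. by rewrite dom_area ltry. Qed.

Lemma test_sqint f : test_fun f -> sqint leb2 dom f.
Proof.
move=> tf.
have mf : measurable_fun dom f.
  by apply: measurable_funTS; apply: continuous2_measurable; exact: test_continuous.
split=> //; apply: measurable_bounded_integrable => //.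
- exact: measurable_dom.
- exact: dom_finite.
- exact: measurable_funX.
- have [M fM] := test_bounded tf; exists (M ^+ 2); split; first exact: num_real.
  move=> y My x _ /=; apply: le_trans (ltW My).
  by rewrite normrX ler_sqr ?nnegrE ?normr_ge0//; apply: le_trans (fM x).
Qed.

End TestFunctions.

Section IntegrationByParts.
Context {R : realType}.
Implicit Types f g : R * R -> R.
Local Notation leb := (@lebesgue_measure R).
Local Notation leb2 := (@lebesgue_measure R \x @lebesgue_measure R)%E.

Lemma parts_vanishing (F G f g : R -> R) (a b : R) : a < b ->
  continuous f -> continuous g ->
  (forall x : R, is_derive x 1 F (f x)) -> (forall x : R, is_derive x 1 G (g x)) ->
  F a = 0 -> F b = 0 ->
  (\int[leb]_(x in `[a, b]) (F x * g x)%:E =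
   \int[leb]_(x in `[a, b]) (- (f x * G x))%:E)%E.
Proof.
move=> ab cf cg dF dG Fa Fb.
have cF : continuous F.
  by move=> x; apply/differentiable_continuous/derivable1_diffP; case: (dF x).
have cG : continuous G.
  by move=> x; apply/differentiable_continuous/derivable1_diffP; case: (dG x).
have oo (K k : R -> R) : continuous K -> (forall x : R, is_derive x 1 K (k x)) ->
    derivable_oo_LRcontinuous K a b.
  move=> cK dK; split; first by move=> x _; case: (dK x).
    by apply: cvg_at_right_filter; exact: cK.
  by apply: cvg_at_left_filter; exact: cK.
rewrite (@integration_by_parts R F G f g)//; first last.
- by move=> x _; rewrite derive1E; apply: derive_val.
- exact: (oo _ g).
- exact: continuous_subspaceT.
- by move=> x _; rewrite derive1E; apply: derive_val.
- exact: (oo _ f).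
- exact: continuous_subspaceT.
rewrite Fa Fb !mul0r subrr sub0e -integralN//.
apply: integrable_add_def; first exact: measurable_itv.
apply: (@continuous_compact_integrable R (fun x => f x * G x) `[a, b]).
  exact: segment_compact.
by apply: continuous_subspaceT => x; apply: cvgM; [exact: cf | exact: cG].
Qed.

(** The value outside the square being zero, the integral over the square is an
    iterated integral over the two axes, in whichever order. *)
Lemma integral_dom_eq (h k : R * R -> R) :
  (forall x, ~ dom x -> h x = 0) -> (forall x, ~ dom x -> k x = 0) ->
  leb2.-integrable dom (EFin \o h) -> leb2.-integrable dom (EFin \o k) ->
  (forall x, \int[leb]_(y in `[0%R, pi]) (h (x, y))%:E =
             \int[leb]_(y in `[0%R, pi]) (k (x, y))%:E)%E \/
  (forall y, \int[leb]_(x in `[0%R, pi]) (h (x, y))%:E =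
             \int[leb]_(x in `[0%R, pi]) (k (x, y))%:E)%E ->
  \int[leb2]_(x in dom) h x = \int[leb2]_(x in dom) k x.
Proof.
have E1 (l : R * R -> R) : (forall x, ~ dom x -> l x = 0) ->
    (EFin \o l) \_ dom = EFin \o l.
  move=> l0; apply/funext => x; rewrite /patch; case: ifPn => // /negP nx /=.
  by rewrite l0// => dx; apply: nx; exact: mem_set.
have Ey (l : R * R -> R) x : (forall x, ~ dom x -> l x = 0) ->
    (\int[leb]_(y in `[0%R, pi]) (l (x, y))%:E = \int[leb]_y (l (x, y))%:E)%E.
  move=> l0; rewrite integral_mkcond; apply: eq_integral => y _.
  rewrite /patch; case: ifPn => // /negP ny; rewrite l0//= => -[_ /= dy].
  by apply: ny; apply: mem_set; exact: subset_itv_oo_cc.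
have Ex (l : R * R -> R) y : (forall x, ~ dom x -> l x = 0) ->
    (\int[leb]_(x in `[0%R, pi]) (l (x, y))%:E = \int[leb]_x (l (x, y))%:E)%E.
  move=> l0; rewrite integral_mkcond; apply: eq_integral => x _.
  rewrite /patch; case: ifPn => // /negP nx; rewrite l0//= => -[/= dx _].
  by apply: nx; apply: mem_set; exact: subset_itv_oo_cc.
move=> h0 k0 ih ik hk; rewrite /Rintegral; congr fine.
have md := @measurable_dom R.
have := (@integrable_mkcond _ _ _ leb2 dom (EFin \o h) md).1 ih; rewrite E1// => ih'.
have := (@integrable_mkcond _ _ _ leb2 dom (EFin \o k) md).1 ik; rewrite E1// => ik'.
have Ed (l : R * R -> R) : (forall x, ~ dom x -> l x = 0) ->
    (\int[leb2]_(x in dom) (l x)%:E = \int[leb2]_x (l x)%:E)%E.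
  by move=> l0; rewrite integral_mkcond; congr (integral _ _ _); exact: E1.
rewrite Ed// Ed//.
case: hk => hk.
  rewrite -(integral12_prod_meas1 ih') -(integral12_prod_meas1 ik').
  by apply: eq_integral => x _; rewrite /fubini_F -Ey// hk Ey.
rewrite -(integral21_prod_meas1 ih') -(integral21_prod_meas1 ik').
by apply: eq_integral => y _; rewrite /fubini_G -Ex// hk Ex.
Qed.

Lemma test_parts f g i : test_fun f -> test_fun g ->
  ip leb2 dom f ('D_(axis i) g) = - ip leb2 dom ('D_(axis i) f) g.
Proof.
move=> tf tg.
have sf := test_sqint tf; have sg := test_sqint tg.
have tdf := test_D i tf; have tdg := test_D i tg.
have sdf := test_sqint tdf; have sdg := test_sqint tdg.
have md := @measurable_dom R.
have sd := ip_semi_dot leb2 md.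
rewrite -(dotNl sd)//; apply: integral_dom_eq.
- by move=> x nx; rewrite (test_outside tf)// mul0r.
- by move=> x nx; rewrite (test_outside tg)// mulr0.
- exact: sqint_mul.
- by apply: sqint_mul => //; exact: (sdN sd).
have pi0 := @pi_gt0 R.
have [i0|i1] : i = ord0 \/ i = ord_max.
- by case: i {tdf tdg sdf sdg} => [[|[|]]]// ?; [left|right]; exact: val_inj.
- right => y; rewrite i0 in tdf tdg *.
  have E : (\int[leb]_(x in `[0%R, pi]) (- ('D_(axis ord0) f (x, y) * g (x, y)))%:E =
      \int[leb]_(x in `[0%R, pi]) ((- 'D_(axis ord0) f) (x, y) * g (x, y))%:E)%E.
    by apply: eq_integral => x _; rewrite -mulNr.
  apply: etrans E.
  apply: (@parts_vanishing (fun x => f (x, y)) (fun x => g (x, y))) => //.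
  + exact: (@continuous_fst _ ('D_(axis ord0) f) y (test_continuous tdf)).
  + exact: (@continuous_fst _ ('D_(axis ord0) g) y (test_continuous tdg)).
  + by move=> x; have := is_derive_fst (@test_derivable _ _ tf ord0 (x, y)); rewrite d1E.
  + by move=> x; have := is_derive_fst (@test_derivable _ _ tg ord0 (x, y)); rewrite d1E.
  + by rewrite (test_outside tf)// => -[]; rewrite /= in_itv/= ltxx.
  + by rewrite (test_outside tf)// => -[]; rewrite /= in_itv/= ltxx andbF.
- left => x; rewrite i1 in tdf tdg *.
  have E : (\int[leb]_(y in `[0%R, pi]) (- ('D_(axis ord_max) f (x, y) * g (x, y)))%:E =
      \int[leb]_(y in `[0%R, pi]) ((- 'D_(axis ord_max) f) (x, y) * g (x, y))%:E)%E.
    by apply: eq_integral => y _; rewrite -mulNr.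
  apply: etrans E.
  apply: (@parts_vanishing (fun y => f (x, y)) (fun y => g (x, y))) => //.
  + exact: (@continuous_snd _ ('D_(axis ord_max) f) x (test_continuous tdf)).
  + exact: (@continuous_snd _ ('D_(axis ord_max) g) x (test_continuous tdg)).
  + by move=> y; have := is_derive_snd (@test_derivable _ _ tf ord_max (x, y)); rewrite d2E.
  + by move=> y; have := is_derive_snd (@test_derivable _ _ tg ord_max (x, y)); rewrite d2E.
  + by rewrite (test_outside tf)// => -[_]; rewrite /= in_itv/= ltxx.
  + by rewrite (test_outside tf)// => -[_]; rewrite /= in_itv/= ltxx andbF.
Qed.

(** Both mixed derivatives are values of the second difference over a small
    square divided by its area, taken at two points of that square. *)
Lemma mixed_partialsC f : test_fun f -> d2 (d1 f) = d1 (d2 f).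
Proof.
move=> tf; apply/funext => -[x y].
have tD1 : test_fun (d1 f) by rewrite d1E; exact: test_D.
have tD2 : test_fun (d2 f) by rewrite d2E; exact: test_D.
have diff2 (F : R -> R) (F' : R -> R) (u h : R) : 0 < h ->
    (forall s : R, is_derive s 1 F (F' s)) ->
    exists2 c, c \in `]u, u + h[ & F (u + h) - F u = F' c * h.
  move=> h0 dF; have uh : u < u + h by rewrite ltrDl.
  have [|c cu ->] := MVT uh (fun s _ => dF s).
  - apply: continuous_subspaceT => s.
    by apply/differentiable_continuous/derivable1_diffP; case: (dF s).
  - by exists c => //; rewrite addrAC subrr add0r.
have near_eq (e : R) : 0 < e -> `|d2 (d1 f) (x, y) - d1 (d2 f) (x, y)| <= e + e.
  move=> e0.
  have c21 : continuous (d2 (d1 f)).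
    by apply: test_continuous; rewrite d1E d2E; do 2 apply: test_D.
  have c12 : continuous (d1 (d2 f)).
    by apply: test_continuous; rewrite d1E d2E; do 2 apply: test_D.
  have /cvgrPdist_le /(_ _ e0) /nbhs_ballP[r1 r10 H1] := c21 (x, y).
  have /cvgrPdist_le /(_ _ e0) /nbhs_ballP[r2 r20 H2] := c12 (x, y).
  pose h := Num.min r1 r2.
  have h0 : 0 < h by rewrite lt_min r10 r20.
  have close (u c : R) : c \in `]u, u + h[ -> `|u - c| < h.
    rewrite in_itv/= => /andP[? ?]; rewrite ltr_norml; apply/andP; split; lra.
  have [a1 a1x E1] := diff2 (fun s => f (s, y + h) - f (s, y))
    (fun s => d1 f (s, y + h) - d1 f (s, y)) x h h0
    (fun s => is_deriveB (is_derive_fst (@test_derivable _ _ tf ord0 _))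
                         (is_derive_fst (@test_derivable _ _ tf ord0 _))).
  have [b1 b1y E2] := diff2 (fun t => d1 f (a1, t)) (fun t => d2 (d1 f) (a1, t)) y h h0
    (fun t => is_derive_snd (@test_derivable _ _ tD1 ord_max _)).
  have [b2 b2y E3] := diff2 (fun t => f (x + h, t) - f (x, t))
    (fun t => d2 f (x + h, t) - d2 f (x, t)) y h h0
    (fun s => is_deriveB (is_derive_snd (@test_derivable _ _ tf ord_max _))
                         (is_derive_snd (@test_derivable _ _ tf ord_max _))).
  have [a2 a2x E4] := diff2 (fun s => d2 f (s, b2)) (fun s => d1 (d2 f) (s, b2)) x h h0
    (fun t => is_derive_fst (@test_derivable _ _ tD2 ord0 _)).
  have E : d2 (d1 f) (a1, b1) = d1 (d2 f) (a2, b2).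
    apply: (@mulIf _ (h * h)); first by rewrite mulf_neq0 ?gt_eqF.
    have E12 : d2 (d1 f) (a1, b1) * h * h =
        f (x + h, y + h) - f (x + h, y) - (f (x, y + h) - f (x, y)).
      by rewrite -E2; exact: esym.
    have E34 : d1 (d2 f) (a2, b2) * h * h =
        f (x + h, y + h) - f (x, y + h) - (f (x + h, y) - f (x, y)).
      by rewrite -E4; exact: esym.
    apply: (etrans (mulrA _ _ _)); apply: (etrans E12).
    apply: esym; apply: (etrans (mulrA _ _ _)); apply: (etrans E34).
    by move: (f _) (f _) (f _) (f _) => p q r s; ring.
  apply: le_trans (ler_distD (d2 (d1 f) (a1, b1)) _ _) _; apply: lerD.
    apply: H1; split => /=; rewrite /ball/=.
      by apply: lt_le_trans (close _ _ a1x) _; rewrite ge_min lexx.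
    by apply: lt_le_trans (close _ _ b1y) _; rewrite ge_min lexx.
  rewrite E distrC; apply: H2; split => /=; rewrite /ball/=.
    by apply: lt_le_trans (close _ _ a2x) _; rewrite ge_min lexx orbT.
  by apply: lt_le_trans (close _ _ b2y) _; rewrite ge_min lexx orbT.
apply/eqP; rewrite -subr_eq0 -normr_le0; apply/ler_addgt0Pl => e e0.
by rewrite addr0 [e]splitr; apply: near_eq; exact: divr_gt0.
Qed.

End IntegrationByParts.

(** * Agmon's inequality *)

Section Agmon.
Context {R : realType}.
Implicit Types f g : R * R -> R.
Local Notation leb := (@lebesgue_measure R).
Local Notation leb2 := (@lebesgue_measure R \x @lebesgue_measure R)%E.
Local Notation dot := (ip leb2 (@dom R)).
Local Notation nrm := (snorm dot).
Let md := @measurable_dom R.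
Let sd : semi_dot (sqint leb2 (@dom R)) dot := ip_semi_dot leb2 md.

Definition lap f := d1 (d1 f) + d2 (d2 f).

Lemma test_d1 f : test_fun f -> test_fun (d1 f).
Proof. by rewrite d1E; exact: test_D. Qed.

Lemma test_d2 f : test_fun f -> test_fun (d2 f).
Proof. by rewrite d2E; exact: test_D. Qed.

Lemma test_lap f : test_fun f -> test_fun (lap f).
Proof.
by move=> tf; rewrite /lap -[d1 _]scale1r; apply: test_linear;
  [do 2 apply: test_d1 | do 2 apply: test_d2].
Qed.

Lemma parts1 f g : test_fun f -> test_fun g -> dot f (d1 g) = - dot (d1 f) g.
Proof. by rewrite !d1E; exact: test_parts. Qed.

Lemma parts2 f g : test_fun f -> test_fun g -> dot f (d2 g) = - dot (d2 f) g.
Proof. by rewrite !d2E; exact: test_parts. Qed.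

Lemma nrm_normr g : nrm (fun z => `|g z|) = nrm g.
Proof.
congr Num.sqrt; apply: eq_Rintegral => z _.
by rewrite -normrM ger0_norm// -expr2 sqr_ge0.
Qed.

Lemma gradient_le f : test_fun f ->
  nrm (d1 f) ^+ 2 + nrm (d2 f) ^+ 2 <= nrm f * nrm (lap f).
Proof.
move=> tf; rewrite (snorm_sqr sd (d1 f)) (snorm_sqr sd (d2 f)).
have t1 := test_d1 tf; have t2 := test_d2 tf.
have sf := test_sqint tf.
have s1 := test_sqint (test_d1 t1); have s2 := test_sqint (test_d2 t2).
have -> : dot (d1 f) (d1 f) + dot (d2 f) (d2 f) = dot (lap f) (- f).
  rewrite (dotNr sd)//; last exact: (sdD sd).
  rewrite (dotDl sd)// opprD -(parts1 t1 tf) -(parts2 t2 tf).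
  by [].
apply: le_trans (dot_le sd _ _) _; [exact: (sdD sd) | exact: (sdN sd)|].
by rewrite (snormN sd)// mulrC.
Qed.

(** Integrating by parts twice turns the square norm of the mixed derivative into
    the pairing of the two pure second derivatives, the cross term of
    [|lap f|^2]. *)
Lemma mixed_le f : test_fun f -> 2 * nrm (d2 (d1 f)) ^+ 2 <= nrm (lap f) ^+ 2.
Proof.
move=> tf; rewrite (snorm_sqr sd (d2 (d1 f))) (snorm_sqr sd (lap f)).
have t1 := test_d1 tf; have t2 := test_d2 tf.
have t11 := test_d1 t1; have t22 := test_d2 t2; have t12 := test_d2 t1.
have s1 := test_sqint t11; have s2 := test_sqint t22.
have -> : dot (d2 (d1 f)) (d2 (d1 f)) = dot (d2 (d2 f)) (d1 (d1 f)).
  have -> : dot (d2 (d1 f)) (d2 (d1 f)) = - dot (d2 (d2 (d1 f))) (d1 f).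
    exact: parts2.
  have -> : d2 (d2 (d1 f)) = d1 (d2 (d2 f)).
    by rewrite (mixed_partialsC tf) (mixed_partialsC t2).
  by apply/esym; exact: parts1.
have s12 := sdD sd s1 s2.
rewrite /lap (dotDl sd)// !(dotDr sd)// (sdC sd (d1 (d1 f)) (d2 (d2 f))).
have := sd_ge0 sd (d1 (d1 f)); have := sd_ge0 sd (d2 (d2 f)).
by lra.
Qed.

Lemma vanishing_le_integral (F F' : R -> R) (x : R) : 0 <= x <= pi ->
  continuous F' -> (forall s : R, is_derive s 1 F (F' s)) -> F 0 = 0 ->
  (`|F x|%:E <= \int[leb]_(s in `[0%R, pi]) `|F' s|%:E)%E.
Proof.
move=> /andP[x0 xpi] cF' dF F0.
have cF : continuous F.
  by move=> s; apply/differentiable_continuous/derivable1_diffP; case: (dF s).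
have mF' (D : set R) : measurable_fun D F'.
  by apply: measurable_funTS; exact: continuous_measurable_fun.
have [->|xn0] := eqVneq x 0.
  by rewrite F0 normr0; apply: integral_ge0 => s _; rewrite lee_fin.
have xp : 0 < x by rewrite lt_neqAle eq_sym xn0.
have FTC : (\int[leb]_(s in `[0%R, x]) (F' s)%:E = (F x)%:E)%E.
  rewrite (@continuous_FTC2 R F' F)// ?F0 ?sube0//.
  - exact: continuous_subspaceT.
  - split; first by move=> s _; case: (dF s).
      by apply: cvg_at_right_filter; exact: cF.
    by apply: cvg_at_left_filter; exact: cF.
  - by move=> s _; rewrite derive1E; apply: derive_val.
rewrite -abse_EFin -FTC; apply: le_trans (le_abse_integral _ _ _) _ => //.
  by apply/measurable_EFinP; exact: mF'.
apply: ge0_subset_integral => //; try exact: measurable_itv.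
  by apply/measurable_EFinP; apply: measurableT_comp => //; exact: mF'.
by move=> s /=; rewrite !in_itv/= => /andP[-> sx]; exact: le_trans xpi.
Qed.

(** The square [f ^+ 2] vanishes on the boundary, so it is bounded by the
    integral of its mixed second derivative. *)
Lemma test_sqr_le_integral f x : test_fun f -> dom x ->
  (((f x) ^+ 2)%:E <=
    \int[leb2]_(z in dom) (`|2 * (d2 f z * d1 f z + f z * d2 (d1 f) z)|)%:E)%E.
Proof.
case: x => x y tf [/= dx dy].
have t1 := test_d1 tf; have t2 := test_d2 tf; have t12 := test_d2 t1.
have [cf c1 c2 c12] := And4 (test_continuous tf) (test_continuous t1)
  (test_continuous t2) (test_continuous t12).
have cfy : continuous (fun s => f (s, y)) by exact: continuous_fst cf.
have c1y : continuous (fun s => d1 f (s, y)) by exact: continuous_fst c1.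
pose m z := 2 * (d2 f z * d1 f z + f z * d2 (d1 f) z).
have cm : continuous m.
  move=> z; apply: cvgM; first exact: cvg_cst.
  by apply: cvgD; apply: cvgM; [exact: c2 | exact: c1 | exact: cf | exact: c12].
have mm : measurable_fun setT (fun z => `|m z|%:E : \bar R).
  by apply/measurable_EFinP; apply: measurableT_comp => //; exact: continuous2_measurable.
have m0 z : ~ dom z -> m z = 0.
  by move=> nz; rewrite /m (test_outside t1)// (test_outside tf)// mulr0 mul0r addr0 mulr0.
have -> : (\int[leb2]_(z in dom) `|m z|%:E = \int[leb2]_z `|m z|%:E)%E.
  rewrite integral_mkcond; congr (integral _ _ _); apply/funext => z.
  rewrite /patch; case: ifPn => // /negP nz; rewrite m0 ?normr0// => dz.
  by apply: nz; exact: mem_set.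
rewrite fubini_tonelli1//.
have itvI (z : R) : `]0, pi[%classic z -> 0 <= z <= pi.
  by rewrite /= in_itv/= => /andP[/ltW -> /ltW ->].
have Fge0 s : (0 <= fubini_F leb (fun z => `|m z|%:E) s)%E.
  by apply: integral_ge0 => t _; rewrite lee_fin.
have mF : measurable_fun setT (fubini_F leb (fun z => `|m z|%:E)).
  exact: measurable_fun_fubini_tonelli_F.
apply: (@le_trans _ _ (\int[leb]_(s in `[0%R, pi]) `|2 * (f (s, y) * d1 f (s, y))|%:E)%E).
  have := @vanishing_le_integral (fun s => f (s, y) ^+ 2)
    (fun s => 2 * (f (s, y) * d1 f (s, y))) x (itvI _ dx).
  rewrite ger0_norm ?sqr_ge0//; apply.
  - move=> s; apply: cvgM; first exact: cvg_cst.
    by apply: cvgM; [exact: cfy | exact: c1y].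
  - move=> s; have ds := is_derive_fst (@test_derivable _ _ tf ord0 (s, y)).
    have -> : 2 * (f (s, y) * d1 f (s, y)) =
        f (s, y) *: d1 f (s, y) + f (s, y) *: d1 f (s, y).
      by rewrite mulr_natl mulr2n.
    exact: is_deriveM.
  - by rewrite (test_outside tf) ?expr0n// => -[]; rewrite /= in_itv/= ltxx.
apply: (@le_trans _ _ (\int[leb]_(s in `[0%R, pi]) fubini_F leb (fun z => `|m z|%:E) s)%E).
  apply: ge0_le_integral => //.
  - apply/measurable_EFinP; apply: measurableT_comp => //.
    apply: measurable_funTS; apply: continuous_measurable_fun => s.
    apply: cvgM; first exact: cvg_cst.
    by apply: cvgM; [exact: cfy | exact: c1y].
  - exact: measurable_funTS.
  move=> s _; have := @vanishing_le_integral (fun t => 2 * (f (s, t) * d1 f (s, t)))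
    (fun t => m (s, t)) y (itvI _ dy).
  move=> h; apply: le_trans (h _ _ _) _.
  - exact: (continuous_snd cm).
  - move=> t; have d1t := is_derive_snd (@test_derivable _ _ t1 ord_max (s, t)).
    have dt := is_derive_snd (@test_derivable _ _ tf ord_max (s, t)).
    have -> : m (s, t) = 2 *: (f (s, t) *: d2 (d1 f) (s, t) + d1 f (s, t) *: d2 f (s, t)).
      by rewrite /m addrC (mulrC (d2 f _)).
    have dm := is_deriveM dt d1t; exact: is_deriveZ.
  - by rewrite (test_outside tf) ?mul0r ?mulr0// => -[_]; rewrite /= in_itv/= ltxx.
  rewrite /fubini_F; apply: ge0_subset_integral => //; try exact: measurable_itv.
  apply/measurable_EFinP; apply: measurableT_comp => //.
  by apply: continuous_measurable_fun; exact: (continuous_snd cm).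
by apply: ge0_subset_integral => //; exact: measurable_itv.
Qed.

(** By Cauchy-Schwarz, the integral of the mixed derivative of [f ^+ 2] is
    controlled by the gradient and the mixed derivative of [f], both of which the
    Laplacian dominates. *)
Lemma agmon f x : test_fun f -> dom x -> f x ^+ 2 <= 3 * (nrm f * nrm (lap f)).
Proof.
move=> tf dx.
have t1 := test_d1 tf; have t2 := test_d2 tf; have t12 := test_d2 t1.
pose a (g : R * R -> R) : R * R -> R := fun z => `|g z|.
have sa g : test_fun g -> sqint leb2 dom (a g).
  move=> /test_sqint sg; apply: sqint_le (sg) _ => //.
    by apply: measurableT_comp => //; case: sg.
  by move=> z _; rewrite /a real_normK ?num_real.
have na g : nrm (a g) = nrm g by exact: nrm_normr.
have key : f x ^+ 2 <= 2 * dot (a (d2 f)) (a (d1 f)) + 2 * dot (a f) (a (d2 (d1 f))).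
  have i1 := @integrableZl _ _ _ leb2 dom md 2 _
    (@sqint_mul _ _ _ leb2 dom md _ _ (sa _ t2) (sa _ t1)).
  have i2 := @integrableZl _ _ _ leb2 dom md 2 _
    (@sqint_mul _ _ _ leb2 dom md _ _ (sa _ tf) (sa _ t12)).
  have i12 := @integrableD _ _ _ leb2 dom md _ _ i1 i2.
  rewrite -lee_fin; apply: le_trans (test_sqr_le_integral tf dx) _.
  rewrite /ip -!RintegralZl//; [|by apply: sqint_mul => //; exact: sa..].
  rewrite -RintegralD// /Rintegral fineK; last exact: integrable_fin_num.
  apply: ge0_le_integral => //.
  - apply/measurable_EFinP; apply: measurableT_comp => //; apply: measurable_funTS.
    apply: continuous2_measurable => z; apply: cvgM; first exact: cvg_cst.
    by apply: cvgD; apply: cvgM; apply: test_continuous.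
  - exact: (measurable_int _ i12).
  - move=> z _; rewrite lee_fin normrM ger0_norm// -mulrDr ler_wpM2l//.
    by apply: le_trans (ler_normD _ _) _; rewrite !normrM.
apply: le_trans key _.
have h1 := dot_le sd (sa _ t2) (sa _ t1); have h2 := dot_le sd (sa _ tf) (sa _ t12).
rewrite !na in h1 h2.
have gr := gradient_le tf; have mx := mixed_le tf.
have n0 g : 0 <= nrm g by exact: snorm_ge0.
have mx' : nrm (d2 (d1 f)) <= nrm (lap f).
  rewrite -ler_sqr ?nnegrE//; apply: le_trans mx.
  by rewrite ler_peMl ?sqr_ge0// ler1n.
have := ler_wpM2l (n0 f) mx'; have := sqr_ge0 (nrm (d1 f) - nrm (d2 f)).
move: h1 h2 gr; move: (nrm _) (nrm _) (nrm _) (nrm _) (nrm _) (ip _ _ _ _) (ip _ _ _ _).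
by move=> n1 n2 n3 n4 n5 p1 p2; nra.
Qed.

End Agmon.

(** * Growth of the eigenvalues *)

Section EigenvalueGrowth.
Context {R : realType}.
Local Notation leb2 := (@lebesgue_measure R \x @lebesgue_measure R)%E.
Local Notation dot := (ip leb2 (@dom R)).
Let md := @measurable_dom R.
Let sd : semi_dot (sqint leb2 (@dom R)) dot := ip_semi_dot leb2 md.
Let vd : semi_dot (@L2field R) (@dotL2 R) := dotL2_semi_dot.

Definition test_field (phi : vfield R) := forall i, test_fun (phi i).
Definition lapv (phi : vfield R) : vfield R := fun i => lap (phi i).

Lemma test_L2field phi : test_field phi -> L2field phi.
Proof. by move=> tp i; exact: test_sqint. Qed.

Lemma test_lapv phi : test_field phi -> test_field (lapv phi).
Proof. by move=> tp i; exact: test_lap. Qed.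

Lemma le_sum_indices2 (F : nat -> nat -> R) a b : (forall k l, 0 <= F k l) ->
  (a + b <= 2)%N -> F a b <= \sum_(k < 3) \sum_(l < 3 | (k + l <= 2)%N) F k l.
Proof.
move=> F0 ab.
have a3 : (a < 3)%N by rewrite ltnS (leq_trans _ ab)// leq_addr.
have b3 : (b < 3)%N by rewrite ltnS (leq_trans _ ab)// leq_addl.
rewrite (bigD1 (Ordinal a3))//= (bigD1 (Ordinal b3))//= -addrA lerDl.
apply: addr_ge0; first exact: sumr_ge0.
by apply: sumr_ge0 => k _; exact: sumr_ge0.
Qed.

Lemma normL2_vpartial (u : vfield R) a b : (a + b <= 2)%N ->
  normL2 (vpartial a b u) <= normH2 u.
Proof.
move=> ab; pose F k l := normL2 (vpartial k l u) ^+ 2.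
have F0 k l : 0 <= F k l by exact: sqr_ge0.
rewrite -ler_sqr ?nnegrE ?sqrtr_ge0// [leRHS]sqr_sqrtr.
  exact: (le_sum_indices2 F0 ab).
by apply: sumr_ge0 => k _; apply: sumr_ge0 => l _; exact: F0.
Qed.

Lemma weak_partialP a b (f : R * R -> R) :
  (exists g, is_weak_partial a b f g) ->
  is_weak_partial a b f (weak_partial a b f).
Proof. by move=> h; exact: (xgetPex (fun=> 0) h). Qed.

(** Both sides are weak derivatives of [f - phi] and agree as seen by test
    functions, although the representative picked by [weak_partial] for the
    difference need not be the difference of the representatives. *)
Lemma weak_partial_test_sub a b (f phi pphi : R * R -> R) :
  L2dom f -> test_fun phi -> test_fun pphi ->
  (forall psi : R * R -> R, test_fun psi -> test_fun (partial a b psi)) ->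
  (forall psi : R * R -> R, test_fun psi ->
    dot phi (partial a b psi) = (-1) ^+ (a + b) * dot pphi psi) ->
  (exists g, is_weak_partial a b f g) ->
  L2dom (weak_partial a b (f - phi)) /\
  forall psi : R * R -> R, test_fun psi -> (-1) ^+ (a + b) * dot (weak_partial a b f - pphi) psi =
    (-1) ^+ (a + b) * dot (weak_partial a b (f - phi)) psi.
Proof.
move=> sf tphi tpphi tpart parts exf.
have [sw wP] := weak_partialP exf.
have weak psi : test_fun psi -> dot (f - phi) (partial a b psi) =
    (-1) ^+ (a + b) * dot (weak_partial a b f - pphi) psi.
  move=> tpsi; have tp := tpart _ tpsi.
  rewrite (dotBl sd) ?(dotBl sd)//; try exact: test_sqint.
  by rewrite mulrBr -parts//; congr (_ - _); exact: wP.
have [|sw' wP'] := @weak_partialP a b (f - phi).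
  exists (weak_partial a b f - pphi); split; last exact: weak.
  by apply: (sdB sd) => //; exact: test_sqint.
split; first exact: sw'.
by move=> psi tpsi; exact: (etrans (esym (weak _ tpsi)) (wP' _ tpsi)).
Qed.

(** A field of [V] and its Laplacian are approximated by a test field and its
    Laplacian, in the weak sense of pairings with test fields: this is all that
    the norm of [V] gives before weak derivatives are known to be unique. *)
Lemma spaceV_approx (u : vfield R) (eps : R) : spaceV u -> 0 < eps ->
  exists2 phi, test_field phi & forall psi, test_field psi ->
    `|dotL2 (u - phi) psi| <= eps * normL2 psi /\
    `|dotL2 (laplacian u - lapv phi) psi| <= 2 * eps * normL2 psi.
Proof.
move=> [Hu uV] eps0; have [phi [tphi _] uphi] := uV _ eps0.
exists phi => // psi tpsi.
have spsi := test_L2field tpsi.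
have part a b (pp : vfield R) : (a + b <= 2)%N -> test_field pp ->
    (forall psi : R * R -> R, test_fun psi -> test_fun (partial a b psi)) ->
    (forall i (psi : R * R -> R), test_fun psi ->
      dot (phi i) (partial a b psi) = (-1) ^+ (a + b) * dot (pp i) psi) ->
    `|dotL2 (vpartial a b u - pp) psi| <= eps * normL2 psi.
  move=> ab tpp tpart parts.
  have P i := weak_partial_test_sub (Hu i).1 (tphi i) (tpp i) tpart (parts i)
    ((Hu i).2 a b ab).
  have -> : dotL2 (vpartial a b u - pp) psi = dotL2 (vpartial a b (u - phi)) psi.
    apply: eq_bigr => i _; have [_ /(_ _ (tpsi i)) /(mulfI _)] := P i; apply.
    by rewrite signr_eq0.
  apply: le_trans (cauchy_schwarz vd _ _) _ => //.
    by move=> i; case: (P i).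
  rewrite ler_wpM2r ?snorm_ge0//; apply: le_trans (ltW uphi).
  exact: normL2_vpartial.
have t1 (f : R * R -> R) : test_fun f -> test_fun ('D_(axis ord0) f) by exact: test_D.
have t2 (f : R * R -> R) : test_fun f -> test_fun ('D_(axis ord_max) f) by exact: test_D.
split.
  have -> : dotL2 (u - phi) psi = dotL2 (vpartial 0 0 u - phi) psi.
    apply: eq_bigr => i _.
    have [sw wP] := weak_partialP ((Hu i).2 0%N 0%N isT).
    have sphi := test_sqint (tphi i); have spi := test_sqint (tpsi i).
    have := wP _ (tpsi i); rewrite expr0 mul1r => E.
    apply: (etrans (dotBl sd (Hu i).1 sphi spi)).
    apply: (etrans (congr1 (fun z => z - dot (phi i) (psi i)) E)).
    by apply/esym; exact: (dotBl sd sw sphi spi).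
  apply: (part 0%N 0%N phi) => // i f tf.
  by rewrite expr0 mul1r.
have -> : laplacian u - lapv phi =
    (vpartial 2 0 u - (fun i => d1 (d1 (phi i)))) +
    (vpartial 0 2 u - (fun i => d2 (d2 (phi i)))).
  rewrite addrACA -opprD; congr (_ - _); apply/funext => i.
have H20 : `|dotL2 (vpartial 2 0 u - (fun i => d1 (d1 (phi i)))) psi| <= eps * normL2 psi.
  apply: part => //.
  - by move=> i; do 2 apply: test_d1.
  - by move=> f tf; exact: t1 (t1 _ tf).
  - move=> i f tf; rewrite -signr_odd mul1r.
    have -> : partial 2 0 f = d1 (d1 f) by rewrite !d1E.
    rewrite (parts1 (tphi i) (test_d1 tf)) (parts1 (test_d1 (tphi i)) tf) opprK.
    by [].
have H02 : `|dotL2 (vpartial 0 2 u - (fun i => d2 (d2 (phi i)))) psi| <= eps * normL2 psi.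
  apply: part => //.
  - by move=> i; do 2 apply: test_d2.
  - by move=> f tf; exact: t2 (t2 _ tf).
  - move=> i f tf; rewrite -signr_odd mul1r.
    have -> : partial 0 2 f = d2 (d2 f) by rewrite !d2E.
    rewrite (parts2 (tphi i) (test_d2 tf)) (parts2 (test_d2 (tphi i)) tf) opprK.
    by [].
have sw a b : (a + b <= 2)%N -> L2field (vpartial a b u).
  by move=> ab i; have [] := weak_partialP ((Hu i).2 a b ab).
rewrite (dotDl vd)//; last 2 first.
- apply: (sdB vd); first exact: sw.
  by apply: test_L2field => i; do 2 apply: test_d1.
- apply: (sdB vd); first exact: sw.
  by apply: test_L2field => i; do 2 apply: test_d2.
apply: le_trans (ler_normD _ _) _; rewrite -mulrA mulr_natl mulr2n.
exact: lerD.
Qed.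

Lemma field_sumE (I : finType) (a : I -> R) (F : I -> vfield R) i :
  (\sum_k a k *: F k) i = \sum_k a k *: F k i.
Proof. by rewrite fct_sumE. Qed.

Lemma lapv_sum (I : finType) (a : I -> R) (F : I -> vfield R) :
  (forall k, test_field (F k)) ->
  lapv (\sum_k a k *: F k) = \sum_k a k *: lapv (F k).
Proof.
move=> tF; apply/funext => i.
rewrite field_sumE /lapv field_sumE /lap.
have D1 (G : I -> R * R -> R) : (forall k, test_fun (G k)) ->
    d1 (\sum_k a k *: G k) = \sum_k a k *: d1 (G k).
  by move=> tG; rewrite d1E D_sum//; apply: eq_bigr => k _; rewrite d1E.
have D2 (G : I -> R * R -> R) : (forall k, test_fun (G k)) ->
    d2 (\sum_k a k *: G k) = \sum_k a k *: d2 (G k).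
  by move=> tG; rewrite d2E D_sum//; apply: eq_bigr => k _; rewrite d2E.
have tFi k : test_fun (F k i) by exact: tF.
have tF1 k : test_fun (d1 (F k i)) by exact: test_d1.
have tF2 k : test_fun (d2 (F k i)) by exact: test_d2.
rewrite (D1 _ tFi) (D2 _ tFi) (D1 _ tF1) (D2 _ tF2) -big_split.
by apply: eq_bigr => k _; rewrite scalerDr.
Qed.

Lemma sum_norm_le (n : nat) (a : 'I_n -> R) :
  \sum_k `|a k| <= n%:R * Num.sqrt (\sum_k a k ^+ 2).
Proof.
rewrite mulr_natl -[X in _ *+ X]card_ord -sumr_const ler_sum// => k _.
rewrite -sqrtr_sqr ler_sqrt; last by apply: sumr_ge0 => l _; exact: sqr_ge0.
by rewrite (bigD1 k)//= lerDl; apply: sumr_ge0 => l _; exact: sqr_ge0.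
Qed.

(** If test fields are close to an orthonormal family whose Laplacians are
    orthogonal, Agmon's inequality applied to the combination whose coefficients
    are the values of these very fields at a point bounds the sum of the squares
    of these values. *)
Lemma sum_sqr_test_le (n : nat) (e phi : 'I_n -> vfield R) (lam : 'I_n -> R)
    (Lam eps : R) x i :
  dom x -> 0 <= eps -> eps * n%:R <= 1 -> 2 * eps * n%:R <= Num.sqrt (2 * Lam) ->
  (forall k, lam k <= Lam) -> 0 <= Lam ->
  (forall k, L2field (e k)) -> (forall k, L2field (laplacian (e k))) ->
  (forall k l, dotL2 (e k) (e l) = (k == l)%:R) ->
  (forall k l, dotL2 (laplacian (e k)) (laplacian (e l)) = 2 * lam k * (k == l)%:R) ->
  (forall k, test_field (phi k)) ->
  (forall k psi, test_field psi -> `|dotL2 (e k - phi k) psi| <= eps * normL2 psi) ->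
  (forall k psi, test_field psi ->
    `|dotL2 (laplacian (e k) - lapv (phi k)) psi| <= 2 * eps * normL2 psi) ->
  \sum_k phi k i x ^+ 2 <= 12 * Num.sqrt (2 * Lam).
Proof.
move=> dx eps0 epsn epsL lamL L0 Se Sle oe ole tphi ephi elap.
pose a k := phi k i x; set A := \sum_k _.
have A0 : 0 <= A by apply: sumr_ge0 => k _; exact: sqr_ge0.
pose q := Num.sqrt A; have q0 : 0 <= q by exact: sqrtr_ge0.
have qq : q ^+ 2 = A by rewrite sqr_sqrtr.
have aq : \sum_k `|a k| <= n%:R * q by exact: sum_norm_le.
pose Phi := \sum_k a k *: phi k.
have tPhi : test_field Phi.
  by move=> j; rewrite /Phi field_sumE; apply: test_sum => k; exact: tphi.
have N1 : normL2 Phi <= 2 * q.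
  have := @snorm_sum_dual _ _ _ _ vd _ a phi e eps eps0 _ Se _.
  move=> /(_ (fun k => test_L2field (tphi k)) (fun k => ephi k _ tPhi)) h.
  apply: le_trans h _; rewrite mulr_natl mulr2n lerD//.
    rewrite -ler_sqr ?nnegrE ?snorm_ge0// (snorm_orthogonal vd a (mu := fun=> 1))//.
      by rewrite qq ler_sum// => k _; rewrite mul1r.
    by move=> k l; rewrite oe mul1r.
  apply: le_trans (ler_wpM2l eps0 aq) _; rewrite mulrA.
  by rewrite -[leRHS]mul1r ler_wpM2r.
have N2 : normL2 (lapv Phi) <= 2 * Num.sqrt (2 * Lam) * q.
  rewrite lapv_sum//.
  have := @snorm_sum_dual _ _ _ _ vd _ a (lapv \o phi) (fun k => laplacian (e k))
    (2 * eps) _ _ Sle _.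
  have e20 : 0 <= 2 * eps by exact: mulr_ge0.
  have tl k : test_field (lapv (phi k)) by exact: test_lapv.
  have tPhi' : test_field (\sum_k a k *: lapv (phi k)).
    by rewrite -lapv_sum//; exact: test_lapv.
  move=> /(_ e20 (fun k => test_L2field (tl k)) (fun k => elap k _ tPhi')) h.
  apply: le_trans h _.
  rewrite [leRHS](_ : _ = Num.sqrt (2 * Lam) * q + Num.sqrt (2 * Lam) * q); last by ring.
  rewrite lerD//.
    rewrite -ler_sqr ?nnegrE ?snorm_ge0 ?mulr_ge0 ?sqrtr_ge0//.
    rewrite (snorm_orthogonal vd a (mu := fun k => 2 * lam k))//.
    rewrite exprMn qq sqr_sqrtr ?mulr_ge0// mulr_sumr ler_sum// => k _.
    by rewrite ler_wpM2r ?sqr_ge0// ler_wpM2l.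
  apply: le_trans (ler_wpM2l e20 aq) _; rewrite mulrA.
  by rewrite ler_wpM2r.
have PhiE : Phi i x = A.
  by rewrite /Phi field_sumE fct_sumE; apply: eq_bigr => k _; rewrite expr2.
have ag := agmon (tPhi i) dx.
rewrite PhiE in ag.
have M1 : snorm dot (Phi i) <= 2 * q by apply: le_trans N1; exact: ip_le_normL2.
have M2 : snorm dot (lap (Phi i)) <= 2 * Num.sqrt (2 * Lam) * q.
  by apply: le_trans N2; exact: (ip_le_normL2 (lapv Phi) i).
have [->|Ane] := eqVneq A 0; first by rewrite mulr_ge0 ?sqrtr_ge0.
have Ap : 0 < A by rewrite lt_neqAle eq_sym Ane.
rewrite -(ler_pM2r Ap) -expr2; apply: le_trans ag _.
have -> : 12 * Num.sqrt (2 * Lam) * A = 3 * ((2 * q) * (2 * Num.sqrt (2 * Lam) * q)).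
  by rewrite -qq; ring.
by rewrite ler_wpM2l// ler_pM ?snorm_ge0.
Qed.

(** Weyl's lower bound for the eigenvalues, of the fourth order operator [A] in
    dimension two: the sum over [k <= n] of the squares of the eigenfields is
    bounded pointwise by a multiple of [sqrt (lam n)], while its integral over
    the square is [n + 1]. *)
Theorem eigenvalue_growth (e : nat -> vfield R) (lam : nat -> R) :
  (forall n, spaceH (e n)) ->
  (forall m n, dotL2 (e m) (e n) = (m == n)%:R) ->
  0 < lam 0%N -> (forall n, lam n <= lam n.+1) ->
  (forall n, eigenpairA (e n) (lam n)) ->
  exists2 c : R, 0 < c & forall n, c * n.+1%:R ^+ 2 <= lam n.
Proof.
move=> He oe lam0 lamS eA.
have lamM m n : (m <= n)%N -> lam m <= lam n.
  by have /nondecreasing_seqP := lamS; apply.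
have Se n : L2field (e n) by move=> i; case: (He n).
have Sle n : L2field (laplacian (e n)).
  have [[HV _] _] := eA n.
  apply: (sdD vd) => i.
    by have [] := weak_partialP ((HV i).2 2%N 0%N isT).
  by have [] := weak_partialP ((HV i).2 0%N 2%N isT).
have ole m n : dotL2 (laplacian (e m)) (laplacian (e n)) = 2 * lam m * (m == n)%:R.
  have [_ /(_ _ (eA n).1)] := eA m.
  rewrite /opA oe => E; rewrite -[RHS]mulrA -E mulrA divff ?mul1r//.
(* The pointwise bound 12 sqrt (2 lam n), summed over the two components and
   integrated over the square, has to be compared with n + 1 norms at least 1/4. *)
pose C : R := 96 * pi ^+ 2.
have C0 : 0 < C by rewrite mulr_gt0 ?exprn_gt0 ?pi_gt0.
have CE : C = 96 * pi ^+ 2 by [].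
move: C C0 CE => C C0 CE.
exists (2 * C ^+ 2)^-1; first by rewrite invr_gt0 mulr_gt0 ?exprn_gt0.
move=> n; have ln0 : 0 < lam n by apply: lt_le_trans lam0 _; exact: lamM.
pose s := Num.sqrt (2 * lam n).
have s0 : 0 < s by rewrite sqrtr_gt0 mulr_gt0.
have ss : s ^+ 2 = 2 * lam n by rewrite sqr_sqrtr// mulr_ge0// ltW.
suff nC : n.+1%:R <= C * s.
  rewrite ler_pdivrMl ?mulr_gt0 ?exprn_gt0//.
  rewrite (_ : 2 * C ^+ 2 * lam n = (C * s) ^+ 2).
    by rewrite ler_sqr ?nnegrE// mulr_ge0 ?ltW.
  by rewrite [RHS]exprMn ss; ring.
(* So small that n + 1 errors of this size are negligible before 1 and s. *)
pose eps := (10 * n.+1%:R)^-1 * Num.min 1 s.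
have m0 : 0 < Num.min 1 s by rewrite lt_min ltr01.
have N0 : 0 < n.+1%:R :> R by rewrite ltr0n.
have eps0 : 0 < eps by rewrite mulr_gt0// invr_gt0 mulr_gt0.
have epsN : eps * n.+1%:R = Num.min 1 s / 10.
  by rewrite /eps; field; rewrite nat1r lt0r_neq0.
have epsn : eps * n.+1%:R <= 10^-1.
  by rewrite epsN ler_pdivrMr// mulVf// ge_min lexx.
have epss : 2 * eps * n.+1%:R <= s.
  rewrite -mulrA epsN; have : Num.min 1 s <= s by rewrite ge_min lexx orbT.
  by lra.
have eps10 : eps <= 10^-1.
  by apply: le_trans epsn; rewrite ler_peMr ?(ltW eps0)// ler1n.
have /choice[phi phiP] (k : 'I_n.+1) : exists phi, test_field phi /\
    forall psi, test_field psi ->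
    `|dotL2 (e k - phi) psi| <= eps * normL2 psi /\
    `|dotL2 (laplacian (e k) - lapv phi) psi| <= 2 * eps * normL2 psi.
  by have [phi tphi phiP] := spaceV_approx (eA k).1 eps0; exists phi.
have tphi k : test_field (phi k) by case: (phiP k).
have ephi k psi (tpsi : test_field psi) := ((phiP k).2 psi tpsi).1.
have elap k psi (tpsi : test_field psi) := ((phiP k).2 psi tpsi).2.
have Sphi k := test_L2field (tphi k).
have upper : \sum_k normL2 (phi k) ^+ 2 <= 24 * pi ^+ 2 * s.
  have -> : \sum_k normL2 (phi k) ^+ 2 = \sum_i \sum_k dot (phi k i) (phi k i).
    by rewrite exchange_big/=; apply: eq_bigr => k _; rewrite (snorm_sqr vd).
  rewrite (_ : 24 * pi ^+ 2 * s = \sum_(i < 2) (12 * s * pi ^+ 2)); last first.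
    by rewrite sumr_const card_ord -[RHS]mulr_natl; ring.
  apply: ler_sum => i _.
  have F k : leb2.-integrable dom (EFin \o (fun x => phi k i x * phi k i x)).
    by apply: sqint_mul => //; exact: Sphi.
  have [iF <-] := @Rintegral_sum _ _ _ leb2 dom md _ (index_enum 'I_n.+1) _ F.
  apply: (@le_trans _ _ (\int[leb2]_(x in dom) (12 * s))).
    apply: le_Rintegral => //.
      apply: measurable_bounded_integrable => //; first exact: dom_finite.
      exists (12 * s); split; first exact: num_real.
      by move=> y /ltW sy x _ /=; rewrite ger0_norm// mulr_ge0// ltW.
    move=> x dx; have := @sum_sqr_test_le n.+1 e phi lam (lam n) eps x i dx (ltW eps0).
    move=> h; apply: le_trans (h _ _ _ _ _ _ _ _ _ _ _) => //.
    - by apply: le_trans epsn _; lra.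
    - by move=> k; apply: lamM; rewrite -ltnS.
    - exact: ltW.
  rewrite Rintegral_cst// le_eqVlt; apply/orP; left; apply/eqP; congr (_ * _).
  exact: (congr1 fine dom_area).
(* The closeness of phi k to e k is known through pairings only: it is tested
   against a test field close to e k. *)
have lower k : 4^-1 <= normL2 (phi k) ^+ 2.
  have [_ /(_ _ eps0)[th [tth _] eth]] := He k.
  have Sth : L2field th by exact: test_L2field.
  have Sek := Se k.
  have e1 : normL2 (e k) = 1 by rewrite /normL2 oe eqxx sqrtr1.
  have t1 : normL2 th <= 1 + eps.
    rewrite -[th](subKr (e k)); apply: le_trans (snormB vd _ _) _ => //.
      exact: (sdB vd).
    by rewrite -!normL2E e1 lerD2l ltW.
  have d1 : dotL2 (e k) th = 1 - dotL2 (e k) (e k - th).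
    by rewrite (dotBr vd)// oe eqxx subKr.
  have d2 : dotL2 (e k) (e k - th) <= eps.
    apply: le_trans (dot_le vd _ _) _ => //; first exact: (sdB vd).
    by rewrite -!normL2E e1 mul1r ltW.
  have d3 := ephi k _ tth.
  have d4 : dotL2 (phi k) th <= normL2 (phi k) * normL2 th by exact: (dot_le vd).
  rewrite (dotBl vd)// in d3; have := le_trans (ler_norm _) d3.
  have n0 : 0 <= normL2 (phi k) by exact: snorm_ge0.
  have d5 := ler_wpM2l n0 t1; have d6 := ler_wpM2l (ltW eps0) t1.
  rewrite d1 => d7.
  rewrite (_ : 4^-1 = 2^-1 ^+ 2); last by field.
  rewrite ler_sqr ?nnegrE//.
  have aux (p1 p2 p3 p4 ep : R) : p1 <= ep -> p2 <= p3 * p4 ->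
      p3 * p4 <= p3 * (1 + ep) -> ep * p4 <= ep * (1 + ep) ->
      1 - p1 - p2 <= ep * p4 -> 0 < ep -> ep <= 10^-1 -> 0 <= p3 -> 2^-1 <= p3.
    move=> h1 h2 h3 h4 h5 ep0 ep1 p30.
    have := ler_wpM2l p30 ep1; have := ler_wpM2l (ltW ep0) ep1.
    by move: h3 h4; rewrite !mulrDr !mulr1; lra.
  exact: (aux _ _ _ _ _ d2 d4 d5 d6 d7 eps0 eps10 n0).
have : \sum_(k < n.+1) (4^-1 : R) <= 24 * pi ^+ 2 * s.
  by apply: le_trans upper; exact: ler_sum.
rewrite sumr_const card_ord -[X in X <= _]mulr_natl CE => h.
by rewrite -(@ler_pM2r _ 4^-1)// (le_trans h)//; lra.
Qed.

End EigenvalueGrowth.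

(** * Wiener integrals of step functions *)

Section StepIntegrals.
Context {R : realType} {d : measure_display} {T : measurableType d}.
Variables (P : probability T R) (H : R) (beta : R -> {RV P >-> R}).
Hypothesis fbm : is_fbm H beta.
Local Notation S := (sqint P setT).
Local Notation dot := (ip P setT).
Local Notation nrm := (snorm dot).
Let sd : semi_dot S dot := ip_semi_dot P measurableT.
Implicit Types (t c : R) (f g : @stepfun R) (p : R * (R * R)).

Lemma sqint_fbm t : 0 <= t -> S (beta t).
Proof.
move=> t0; case: fbm => _ _ cov.
apply: sqint_lty => //.
have := cov t t t0 t0; rewrite unlock => E.
by rewrite [X in (X < _)%E](_ : _ = (fbm_cov H t t)%:E) ?ltry//; exact: E.
Qed.

Lemma ip_fbm t s : 0 <= t -> 0 <= s -> dot (beta t) (beta s) = fbm_cov H t s.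
Proof.
by move=> t0 s0; case: fbm => _ _ cov; have := cov t s t0 s0; rewrite unlock /ip /Rintegral => ->.
Qed.

Lemma step_integralE f : step_integral beta f =
  \sum_(p <- f) p.1 *: ((beta p.2.2 : T -> R) - beta p.2.1).
Proof. by apply/funext => w; rewrite fct_sumE. Qed.

Lemma step_integral_seqE f : step_integral beta f =
  \sum_(p <- f | p \in f) p.1 *: ((beta p.2.2 : T -> R) - beta p.2.1).
Proof. by rewrite step_integralE big_seq. Qed.

Lemma sqint_increment (a b : R) : 0 <= a -> 0 <= b -> S ((beta b : T -> R) - beta a).
Proof. by move=> a0 b0; apply: (sdB sd); exact: sqint_fbm. Qed.

Lemma within_ge0 t f p : step_within t f -> p \in f -> 0 <= p.2.1 /\ 0 <= p.2.2.
Proof. by move=> wf /wf[p0 [p12 _]]; split => //; exact: le_trans p12. Qed.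

Lemma sqint_summand t f p : step_within t f -> p \in f ->
  S (p.1 *: ((beta p.2.2 : T -> R) - beta p.2.1)).
Proof.
by move=> wf /(within_ge0 wf)[a0 b0]; apply: (sdZ sd); exact: sqint_increment.
Qed.

Lemma sqint_step_integral t f : step_within t f -> S (step_integral beta f).
Proof.
move=> wf; rewrite step_integral_seqE; apply: (sd_sum sd) => p pf.
exact: (sqint_summand wf pf).
Qed.

(** Expanding the increments, both sides are the same combination of covariances
    of the values of the process. *)
Lemma ip_step_integral t f g : step_within t f -> step_within t g ->
  dot (step_integral beta f) (step_integral beta g) = step_dot H f g.
Proof.
move=> wf wg; rewrite /step_dot big_seq step_integral_seqE.
rewrite (dot_suml sd); [|by move=> p; exact: (sqint_summand wf)|exact: sqint_step_integral wg].
apply: eq_bigr => p pf; rewrite big_seq step_integral_seqE.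
rewrite (dot_sumr sd); [|by move=> q; exact: (sqint_summand wg)|exact: (sqint_summand wf pf)].
apply: eq_bigr => q qg.
have [p1 p2] := within_ge0 wf pf; have [q1 q2] := within_ge0 wg qg.
rewrite (dotZl sd) ?(dotZr sd)//; try exact: sqint_increment; last exact: (sqint_summand wg qg).
rewrite (dotBl sd) ?(dotBr sd)//; try exact: sqint_fbm; last exact: sqint_increment.
by rewrite !ip_fbm//; ring.
Qed.

Lemma snorm_step_integral t f : step_within t f ->
  nrm (step_integral beta f) ^+ 2 = step_dot H f f.
Proof. by move=> wf; rewrite (snorm_sqr sd) (ip_step_integral wf wf). Qed.

Definition step_scale (c : R) (f : stepfun) : @stepfun R := [seq (c * p.1, p.2) | p <- f].

Lemma step_integral_sub f g : step_integral beta (step_sub f g) =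
  step_integral beta f - step_integral beta g.
Proof.
apply/funext => w; rewrite /step_integral /step_sub big_cat/= big_map/=.
congr (_ + _); rewrite -[RHS]/(- (step_integral beta g w)) /step_integral -sumrN.
by apply: eq_bigr => p _; rewrite mulNr.
Qed.

Lemma step_integral_scale c f :
  step_integral beta (step_scale c f) = c *: step_integral beta f.
Proof.
apply/funext => w; rewrite /step_integral /step_scale big_map/=.
rewrite -[RHS]/(c * (step_integral beta f w)) /step_integral mulr_sumr.
by apply: eq_bigr => p _; rewrite mulrA.
Qed.

Lemma step_eval_sub (f g : @stepfun R) s :
  step_eval (step_sub f g) s = step_eval f s - step_eval g s.
Proof.
rewrite /step_eval /step_sub big_cat/= big_map/= -sumrN; congr (_ + _).
by apply: eq_bigr => p _; rewrite mulNr.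
Qed.

Lemma step_eval_scale c (f : @stepfun R) s :
  step_eval (step_scale c f) s = c * step_eval f s.
Proof.
rewrite /step_eval /step_scale big_map/= mulr_sumr.
by apply: eq_bigr => p _; rewrite mulrA.
Qed.

Lemma step_within_sub (t : R) f g : step_within t f -> step_within t g ->
  step_within t (step_sub f g).
Proof.
move=> wf wg p; rewrite mem_cat => /orP[/wf//|/mapP[q qg ->]]; exact: (wg q).
Qed.

Lemma step_within_scale (t : R) c f : step_within t f -> step_within t (step_scale c f).
Proof. by move=> wf p /mapP[q qf ->]; exact: (wf q). Qed.

Lemma fbm_increment (s t : R) : 0 < H -> 0 <= s -> s <= t ->
  nrm ((beta t : T -> R) - beta s) = (t - s) `^ H.
Proof.
move=> H0 s0 st; have t0 : 0 <= t by exact: le_trans st.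
have H20 : 2 * H != 0 by rewrite mulf_neq0// gt_eqF.
apply/eqP; rewrite -(@eqrXn2 _ 2)// ?snorm_ge0 ?powR_ge0// (snorm_sqr sd).
rewrite (dotBl sd) ?(dotBr sd)//; try exact: sqint_fbm; last exact: sqint_increment.
rewrite !ip_fbm// /fbm_cov !subrr normr0 powR0// (distrC s t) ger0_norm ?subr_ge0//.
rewrite -[X in _ == X]powR_mulrn ?powR_ge0// -powRrM (mulrC H).
by apply/eqP; field.
Qed.

End StepIntegrals.

(** * Closability of the covariance form *)

Section Closability.
Context {R : realType}.
Variables (H t : R).
Hypotheses (H4 : 4^-1 < H) (H2 : H < 2^-1) (t0 : 0 < t).
Local Notation leb := (@lebesgue_measure R).
Local Notation I0t := (`[0, t]%classic : set R).
Local Notation dott := (ip leb I0t).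
Local Notation nrmt := (snorm dott).

Let mI : measurable I0t. Proof. exact: measurable_itv. Qed.
Let sdt : semi_dot (sqint leb I0t) dott := ip_semi_dot leb mI.

Lemma sqint_itv_bounded (f : R -> R) (M : R) : measurable_fun I0t f ->
  (forall s, I0t s -> `|f s| <= M) -> sqint leb I0t f.
Proof.
move=> mf fM; split => //; apply: measurable_bounded_integrable => //.
- by rewrite /= lebesgue_measure_itv/= lte_fin t0 -EFinD ltry.
- exact: measurable_funX.
- exists (M ^+ 2); split; first exact: num_real.
  move=> y My s /fM fs; apply: le_trans (ltW My).
  by rewrite /= normrX ler_sqr ?nnegrE ?normr_ge0//; apply: le_trans fs.
Qed.

Lemma sqint_itv_continuous (f : R -> R) : continuous f -> sqint leb I0t f.
Proof.
move=> cf; have mf : measurable_fun I0t f.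
  by apply: measurable_funTS; exact: continuous_measurable_fun.
split => //.
apply: (@continuous_compact_integrable R (fun s => f s ^+ 2) I0t).
  exact: segment_compact.
have cff : continuous (fun s => f s * f s) by move=> s; apply: cvgM; exact: cf.
exact: continuous_subspaceT cff.
Qed.

Lemma sqint_indic (A : set R) : measurable A -> sqint leb I0t (\1_A : R -> R).
Proof.
move=> mA; apply: (@sqint_itv_bounded _ 1); first exact: measurable_indic.
by move=> s _; rewrite indicE; case: (_ \in _); rewrite ?normr1 ?normr0.
Qed.

Lemma step_eval_sumE (f : @stepfun R) :
  step_eval f = \sum_(p <- f) p.1 *: (\1_`]p.2.1, p.2.2] : R -> R).
Proof. by apply/funext => s; rewrite fct_sumE. Qed.

Lemma sqint_step_eval (f : @stepfun R) : sqint leb I0t (step_eval f).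
Proof.
rewrite step_eval_sumE; apply: (sd_sum sdt) => p _.
by apply: (sdZ sdt); apply: sqint_indic; exact: measurable_itv.
Qed.

Lemma ip_indic (F K : R -> R) (a b : R) : 0 <= a -> a <= b -> b <= t ->
  continuous K -> (forall s : R, is_derive s 1 F (K s)) ->
  dott K (\1_`]a, b]) = F b - F a.
Proof.
move=> a0 ab bt cK dF.
have cF : continuous F.
  by move=> s; apply/differentiable_continuous/derivable1_diffP; case: (dF s).
have -> : dott K (\1_`]a, b]) = \int[leb]_(s in `]a, b]) K s.
  rewrite /ip [RHS]Rintegral_mkcond [LHS]Rintegral_mkcond.
  apply: eq_Rintegral => s _; rewrite /patch indicE.
  have [sab|sab] := boolP (s \in `]a, b]%classic).
    rewrite mulr1; case: ifPn => // /negP[]; move: sab; rewrite !inE/= !in_itv/=.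
    by move=> /andP[as_ sb]; rewrite (le_trans a0 (ltW as_)) (le_trans sb bt).
  by rewrite mulr0; case: ifP.
have iK (x y : R) : leb.-integrable `[x, y] (EFin \o K).
  apply: (@continuous_compact_integrable R K `[x, y]); first exact: segment_compact.
  exact: continuous_subspaceT.
rewrite Rintegral_itv_obnd_cbnd; last first.
  apply: (@integrableS _ _ _ leb `[a, b]%classic) => //; try exact: measurable_itv.
  exact: subset_itv_oc_cc.
move: ab; rewrite le_eqVlt => /orP[/eqP <-|ab].
  by rewrite set_itv1 Rintegral_set1 subrr.
rewrite /Rintegral (@continuous_FTC2 R K F)//.
- exact: continuous_subspaceT.
- split; first by move=> s _; case: (dF s).
    by apply: cvg_at_right_filter; exact: cF.
  by apply: cvg_at_left_filter; exact: cF.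
- by move=> s _; rewrite derive1E; apply: derive_val.
Qed.

Lemma ip_step_eval (F K : R -> R) (g : @stepfun R) : step_within t g ->
  continuous K -> (forall s : R, is_derive s 1 F (K s)) ->
  dott K (step_eval g) = \sum_(q <- g) q.1 * (F q.2.2 - F q.2.1).
Proof.
move=> wg cK dF; rewrite step_eval_sumE.
have SK := sqint_itv_continuous cK.
have S1 (q : R * (R * R)) : sqint leb I0t (\1_`]q.2.1, q.2.2] : R -> R).
  by apply: sqint_indic; exact: measurable_itv.
rewrite (dot_sumr sdt)//; last by move=> q _; exact: (sdZ sdt).
rewrite big_seq [RHS]big_seq; apply: eq_bigr => q /wg[q0 [q12 q2t]].
by rewrite (dotZr sdt)// (ip_indic _ _ _ cK dF).
Qed.

(** Adding [eps] to the square smooths [|s - a| ^ (2 H)] at [a], while keeping the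
    derivative bounded in [L^2(0, t)] uniformly in [eps]. *)
Definition ker (a eps s : R) : R := ((s - a) ^+ 2 + eps) `^ H.
Definition dker (a eps s : R) : R :=
  2 * H * (s - a) * ((s - a) ^+ 2 + eps) `^ (H - 1).

Lemma quad_gt0 (a eps s : R) : 0 < eps -> 0 < (s - a) ^+ 2 + eps.
Proof. by move=> e0; rewrite ltr_wpDl// sqr_ge0. Qed.

Lemma is_derive_quad (a eps s : R) :
  is_derive s 1 (fun r : R => (r - a) ^+ 2 + eps) (2 * (s - a)).
Proof.
have h1 : is_derive s 1 (fun r : R => r - a) (1 - 0) by exact: is_deriveB.
have h2 : is_derive s 1 (fun r : R => (r - a) * (r - a))
    ((s - a) *: (1 - 0 : R) + (s - a) *: (1 - 0 : R)) by exact: is_deriveM.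
have h3 : is_derive s 1 (fun r : R => (r - a) * (r - a) + eps)
    ((s - a) *: (1 - 0 : R) + (s - a) *: (1 - 0 : R) + 0) by exact: is_deriveD.
suff -> : 2 * (s - a) = (s - a) *: (1 - 0 : R) + (s - a) *: (1 - 0 : R) + 0 by [].
by rewrite subr0 addr0 /GRing.scale/= mulr1 mulr_natl mulr2n.
Qed.

Lemma is_derive_quad_powR (p a eps s : R) : 0 < eps ->
  is_derive s 1 (fun r : R => ((r - a) ^+ 2 + eps) `^ p)
    (2 * p * (s - a) * ((s - a) ^+ 2 + eps) `^ (p - 1)).
Proof.
move=> e0; have y0 := quad_gt0 a s e0.
have yin : (s - a) ^+ 2 + eps \in `]0, +oo[ by rewrite in_itv/= y0.
have dq := is_derive_quad a eps s.
have dp : is_derive ((s - a) ^+ 2 + eps) 1 (fun y : R => y `^ p)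
    (p * ((s - a) ^+ 2 + eps) `^ (p - 1)).
  apply: DeriveDef; first exact: derivable_powR.
  by rewrite -derive1E powR_derive1.
have := @is_derive1_comp R (fun y : R => y `^ p) _ s _ _ dp dq.
by move=> h; apply: is_derive_eq h _; ring.
Qed.

Lemma continuous_quad_powR (p a eps : R) : 0 < eps ->
  continuous (fun r : R => ((r - a) ^+ 2 + eps) `^ p).
Proof.
move=> e0 s; apply/differentiable_continuous/derivable1_diffP.
by case: (is_derive_quad_powR p a s e0).
Qed.

Lemma continuous_dker (a eps : R) : 0 < eps -> continuous (dker a eps).
Proof.
move=> e0 s; apply: cvgM; last exact: (@continuous_quad_powR (H - 1) a _ e0).
apply: cvgM; first exact: cvg_cst.
by apply: cvgB; [exact: cvg_id | exact: cvg_cst].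
Qed.

(** The primitive [(s - a) ((s - a)^2 + eps)^(2H - 1)] dominates the integral of
    [((s - a)^2 + eps)^(2H - 1)] up to the factor [4H - 1]: this is where
    [H > 1/4] enters. *)
Lemma dker_norm_le (a eps : R) : 0 <= a -> a <= t -> 0 < eps -> eps <= 1 ->
  nrmt (dker a eps) ^+ 2 <= 8 * H ^+ 2 / (4 * H - 1) * (t ^+ 2 + 1) `^ (2 * H - 2^-1).
Proof.
move=> a0 at_ e0 e1.
pose y s := (s - a) ^+ 2 + eps.
have y0 s : 0 < y s by exact: quad_gt0.
pose q := 2 * H - 1.
pose G s := (s - a) * (y s) `^ q.
pose g s := (y s) `^ q + (s - a) * (2 * q * (s - a) * (y s) `^ (q - 1)).
have cq := @continuous_quad_powR q a _ e0.
have cq1 := @continuous_quad_powR (q - 1) a _ e0.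
have cs : continuous (fun s : R => s - a).
  by move=> s; apply: cvgB; [exact: cvg_id | exact: cvg_cst].
have cg : continuous g.
  move=> s; apply: cvgD; first exact: cq.
  apply: cvgM; first exact: cs.
  apply: cvgM; last exact: cq1.
  by apply: cvgM; [exact: cvg_cst | exact: cs].
have dG (s : R) : is_derive s 1 G (g s).
  have h1 := is_derive_quad_powR q a s e0.
  have h2 : is_derive s 1 (fun r : R => r - a) (1 - 0) by exact: is_deriveB.
  have h := is_deriveM h2 h1.
  apply: is_derive_eq h _; rewrite /g /GRing.scale/= subr0 mulr1.
  by rewrite addrC.
have Hp : 0 < H by apply: lt_trans H4; rewrite invr_gt0.
have H41 : 0 < 4 * H - 1 by move: H4; lra.
have gle s : (4 * H - 1) * (y s) `^ q <= g s.
  have yq : (y s) `^ q = y s * (y s) `^ (q - 1).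
    rewrite -{2}[y s]powRr1 ?(ltW (y0 s))// -powRD ?(gt_eqF (y0 s)) ?implybT//.
    by congr (_ `^ _); ring.
  rewrite /g -[X in (4 * H - 1) * X]mul1r.
  have P0 : 0 <= (y s) `^ (q - 1) by exact: powR_ge0.
  have sy : (s - a) ^+ 2 * (y s) `^ (q - 1) <= (y s) `^ q.
    by rewrite yq ler_wpM2r// /y lerDl ltW.
  have q2 : 2 * q <= 0 by rewrite /q; move: H2; lra.
  have := ler_wnM2l q2 sy.
  rewrite (_ : (s - a) * (2 * q * (s - a) * y s `^ (q - 1)) =
    2 * q * ((s - a) ^+ 2 * y s `^ (q - 1))); last by ring.
  by rewrite /q; lra.
have Gle s : 0 <= s <= t -> `|G s| <= (t ^+ 2 + 1) `^ (2 * H - 2^-1).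
  move=> /andP[s0 st].
  have ys : y s <= t ^+ 2 + 1.
    by rewrite lerD// -real_normK ?num_real// ler_sqr ?nnegrE ?(ltW t0)//;
      rewrite ler_norml; apply/andP; split; lra.
  apply: (@le_trans _ _ ((y s) `^ (2 * H - 2^-1))); last first.
    apply: ge0_ler_powR; [by move: H4; lra | by rewrite nnegrE ltW | | exact: ys].
    by rewrite nnegrE addr_ge0 ?sqr_ge0.
  rewrite /G normrM (ger0_norm (powR_ge0 _ _)).
  have -> : 2 * H - 2^-1 = 2^-1 + q by rewrite /q; field.
  rewrite [leRHS]powRD; last by rewrite (gt_eqF (y0 s)) implybT.
  rewrite ler_wpM2r ?powR_ge0// powR12_sqrt ?(ltW (y0 s))//.
  by rewrite -sqrtr_sqr ler_wsqrtr// /y lerDl ltW.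
have SK := sqint_itv_continuous (@continuous_dker a _ e0).
have -> : nrmt (dker a eps) ^+ 2 = \int[leb]_(s in I0t) (dker a eps s * dker a eps s).
  exact: (snorm_sqr sdt).
have ig : leb.-integrable I0t (EFin \o g).
  apply: (@continuous_compact_integrable R g I0t); first exact: segment_compact.
  exact: continuous_subspaceT.
have c0 : 0 <= 4 * H ^+ 2 / (4 * H - 1).
  by rewrite mulr_ge0 ?invr_ge0 ?(ltW H41)// mulr_ge0 ?exprn_ge0 ?(ltW Hp).
apply: (@le_trans _ _ (4 * H ^+ 2 / (4 * H - 1) * \int[leb]_(s in I0t) g s)).
  rewrite -RintegralZl//; apply: le_Rintegral => //.
  - exact: sqint_mul.
  - exact: (@integrableZl _ _ _ leb I0t mI (4 * H ^+ 2 / (4 * H - 1)) _ ig).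
  move=> s _; apply: (@le_trans _ _ (4 * H ^+ 2 * (y s) `^ q)).
    rewrite /dker -/(y s).
    have -> : 2 * H * (s - a) * y s `^ (H - 1) * (2 * H * (s - a) * y s `^ (H - 1)) =
        4 * H ^+ 2 * ((s - a) ^+ 2 * (y s `^ (H - 1) * y s `^ (H - 1))) by ring.
    rewrite -powRD; last by rewrite (gt_eqF (y0 s)) implybT.
    rewrite ler_wpM2l ?mulr_ge0 ?exprn_ge0 ?(ltW Hp)//.
    have -> : H - 1 + (H - 1) = q - 1 by rewrite /q; ring.
    have -> : (y s) `^ q = y s * (y s) `^ (q - 1).
      rewrite -{2}[y s]powRr1 ?(ltW (y0 s))// -powRD ?(gt_eqF (y0 s)) ?implybT//.
      by congr (_ `^ _); ring.
    by rewrite ler_wpM2r ?powR_ge0// /y lerDl ltW.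
  have -> : 4 * H ^+ 2 / (4 * H - 1) * g s = 4 * H ^+ 2 * (g s / (4 * H - 1)) by ring.
  rewrite ler_wpM2l ?mulr_ge0 ?exprn_ge0 ?(ltW Hp)// ler_pdivlMr// mulrC.
  exact: gle.
have -> : \int[leb]_(s in I0t) g s = G t - G 0.
  have cG : continuous G.
    by move=> s; apply/differentiable_continuous/derivable1_diffP; case: (dG s).
  rewrite /Rintegral (@continuous_FTC2 R g G)//.
  - exact: continuous_subspaceT.
  - split; first by move=> s _; case: (dG s).
      by apply: cvg_at_right_filter; exact: cG.
    by apply: cvg_at_left_filter; exact: cG.
  - by move=> s _; rewrite derive1E; apply: derive_val.
have -> : 8 * H ^+ 2 / (4 * H - 1) * (t ^+ 2 + 1) `^ (2 * H - 2^-1) =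
  4 * H ^+ 2 / (4 * H - 1) * ((t ^+ 2 + 1) `^ (2 * H - 2^-1) + (t ^+ 2 + 1) `^ (2 * H - 2^-1)).
  by field; rewrite gt_eqF.
rewrite ler_wpM2l//; apply: le_trans (ler_norm _) _; apply: le_trans (ler_normB _ _) _.
by apply: lerD; apply: Gle; rewrite ?lexx ?(ltW t0).
Qed.


Lemma ker_cvg (a s : R) : ker a eps s @[eps --> 0^'+] --> `|s - a| `^ (2 * H).
Proof.
have Hp : 0 < H by apply: lt_trans H4; rewrite invr_gt0.
have -> : `|s - a| `^ (2 * H) = ((s - a) ^+ 2) `^ H.
  by rewrite powRrM powR_mulrn// real_normK ?num_real.
rewrite /ker; set y := (s - a) ^+ 2.
have [y0|yn0] := eqVneq y 0.
  rewrite y0 powR0 ?gt_eqF//.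
  by under eq_fun do rewrite add0r; exact: powR_cvg0.
have yp : 0 < y by rewrite lt_neqAle eq_sym yn0 sqr_ge0.
have cy : {for y, continuous (fun z : R => z `^ H)}.
  apply/differentiable_continuous/derivable1_diffP; apply: derivable_powR.
  by rewrite in_itv/= yp.
apply: (@cvg_comp _ _ _ (fun eps => y + eps) (fun z => z `^ H) _ (nbhs y)) => //.
have : y + eps @[eps --> 0^'+] --> y + 0.
  by apply: cvgD; [exact: cvg_cst | apply: cvg_at_right_filter; exact: cvg_id].
by rewrite addr0.
Qed.

Definition pow_pairing (a : R) (g : @stepfun R) : R :=
  \sum_(q <- g) q.1 * (`|q.2.2 - a| `^ (2 * H) - `|q.2.1 - a| `^ (2 * H)).

(** The increments of the regularized kernel are integrals of its derivative, so
    Cauchy-Schwarz gives a bound that survives the limit [eps -> 0]. *)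
Lemma pow_pairing_bounded (a : R) : 0 <= a <= t -> exists2 C, 0 <= C &
  forall g : @stepfun R, step_within t g -> `|pow_pairing a g| <= C * nrmt (step_eval g).
Proof.
move=> /andP[a0 at_].
pose C2 := 8 * H ^+ 2 / (4 * H - 1) * (t ^+ 2 + 1) `^ (2 * H - 2^-1).
exists (Num.sqrt C2) => [|g wg]; first exact: sqrtr_ge0.
pose p eps := \sum_(q <- g) q.1 * (ker a eps q.2.2 - ker a eps q.2.1).
have pc : p eps @[eps --> 0^'+] --> pow_pairing a g.
  apply: (cvg_big (op := +%R)) => [|q _]; first exact: add_continuous.
  apply: cvgM; first exact: cvg_cst.
  by apply: cvgB; exact: ker_cvg.
have npc : `|p eps| @[eps --> 0^'+] --> `|pow_pairing a g| by exact: cvg_norm.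
rewrite -(cvg_lim _ npc)//; apply: limr_le; first by apply/cvg_ex; eexists; exact: npc.
near=> eps.
have e0 : 0 < eps by near: eps; exact: nbhs_right_gt.
have e1 : eps <= 1 by near: eps; exact: nbhs_right_le.
have cK := @continuous_dker a _ e0.
have dk (s : R) : is_derive s 1 (ker a eps) (dker a eps s).
  exact: is_derive_quad_powR.
rewrite /p -(ip_step_eval wg cK dk).
apply: le_trans (cauchy_schwarz sdt _ _) _.
- exact: sqint_itv_continuous.
- exact: sqint_step_eval.
rewrite ler_wpM2r ?snorm_ge0//.
rewrite -ler_sqr ?nnegrE ?snorm_ge0 ?sqrtr_ge0//.
rewrite [leRHS]sqr_sqrtr; first exact: dker_norm_le.
have H41 : 0 <= 4 * H - 1 by move: H4; lra.
by apply: mulr_ge0; [apply: divr_ge0 => //; apply: mulr_ge0 => //; exact: sqr_ge0 |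
  exact: powR_ge0].
Unshelve. all: end_near.
Qed.

(** The terms [t ^ (2 H)] and [s ^ (2 H)] of the covariance cancel in the second
    differences. *)
Lemma step_dot_pairing (k g : @stepfun R) : step_dot H k g =
  \sum_(p <- k) p.1 * (2^-1 * (pow_pairing p.2.1 g - pow_pairing p.2.2 g)).
Proof.
apply: eq_bigr => p _; rewrite /pow_pairing -sumrB !mulr_sumr.
apply: eq_bigr => q _; rewrite /fbm_cov.
rewrite (distrC p.2.2 q.2.2) (distrC p.2.2 q.2.1) (distrC p.2.1 q.2.2) (distrC p.2.1 q.2.1).
by ring.
Qed.

Lemma step_dot_bounded (k : @stepfun R) : step_within t k -> exists2 C, 0 <= C &
  forall g : @stepfun R, step_within t g -> `|step_dot H k g| <= C * nrmt (step_eval g).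
Proof.
elim: k => [|p k ih] wk.
  exists 0 => // g _; rewrite step_dot_pairing big_nil normr0 mul0r//.
have [|C1 C10 h1] := ih; first by move=> q qk; apply: wk; rewrite inE qk orbT.
have [pa [pab pb]] := wk p (mem_head _ _).
have [|C2 C20 h2] := @pow_pairing_bounded p.2.1.
  by rewrite pa (le_trans pab pb).
have [|C3 C30 h3] := @pow_pairing_bounded p.2.2.
  by rewrite pb (le_trans pa pab).
exists (`|p.1| * (C2 + C3) + C1) => [|g wg].
  by rewrite addr_ge0 ?mulr_ge0 ?addr_ge0.
rewrite step_dot_pairing big_cons -step_dot_pairing.
apply: le_trans (ler_normD _ _) _; rewrite mulrDl lerD ?h1//.
rewrite normrM -mulrA ler_wpM2l// normrM ger0_norm ?invr_ge0//.
apply: (@le_trans _ _ (1 * `|pow_pairing p.2.1 g - pow_pairing p.2.2 g|)).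
  by rewrite ler_wpM2r// invf_le1// ler1n.
rewrite mul1r; apply: le_trans (ler_normB _ _) _.
by rewrite mulrDl lerD ?h2 ?h3.
Qed.

End Closability.

Section ClosableForm.
Context {R : realType} {d : measure_display} {T : measurableType d}.
Variables (P : probability T R) (H t : R) (beta : R -> {RV P >-> R}).
Hypotheses (H4 : 4^-1 < H) (H2 : H < 2^-1) (t0 : 0 < t) (fbm : is_fbm H beta).
Local Notation S := (sqint P setT).
Local Notation nrm := (snorm (ip P setT)).
Local Notation nrmt := (snorm (ip (@lebesgue_measure R) `[0, t])).
Let sd : semi_dot S (ip P setT) := ip_semi_dot P measurableT.

Lemma step_cauchyP (k : nat -> @stepfun R) : (forall n, step_within t (k n)) ->
  step_cauchy H k <-> (forall eps : R, 0 < eps -> exists N, forall m n,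
    (N <= m)%N -> (N <= n)%N ->
    nrm (step_integral beta (k m) - step_integral beta (k n)) < eps).
Proof.
move=> wk; split=> kC eps eps0.
  have [N NP] := kC (eps ^+ 2) (exprn_gt0 _ eps0).
  exists N => m n Nm Nn; rewrite -ltr_sqr ?nnegrE ?snorm_ge0 ?(ltW eps0)//.
  rewrite -step_integral_sub (snorm_step_integral fbm (t := t)); first exact: NP.
  exact: step_within_sub.
have [|N NP] := kC (Num.sqrt eps); first by rewrite sqrtr_gt0.
exists N => m n Nm Nn.
rewrite -(snorm_step_integral fbm (t := t)); last exact: step_within_sub.
rewrite step_integral_sub -[ltRHS]sqr_sqrtr ?(ltW eps0)//.
by rewrite ltr_sqr ?nnegrE ?snorm_ge0 ?sqrtr_ge0//; exact: NP.
Qed.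

(** For fixed [m], the pairing of [k m] with [k n] tends to [0] with [n] by
    continuity in [L^2], while the Cauchy property keeps it close to the square
    norm of [k m]. *)
Lemma step_dot_closable (k : nat -> @stepfun R) :
  (forall n, step_within t (k n)) -> step_cauchy H k ->
  nrmt (step_eval (k n)) @[n --> \oo] --> (0 : R) ->
  nrm (step_integral beta (k n)) @[n --> \oo] --> (0 : R).
Proof.
move=> wk /(step_cauchyP wk) kC k0; apply/cvgrPdist_le => /= eps eps0.
have [N NP] := kC _ eps0; exists N => // m /= Nm.
rewrite sub0r normrN ger0_norm ?snorm_ge0//.
have Sk n : S (step_integral beta (k n)) by exact: (sqint_step_integral fbm (wk n)).
set x := nrm _; have x0 : 0 <= x by exact: snorm_ge0.
suff xe : x ^+ 2 <= x * eps.
  have [->|xn0] := eqVneq x 0; first exact: ltW.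
  have xp : 0 < x by rewrite lt_neqAle eq_sym xn0.
  by rewrite -(ler_pM2l xp) -expr2.
apply/ler_addgt0Pr => delta delta0.
have [C C0 hC] := step_dot_bounded H4 H2 t0 (wk m).
have C1 : 0 < C + 1 by rewrite ltr_wpDl.
have /cvgrPdist_le /(_ (delta / (C + 1)) (divr_gt0 delta0 C1))[M _ MP] := k0.
pose n := maxn N M.
have := MP n (leq_maxr _ _); rewrite /= sub0r normrN ger0_norm ?snorm_ge0// => kn.
rewrite /x (snorm_sqr sd) -/x.
have -> : ip P setT (step_integral beta (k m)) (step_integral beta (k m)) =
    ip P setT (step_integral beta (k m)) (step_integral beta (k m) - step_integral beta (k n))
    + ip P setT (step_integral beta (k m)) (step_integral beta (k n)).
  by rewrite (dotBr sd)// subrK.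
apply: lerD.
  apply: le_trans (dot_le sd _ _) _ => //; first exact: (sdB sd).
  by rewrite ler_wpM2l//; apply/ltW/NP => //; exact: leq_maxl.
rewrite (ip_step_integral fbm (wk m) (wk n)).
apply: le_trans (ler_norm _) _; apply: le_trans (hC _ (wk n)) _.
apply: (@le_trans _ _ ((C + 1) * (delta / (C + 1)))).
  by apply: ler_pM => //; rewrite ?snorm_ge0// lerDl.
by rewrite mulrC divfK// gt_eqF.
Qed.

End ClosableForm.

Section GeometricCauchy.
Context {R : realType} {V : lmodType R} {S : set V} {b : V -> V -> R}.
Hypothesis sd : semi_dot S b.
Local Notation nrm := (snorm b).

Lemma geometric_cauchy (u : nat -> V) (C rho : R) :
  (forall n, S (u n)) -> 0 <= C -> 0 <= rho -> rho < 1 ->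
  (forall j, nrm (u j.+1 - u j) <= C * rho ^+ j) ->
  forall eps : R, 0 < eps -> exists N, forall m n, (N <= m)%N -> (N <= n)%N ->
    nrm (u m - u n) < eps.
Proof.
move=> Su C0 rho0 rho1 uC eps eps0.
have r10 : 0 < 1 - rho by rewrite subr_gt0.
have far n k : nrm (u (n + k)%N - u n) <= C / (1 - rho) * (rho ^+ n - rho ^+ (n + k)).
  elim: k => [|k ih]; first by rewrite addn0 !subrr mulr0 (snorm0 sd).
  rewrite addnS; apply: le_trans (sdist_triangle sd (Su _) (Su (n + k)%N) (Su _)) _.
  apply: le_trans (lerD (uC _) ih) _; rewrite exprS.
  rewrite le_eqVlt; apply/orP; left; apply/eqP; field; exact: lt0r_neq0.
have farN n m : (n <= m)%N -> nrm (u m - u n) <= C / (1 - rho) * rho ^+ n.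
  move=> nm; rewrite -(subnKC nm); apply: le_trans (far _ _) _.
  rewrite ler_wpM2l ?divr_ge0 ?(ltW r10)// gerBl exprn_ge0//.
have : C / (1 - rho) * rho ^+ n @[n --> \oo] --> C / (1 - rho) * 0.
  by apply: cvgM; [exact: cvg_cst | apply: cvg_expr; rewrite ger0_norm].
rewrite mulr0 => /cvgrPdist_lt /(_ (eps / 2) (divr_gt0 eps0 (ltr0Sn _ 1)))[N _].
move=> /(_ N (leqnn _)) /=; rewrite sub0r normrN ger0_norm => [hN|]; last first.
  by rewrite mulr_ge0 ?exprn_ge0 ?divr_ge0 ?(ltW r10).
exists N => m n Nm Nn.
apply: le_lt_trans (sdist_triangle sd (Su m) (Su N) (Su n)) _.
rewrite (snorm_subC sd (Su N) (Su n)) [eps]splitr.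
by apply: ltrD; apply: le_lt_trans (farN _ _ _) hN.
Qed.

End GeometricCauchy.

(** * The exponential integrand *)

Section ExponentialIntegrand.
Context {R : realType}.
Variables (t lam : R).
Hypotheses (t0 : 0 < t) (lam0 : 0 < lam).

Definition expo (s : R) : R := expR (- (t - s) * lam).

Definition grid (j i : nat) : R := t * i%:R / 2 ^+ j.

(** The left-endpoint dyadic step function, written by its jumps: summation by
    parts is thus built into the integrals. *)
Definition dyadic (j : nat) : @stepfun R :=
  (expo 0, (0, t)) ::
  [seq (expo (grid j i.+1) - expo (grid j i), (grid j i.+1, t)) | i <- iota 0 (2 ^ j)].

Lemma expo_gt0 s : 0 < expo s. Proof. exact: expR_gt0. Qed.

Lemma expo_le s r : s <= r -> expo s <= expo r.
Proof. by move=> sr; rewrite ler_expR ler_wpM2r ?(ltW lam0)//; lra. Qed.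

Lemma expo_t : expo t = 1. Proof. by rewrite /expo subrr oppr0 mul0r expR0. Qed.

Lemma expo_lipschitz s r : s <= r -> r <= t -> expo r - expo s <= lam * (r - s).
Proof.
move=> sr rt.
have -> : expo s = expo r * expR (- (lam * (r - s))).
  by rewrite /expo -expRD; congr expR; ring.
rewrite -[X in X - _]mulr1 -mulrBr.
have h := expR_ge1Dx (- (lam * (r - s))).
have er1 : expo r <= 1 by rewrite -expo_t expo_le.
apply: (@le_trans _ _ (1 * (lam * (r - s)))); last by rewrite mul1r.
apply: ler_pM => //; first exact: ltW (expo_gt0 _).
  by rewrite subr_ge0 -expR0 ler_expR oppr_le0 mulr_ge0 ?(ltW lam0)// subr_ge0.
by lra.
Qed.

Lemma grid_ge0 j i : 0 <= grid j i.
Proof. by rewrite divr_ge0 ?exprn_ge0// mulr_ge0// ltW. Qed.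

Lemma grid0 j : grid j 0 = 0. Proof. by rewrite /grid mulr0 mul0r. Qed.

Lemma gridS j i : grid j i.+1 = grid j i + t / 2 ^+ j.
Proof. by rewrite /grid -natr1 mulrDr mulr1 mulrDl. Qed.

Lemma grid_max j : grid j (2 ^ j) = t.
Proof. by rewrite /grid natrX -mulrA divff ?mulr1// expf_neq0. Qed.

Lemma grid_le j m n : (m <= n)%N -> grid j m <= grid j n.
Proof.
move=> mn; rewrite /grid ler_wpM2r ?invr_ge0 ?exprn_ge0//.
by rewrite ler_wpM2l ?(ltW t0)// ler_nat.
Qed.

Lemma grid_double j i : grid j.+1 i.*2 = grid j i.
Proof. by rewrite /grid -muln2 natrM exprS; field; rewrite expf_neq0. Qed.

Lemma dyadic_within j : step_within t (dyadic j).
Proof.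
move=> p; rewrite inE => /orP[/eqP ->/=|/mapP[i + ->]/=].
  by split; [|split]; rewrite ?lexx// ltW.
rewrite mem_iota add0n => /andP[_ ij]; split; first exact: grid_ge0.
by split => //; have := grid_le j ij; rewrite grid_max.
Qed.

Lemma dyadic_sum (V : nmodType) (F : R -> R * R -> V) j :
  \sum_(p <- dyadic j) F p.1 p.2 = F (expo 0) (0, t) +
  \sum_(0 <= i < 2 ^ j) F (expo (grid j i.+1) - expo (grid j i)) (grid j i.+1, t).
Proof. by rewrite /dyadic big_cons big_map /index_iota subn0. Qed.

Lemma step_eval_dyadic j s : 0 < s -> s <= t ->
  `|step_eval (dyadic j) s - expo s| <= lam * t / 2 ^+ j.
Proof.
move=> s0 st.
have exP : exists i, grid j i < s by exists 0%N; rewrite grid0.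
have boundP i : grid j i < s -> (i <= 2 ^ j)%N.
  move=> gs; rewrite leqNgt; apply/negP => ji.
  have := grid_le j (ltnW ji); rewrite grid_max => tg.
  by have := lt_le_trans gs (le_trans st tg); rewrite ltxx.
(* The value on the cell (grid j m, grid j (m + 1)] of s telescopes. *)
have [m gm mmax] := ex_maxnP exP boundP.
have mj : (m <= 2 ^ j)%N by exact: boundP.
have sm : s <= grid j m.+1.
  by rewrite leNgt; apply/negP => /mmax; rewrite ltnn.
have -> : step_eval (dyadic j) s = expo (grid j m).
  rewrite /step_eval (@dyadic_sum _ (fun c I => c * \1_`]I.1, I.2] s))/=.
  have I1 : (\1_`]0, t] s : R) = 1.
    by rewrite indicE mem_set//= in_itv/= s0 st.
  rewrite I1 mulr1 (@big_cat_nat _ _ _ m)//= [X in _ + (_ + X)]big1_seq ?addr0.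
    rewrite (eq_big_nat _ _ (F2 := fun i => expo (grid j i.+1) - expo (grid j i))).
      by rewrite (telescope_sumr (fun i => expo (grid j i)))// grid0 addrC subrK.
    move=> i /andP[_ im]; rewrite indicE mem_set ?mulr1//= in_itv/= st andbT.
    by apply: le_lt_trans gm; exact: grid_le.
  move=> i; rewrite mem_index_iota => /andP[_ /andP[mi _]].
  rewrite indicE memNset ?mulr0//= in_itv/= => /andP[gs _].
  by have := mmax _ gs; rewrite ltnNge mi.
rewrite distrC ger0_norm ?subr_ge0 ?expo_le ?(ltW gm)//.
apply: le_trans (expo_lipschitz (ltW gm) st) _.
rewrite -mulrA ler_wpM2l ?(ltW lam0)//.
by rewrite gridS in sm; lra.
Qed.

Local Notation leb := (@lebesgue_measure R).
Local Notation nrmt := (snorm (ip leb `[0, t])).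

Lemma continuous_expo : continuous expo.
Proof.
move=> s; apply: (@cvg_comp _ _ _ (fun s => - (t - s) * lam) expR); last exact: continuous_expR.
apply: cvgM; last exact: cvg_cst.
by apply: cvgN; apply: cvgB; [exact: cvg_cst | exact: cvg_id].
Qed.

Lemma dyadic_cvg : nrmt (step_eval (dyadic j) - expo) @[j --> \oo] --> (0 : R).
Proof.
have mI : measurable (`[0, t]%classic : set R) by exact: measurable_itv.
have sdt := ip_semi_dot leb mI.
have Sj j : sqint leb `[0, t] (step_eval (dyadic j) - expo).
  by apply: (sdB sdt); [exact: sqint_step_eval | exact: sqint_itv_continuous continuous_expo].
have bound j : nrmt (step_eval (dyadic j) - expo) <= Num.sqrt t * (lam * t) * 2^-1 ^+ j.
  rewrite -ler_sqr ?nnegrE ?snorm_ge0 ?mulr_ge0 ?sqrtr_ge0 ?exprn_ge0 ?(ltW t0) ?(ltW lam0)//.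
  rewrite (snorm_sqr sdt) /ip.
  have iF := @sqint_mul _ _ _ leb _ mI _ _ (Sj j) (Sj j).
  have sub : `]0%R, t] `<=` (`[0%R, t]%classic : set R) by exact: subset_itv_oc_cc.
  have moc : measurable (`]0, t]%classic : set R) by exact: measurable_itv.
  have lI : leb (`]0, t]%classic : set R) = t%:E.
    by rewrite lebesgue_measure_itv/= lte_fin t0 -EFinD subr0.
  rewrite -Rintegral_itv_obnd_cbnd; last exact: (@integrableS _ _ _ leb _ _ _ mI moc sub iF).
  apply: (@le_trans _ _ (\int[leb]_(s in `]0, t]) ((lam * t / 2 ^+ j) ^+ 2))).
    apply: le_Rintegral => //.
    - exact: (@integrableS _ _ _ leb _ _ _ mI moc sub iF).
    - apply: measurable_bounded_integrable => //.
        by apply: (@le_lt_trans _ _ t%:E); [rewrite -lI; exact: lexx | exact: ltry].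
      exists ((lam * t / 2 ^+ j) ^+ 2); split; first exact: num_real.
      by move=> y /ltW sy x _ /=; rewrite ger0_norm ?sqr_ge0.
    - move=> s; rewrite /= in_itv/= => /andP[s0 st].
      rewrite -expr2 -real_normK ?num_real// ler_sqr ?nnegrE//.
        exact: step_eval_dyadic.
      by rewrite divr_ge0 ?exprn_ge0 ?mulr_ge0 ?(ltW t0) ?(ltW lam0).
  rewrite Rintegral_cst// [X in _ * X <= _](_ : _ = t); last exact: (congr1 fine lI).
  rewrite le_eqVlt; apply/orP; left; apply/eqP.
  transitivity ((lam * t / 2 ^+ j) ^+ 2 * Num.sqrt t ^+ 2).
    by rewrite sqr_sqrtr// ltW.
  by rewrite exprVn; ring.
apply/cvgrPdist_le => /= eps eps0.
have : Num.sqrt t * (lam * t) * 2^-1 ^+ n @[n --> \oo] --> Num.sqrt t * (lam * t) * 0.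
  apply: cvgM; [exact: cvg_cst | apply: cvg_expr].
  by rewrite ger0_norm// invf_lt1// ltr1n.
rewrite mulr0 => /cvgrPdist_le /(_ eps eps0); apply: filterS => n.
rewrite !sub0r !normrN => h; apply: le_trans h.
by rewrite ger0_norm ?snorm_ge0//; apply: le_trans (bound n) _; exact: ler_norm.
Qed.

End ExponentialIntegrand.

(** * The integral of the exponential *)

Section ExponentialIntegral.
Context {R : realType} {d : measure_display} {T : measurableType d}.
Variables (P : probability T R) (H t lam : R) (beta : R -> {RV P >-> R}).
Hypotheses (H4 : 4^-1 < H) (H2 : H < 2^-1) (t0 : 0 < t) (lam0 : 0 < lam).
Hypothesis fbm : is_fbm H beta.
Local Notation S := (sqint P setT).
Local Notation nrm := (snorm (ip P setT)).
Local Notation nrmt := (snorm (ip (@lebesgue_measure R) `[0, t])).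
Local Notation leb := (@lebesgue_measure R).
Local Notation Int := (step_integral beta).
Local Notation E := (expo t lam).
Local Notation grd := (grid t).
Local Notation dya := (dyadic t lam).
Let sd : semi_dot S (ip P setT) := ip_semi_dot P measurableT.
Let Hp : 0 < H. Proof. by apply: lt_trans H4; rewrite invr_gt0. Qed.

Lemma sqint_dyadic j : S (Int (dya j)).
Proof. by apply: (sqint_step_integral fbm (t := t)); exact: dyadic_within. Qed.

Lemma increment_norm (a b : R) : 0 <= a -> a <= b ->
  S ((beta b : T -> R) - beta a) /\ nrm ((beta b : T -> R) - beta a) = (b - a) `^ H.
Proof.
move=> a0 ab; split; last exact: fbm_increment.
by apply: (sqint_increment fbm) => //; exact: le_trans ab.
Qed.

Lemma powRXn (x p : R) n : 0 <= x -> (x ^+ n) `^ p = (x `^ p) ^+ n.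
Proof.
move=> x0; elim: n => [|n ih]; first by rewrite !expr0 powR1.
by rewrite !exprS powRM ?exprn_ge0// ih.
Qed.

Lemma sum_double (V : nmodType) (F : nat -> V) n :
  \sum_(0 <= k < n.*2) F k = \sum_(0 <= i < n) (F i.*2 + F i.*2.+1).
Proof.
elim: n => [|n ih]; first by rewrite !big_nil.
by rewrite doubleS !big_nat_recr//= ih addrA.
Qed.

Lemma dyadic_refine j : Int (dya j.+1) - Int (dya j) =
  \sum_(0 <= i < 2 ^ j) (E (grd j.+1 i.*2.+1) - E (grd j.+1 i.*2)) *:
    ((beta (grd j.+1 i.+1.*2) : T -> R) - beta (grd j.+1 i.*2.+1)).
Proof.
apply/funext => w.
rewrite -[LHS]/(Int (dya j.+1) w - Int (dya j) w) /step_integral.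
rewrite !(@dyadic_sum _ t lam _ (fun c I => c * (beta I.2 w - beta I.1 w)))/=.
rewrite opprD addrACA subrr add0r expnS mul2n sum_double -sumrB fct_sumE.
apply: eq_bigr => i _; rewrite -doubleS !grid_double.
rewrite -[RHS]/(_ * (beta _ w - beta _ w)).
rewrite -(grid_double t j i) -(grid_double t j i.+1) doubleS; ring.
Qed.

(** Refining the dyadic grid changes the integral by increments over half
    cells, with coefficients whose sum is at most the variation of the
    exponential. *)
Lemma dyadic_refine_norm j :
  nrm (Int (dya j.+1) - Int (dya j)) <= t `^ H * (2^-1 `^ H) ^+ j.+1.
Proof.
have E01 : \sum_(0 <= i < 2 ^ j) (E (grd j.+1 i.*2.+1) - E (grd j.+1 i.*2)) <= 1.
  apply: (@le_trans _ _ (\sum_(0 <= i < 2 ^ j) (E (grd j i.+1) - E (grd j i)))).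
    apply: ler_sum => i _; rewrite grid_double -(grid_double t j i.+1) lerB// expo_le//.
    by apply: grid_le => //; rewrite doubleS.
  rewrite (telescope_sumr (fun i => E (grd j i)))// grid_max expo_t.
  by rewrite gerBl ltW// expo_gt0.
have hH : (t / 2 ^+ j.+1) `^ H = t `^ H * (2^-1 `^ H) ^+ j.+1.
  rewrite powRM ?invr_ge0 ?exprn_ge0 ?(ltW t0)//; congr (_ * _).
  by rewrite -exprVn powRXn ?invr_ge0.
rewrite -hH dyadic_refine.
have inc i : S ((beta (grd j.+1 i.+1.*2) : T -> R) - beta (grd j.+1 i.*2.+1)) /\
    nrm ((beta (grd j.+1 i.+1.*2) : T -> R) - beta (grd j.+1 i.*2.+1)) =
    (t / 2 ^+ j.+1) `^ H.
  have [||s ->] := @increment_norm (grd j.+1 i.*2.+1) (grd j.+1 i.+1.*2).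
  - exact: grid_ge0.
  - by apply: grid_le => //; rewrite doubleS.
  by split => //; congr (_ `^ _); rewrite doubleS gridS addrAC subrr add0r.
apply: le_trans (snorm_sum sd _ _) _.
  by move=> i _; apply: (sdZ sd); case: (inc i).
apply: (@le_trans _ _ (\sum_(0 <= i < 2 ^ j)
   (E (grd j.+1 i.*2.+1) - E (grd j.+1 i.*2)) * (t / 2 ^+ j.+1) `^ H)).
  apply: ler_sum => i _; have [s n] := inc i.
  rewrite (snormZ sd)// n ger0_norm// subr_ge0 expo_le//.
  exact: grid_le.
by rewrite -mulr_suml -[leRHS]mul1r ler_wpM2r ?powR_ge0.
Qed.

Lemma dyadic_cauchy (eps : R) : 0 < eps -> exists N, forall m n,
  (N <= m)%N -> (N <= n)%N -> nrm (Int (dya m) - Int (dya n)) < eps.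
Proof.
have r0 : 0 <= (2^-1 : R) `^ H by exact: powR_ge0.
have r1 : (2^-1 : R) `^ H < 1.
  rewrite [ltRHS](_ : _ = 1 `^ H); last by rewrite powR1.
  by apply: gt0_ltr_powR; rewrite ?nnegrE ?invr_ge0// invf_lt1// ltr1n.
apply: (geometric_cauchy sd (u := fun j => Int (dya j)) sqint_dyadic
  (mulr_ge0 (powR_ge0 t H) r0) r0 r1) => j.
by rewrite -mulrA -exprS; exact: dyadic_refine_norm.
Qed.

Lemma powR_le_exp (x : R) : 0 <= x -> x `^ H <= 2 * expR (x / 2).
Proof.
move=> x0; have e := expR_ge1Dx (x / 2).
have [x1|x1] := leP x 1.
  apply: (@le_trans _ _ 1); last by lra.
  rewrite [leRHS](_ : _ = 1 `^ H); last by rewrite powR1.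
  by rewrite ge0_ler_powR ?nnegrE ?(ltW Hp).
apply: (@le_trans _ _ (x `^ 1)).
  by rewrite ler_powR ?(ltW x1)//; move: H2; lra.
by rewrite powRr1//; lra.
Qed.

(** Summation by parts and Minkowski's inequality bound the norm by the integral
    of [(t - s) ^ H] against the derivative of the exponential, which has the
    order [lam ^ (- H)]. *)
Lemma dyadic_norm j : nrm (Int (dya j)) <= 4 * lam `^ (- H).
Proof.
pose r s := expR (- (t - s) * lam / 2).
have rr s : E s = r s ^+ 2 by rewrite expr2 /r /expo -expRD; congr expR; field.
have r0 s : 0 < r s by exact: expR_gt0.
have rM s s' : s <= s' -> r s <= r s'.
  move=> ss; rewrite ler_expR ler_wpM2r ?invr_ge0// ler_wpM2r ?(ltW lam0)//.
  by rewrite lerN2 lerD2l lerN2.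
have rt : r t = 1 by rewrite /r subrr oppr0 !mul0r expR0.
have L0 : 0 <= lam `^ (- H) by exact: powR_ge0.
(* Half of the exponential decay absorbs the power of t - s. *)
have key s : s <= t -> r s * (t - s) `^ H <= 2 * lam `^ (- H).
  move=> st; have ts : 0 <= t - s by rewrite subr_ge0.
  have -> : (t - s) `^ H = lam `^ (- H) * (lam * (t - s)) `^ H.
    rewrite powRM ?(ltW lam0)// mulrA -powRD ?(gt_eqF lam0) ?implybT//.
    by rewrite addNr powRr0 mul1r.
  rewrite mulrCA [leRHS]mulrC ler_wpM2l//.
  apply: le_trans (ler_wpM2l (ltW (r0 s)) (powR_le_exp _)) _.
    by rewrite mulr_ge0 ?(ltW lam0).
  rewrite mulrCA ler_piMr// /r -expRD.
  by rewrite (_ : _ + _ = 0) ?expR0//; field.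
have -> : Int (dya j) = E 0 *: ((beta t : T -> R) - beta 0) +
    \sum_(0 <= i < 2 ^ j) (E (grd j i.+1) - E (grd j i)) *:
      ((beta t : T -> R) - beta (grd j i.+1)).
  rewrite step_integralE.
  exact: (@dyadic_sum _ t lam _ (fun c I => c *: ((beta I.2 : T -> R) - beta I.1))).
have [S0 n0] := increment_norm (lexx 0) (ltW t0).
have inc i : (i < 2 ^ j)%N -> S ((beta t : T -> R) - beta (grd j i.+1)) /\
    nrm ((beta t : T -> R) - beta (grd j i.+1)) = (t - grd j i.+1) `^ H.
  move=> ij; apply: increment_norm; first exact: grid_ge0.
  by have := grid_le t0 j ij; rewrite grid_max.
have SS i : (0 <= i < 2 ^ j)%N -> S ((E (grd j i.+1) - E (grd j i)) *:
      ((beta t : T -> R) - beta (grd j i.+1))).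
  by move=> /andP[_ ij]; apply: (sdZ sd); case: (inc i ij).
rewrite big_nat; apply: le_trans (snormD sd _ _) _; first exact: (sdZ sd).
  exact: (sd_sum sd).
apply: (@le_trans _ _ (2 * lam `^ (- H) * r 0 +
    \sum_(0 <= i < 2 ^ j) 4 * lam `^ (- H) * (r (grd j i.+1) - r (grd j i)))); last first.
  rewrite -mulr_sumr (telescope_sumr (fun i => r (grd j i)))// grid_max grid0 rt.
  by have := mulr_ge0 L0 (ltW (r0 0)); nra.
apply: lerD.
  rewrite (snormZ sd)// n0 subr0 ger0_norm ?(ltW (expo_gt0 _ _ _))// rr expr2.
  rewrite -[leLHS]mulrA [leRHS]mulrC ler_wpM2l ?(ltW (r0 _))//.
  by have := key 0 (ltW t0); rewrite subr0.
apply: le_trans (snorm_sum sd _ SS) _; rewrite [leRHS]big_nat.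
apply: ler_sum => i /andP[_ ij]; have [Si ni] := inc i ij.
have gg : grd j i <= grd j i.+1 by exact: grid_le.
rewrite (snormZ sd)// ni ger0_norm ?subr_ge0 ?expo_le// !rr subr_sqr.
have git : grd j i.+1 <= t
  by have := grid_le t0 j ij; rewrite grid_max.
have k := key _ git; have rg := rM _ _ gg.
have d0 : 0 <= r (grd j i.+1) - r (grd j i) by rewrite subr_ge0.
rewrite -[leLHS]mulrA [leRHS]mulrC ler_wpM2l//.
apply: (@le_trans _ _ (2 * r (grd j i.+1) * (t - grd j i.+1) `^ H)).
  by rewrite ler_wpM2r ?powR_ge0//; lra.
by rewrite -mulrA; lra.
Qed.

End ExponentialIntegral.

Section SquareConvergence.
Context d (T : measurableType d) (R : realType).
Variables (mu : {measure set T -> \bar R}) (D : set T).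
Hypothesis mD : measurable D.
Local Notation nrm := (snorm (ip mu D)).

Lemma cvg0_sqr (u : nat -> R) : (forall n, 0 <= u n) ->
  (u n ^+ 2 @[n --> \oo] --> (0 : R)) <-> (u n @[n --> \oo] --> (0 : R)).
Proof.
move=> u0; split=> h; last first.
  rewrite (_ : (fun n => u n ^+ 2) = (fun n => u n * u n)); last exact/funext.
  by rewrite -(mulr0 (0 : R)); exact: cvgM.
have := @cvg_comp _ _ _ (fun n => u n ^+ 2) (@Num.sqrt R) _ _ _ h (@sqrt_continuous R 0).
rewrite sqrtr0; set v := _ \o _; suff -> : v = u by [].
by apply/funext => n; rewrite /v/= sqrtr_sqr ger0_norm.
Qed.

Lemma sqint_cvg0 (h : nat -> T -> R) : (forall n, sqint mu D (h n)) ->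
  ((\int[mu]_(x in D) ((h n x) ^+ 2)%:E)%E @[n --> \oo] --> 0%E) <->
  (nrm (h n) @[n --> \oo] --> (0 : R)).
Proof.
move=> Sh.
rewrite -(@cvg0_sqr (fun n => nrm (h n))); last by move=> n; exact: snorm_ge0.
have -> : (fun n => \int[mu]_(x in D) ((h n x) ^+ 2)%:E)%E =
    (fun n => (nrm (h n) ^+ 2)%:E).
  by apply/funext => n; exact: integral_sqr.
split; last by move=> k; apply: cvg_EFin => //; exact: nearW.
by move=> /fine_cvg.
Qed.

End SquareConvergence.

Section WienerExponential.
Context {R : realType} {d : measure_display} {T : measurableType d}.
Variables (P : probability T R) (H t lam : R) (beta : R -> {RV P >-> R}).
Hypotheses (H4 : 4^-1 < H) (H2 : H < 2^-1) (t0 : 0 < t) (lam0 : 0 < lam).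
Hypothesis fbm : is_fbm H beta.
Local Notation leb := (@lebesgue_measure R).
Local Notation S := (sqint P setT).
Local Notation nrm := (snorm (ip P setT)).
Local Notation nrmt := (snorm (ip leb `[0, t])).
Local Notation Int := (step_integral beta).
Local Notation dya := (dyadic t lam).
Let sd : semi_dot S (ip P setT) := ip_semi_dot P measurableT.
Let mI : measurable (`[0, t]%classic : set R). Proof. exact: measurable_itv. Qed.
Let sdt : semi_dot (sqint leb `[0, t]) (ip leb `[0, t]) := ip_semi_dot leb mI.

Let SE : sqint leb `[0, t] (expo t lam).
Proof. exact: sqint_itv_continuous (@continuous_expo R t lam). Qed.

Let Sstep (f : @stepfun R) : sqint leb `[0, t] (step_eval f).
Proof. exact: sqint_step_eval. Qed.

Lemma wiener_expo_exists : exists2 X, S X & is_wiener_integral H beta t (expo t lam) X.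
Proof.
have [|X SX XP] := riesz_fischer measurableT (mu := P) (g := fun j => Int (dya j))
  (fun j => sqint_dyadic lam t0 fbm j).
  by move=> eps eps0; exact: (dyadic_cauchy H4 t0 lam0 fbm).
exists X => //; split; first by case: SX.
exists dya; last first.
  apply/(sqint_cvg0 measurableT) => // n; apply: (sdB sd) => //.
  exact: (sqint_dyadic lam t0 fbm).
have wd n : step_within t (dya n) by exact: dyadic_within.
split => //.
- apply/(step_cauchyP fbm wd) => eps eps0; exact: (dyadic_cauchy H4 t0 lam0 fbm).
- by case: SE.
- apply/(@sqint_cvg0 _ _ _ leb _ mI (fun n => step_eval (dya n) - expo t lam)).
    by move=> n; exact: (sdB sdt).
  exact: dyadic_cvg.
Qed.

(** The closability of the form makes the norm of the integral independent of
    the approximating step functions, hence the bound of the dyadic ones holds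
    for all. *)
Lemma wiener_expo_norm (phi : R -> R) (X : T -> R) (c : R) :
  is_wiener_integral H beta t phi X ->
  (forall s, 0 <= s <= t -> phi s = c * expo t lam s) ->
  S X /\ nrm X <= `|c| * (4 * lam `^ (- H)).
Proof.
move=> [mX [f [wf fC _ fphi] fX]] phiE.
have ScE : sqint leb `[0, t] (c *: expo t lam) by exact: (sdZ sdt).
have wd n : step_within t (dya n) by exact: dyadic_within.
have SI n : S (Int (f n)) by exact: (sqint_step_integral fbm (wf n)).
have Sd n : S (Int (dya n)) by exact: (sqint_dyadic lam t0 fbm).
have fE : nrmt (step_eval (f n) - c *: expo t lam) @[n --> \oo] --> (0 : R).
  apply/(@sqint_cvg0 _ _ _ leb _ mI); first by move=> n; exact: (sdB sdt).
  suff -> : (fun n => \int[leb]_(x in `[0%R, t])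
      (((step_eval (f n) - c *: expo t lam) x) ^+ 2)%:E)%E =
    (fun n => \int[leb]_(x in `[0%R, t]) ((step_eval (f n) x - phi x) ^+ 2)%:E)%E by [].
  apply/funext => n; apply: eq_integral => s; rewrite inE/= in_itv/= => st.
  by rewrite phiE.
pose k n := step_sub (f n) (step_scale c (dya n)).
have wk n : step_within t (k n).
  by apply: step_within_sub => //; exact: step_within_scale.
have Ik n : Int (k n) = Int (f n) - c *: Int (dya n).
  by rewrite step_integral_sub step_integral_scale.
have kE : nrmt (step_eval (k n)) @[n --> \oo] --> (0 : R).
  have lim0 : nrmt (step_eval (f n) - c *: expo t lam) +
      `|c| * nrmt (step_eval (dya n) - expo t lam) @[n --> \oo] --> 0 + `|c| * 0.
    by apply: cvgD => //; apply: cvgM; [exact: cvg_cst | exact: dyadic_cvg].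
  rewrite mulr0 addr0 in lim0.
  apply: (squeeze_cvgr _ (cvg_cst 0) lim0); apply: nearW => n.
  rewrite snorm_ge0/=.
  have -> : step_eval (k n) =
      (step_eval (f n) - c *: expo t lam) - c *: (step_eval (dya n) - expo t lam).
    apply/funext => s; rewrite step_eval_sub step_eval_scale.
    rewrite -[RHS]/(step_eval (f n) s - c * expo t lam s -
      c * (step_eval (dya n) s - expo t lam s)); ring.
  have S1 : sqint leb `[0, t] (step_eval (f n) - c *: expo t lam) by exact: (sdB sdt).
  have S2 : sqint leb `[0, t] (step_eval (dya n) - expo t lam) by exact: (sdB sdt).
  by apply: le_trans (snormB sdt S1 (sdZ sdt c S2)) _; rewrite (snormZ sdt).
have kC : step_cauchy H k.
  apply/(step_cauchyP fbm wk) => eps eps0.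
  have c1 : 0 < 2 * (`|c| + 1) by rewrite mulr_gt0// ltr_wpDl.
  have [N1 P1] := (step_cauchyP fbm wf).1 fC _ (divr_gt0 eps0 (ltr0Sn _ 1)).
  have [N2 P2] := dyadic_cauchy H4 t0 lam0 fbm (divr_gt0 eps0 c1).
  exists (maxn N1 N2) => m n; rewrite !geq_max => /andP[m1 m2] /andP[n1 n2].
  have -> : Int (k m) - Int (k n) =
      (Int (f m) - Int (f n)) - c *: (Int (dya m) - Int (dya n)).
    by rewrite !Ik scalerBr !opprB addrACA [- _ + _]addrC addrACA !addrA.
  have S1 : S (Int (f m) - Int (f n)) by exact: (sdB sd).
  have S2 : S (Int (dya m) - Int (dya n)) by exact: (sdB sd).
  apply: le_lt_trans (snormB sd S1 (sdZ sd c S2)) _; rewrite (snormZ sd)// [eps]splitr.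
  apply: ltr_leD; first exact: P1.
  apply: le_trans (ler_wpM2l (normr_ge0 c) (ltW (P2 _ _ m2 n2))) _.
  have cp : 0 < `|c| + 1 by rewrite ltr_wpDl.
  rewrite (_ : _ * _ = eps / 2 * (`|c| / (`|c| + 1))); last first.
    by field; rewrite gt_eqF.
  rewrite ler_piMr ?divr_ge0 ?(ltW eps0)//.
  by rewrite ler_pdivrMr ?mul1r ?lerDl.
have Ik0 := step_dot_closable H4 H2 t0 fbm wk kC kE.
have SX : S X.
  have /fine_cvgP[[N _ NP] _] := fX.
  rewrite -[X](subKr (Int (f N))); apply: (sdB sd) => //.
  apply: sqint_lty => //; last first.
    by have /= := NP N (leqnn N); rewrite fin_numElt => /andP[].
  by apply: measurable_funB => //; case: (SI N).
split => //.
have IX : nrm (Int (f n) - X) @[n --> \oo] --> (0 : R).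
  by apply/(sqint_cvg0 measurableT) => // n; exact: (sdB sd).
have lim0 : nrm (Int (f n) - X) + nrm (Int (k n)) + `|c| * (4 * lam `^ (- H))
    @[n --> \oo] --> 0 + 0 + `|c| * (4 * lam `^ (- H)).
  by apply: cvgD; [exact: cvgD | exact: cvg_cst].
rewrite !add0r in lim0; rewrite -(cvg_lim _ lim0)//.
apply: limr_ge; first by apply/cvg_ex; eexists; exact: lim0.
apply: nearW => n.
have -> : nrm X = nrm (c *: Int (dya n) + (Int (k n) - (Int (f n) - X))).
  by congr snorm; rewrite Ik opprB addrA [c *: _ + _]addrC subrK addrC subrK.
have S1 : S (Int (f n) - X) by exact: (sdB sd).
have Sk : S (Int (k n)) by rewrite Ik; apply: (sdB sd) => //; exact: (sdZ sd).
apply: le_trans (snormD sd (sdZ sd c (Sd n)) (sdB sd Sk S1)) _.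
rewrite (snormZ sd)// [leLHS]addrC; apply: lerD.
  by rewrite [leRHS]addrC; exact: (snormB sd Sk S1).
by rewrite ler_wpM2l//; exact: dyadic_norm.
Qed.

End WienerExponential.

(** * The space H and the semigroup *)

Section SpaceH.
Context {R : realType}.
Let vd : semi_dot (@L2field R) (@dotL2 R) := dotL2_semi_dot.

Lemma spaceH_L2field (u : vfield R) : spaceH u -> L2field u.
Proof. by case. Qed.

Lemma calV_L2field (phi : vfield R) : calV phi -> L2field phi.
Proof. by case=> tphi _ i; exact: test_sqint. Qed.

Lemma calV_linear a (phi psi : vfield R) : calV phi -> calV psi -> calV (a *: phi + psi).
Proof.
move=> [tphi dphi] [tpsi dpsi]; split; first by move=> i; exact: test_linear.
move=> x.
transitivity (a * (\sum_i 'D_(axis i) (phi i) x) + \sum_i 'D_(axis i) (psi i) x).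
  rewrite mulr_sumr -big_split.
  apply: eq_bigr => i _.
  rewrite -[(a *: phi + psi) i]/(a *: phi i + psi i).
  exact: (congr1 (fun f => f x) (D_linear a i (tphi i) (tpsi i))).
by rewrite dphi dpsi mulr0 addr0.
Qed.

Lemma spaceH_linear a (u v : vfield R) : spaceH u -> spaceH v -> spaceH (a *: u + v).
Proof.
move=> [Su uV] [Sv vV]; split; first exact: (sdL vd).
move=> eps eps0; have c0 : 0 < 2 * (`|a| + 1) by rewrite mulr_gt0// ltr_wpDl.
have [phi Vphi uphi] := uV _ (divr_gt0 eps0 c0).
have [psi Vpsi vpsi] := vV _ (divr_gt0 eps0 (ltr0Sn _ 1)).
exists (a *: phi + psi); first exact: calV_linear.
have Sphi := calV_L2field Vphi; have Spsi := calV_L2field Vpsi.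
rewrite (_ : _ - _ = a *: (u - phi) + (v - psi)); last first.
  by rewrite scalerBr opprD addrACA.
have S1 : L2field (u - phi) by exact: (sdB vd).
have S2 : L2field (v - psi) by exact: (sdB vd).
apply: le_lt_trans (snormD vd (sdZ vd a S1) S2) _; rewrite (snormZ vd)// [ltRHS]splitr.
apply: ler_ltD => //.
apply: le_trans (ler_wpM2l (normr_ge0 a) (ltW uphi)) _.
have cp : 0 < `|a| + 1 by rewrite ltr_wpDl.
rewrite (_ : _ * _ = eps / 2 * (`|a| / (`|a| + 1))); last first.
  by field; rewrite gt_eqF.
rewrite ler_piMr ?divr_ge0 ?(ltW eps0)//.
by rewrite ler_pdivrMr ?mul1r ?lerDl.
Qed.

Lemma spaceH0 : spaceH (0 : vfield R).
Proof.
split; first exact: (sd0 vd).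
move=> eps eps0; exists 0; last by rewrite subrr [normL2 _](snorm0 vd).
split; first by move=> i; exact: test0.
by move=> x; rewrite big1// => i _; exact: derive_cst.
Qed.

Lemma spaceH_semi_dot : semi_dot (@spaceH R) (@dotL2 R).
Proof.
split.
- exact: spaceH0.
- exact: spaceH_linear.
- exact: (sdC vd).
- by move=> a u v w Su Sv Sw; apply: (sd_linear vd); exact: spaceH_L2field.
- exact: (sd_ge0 vd).
Qed.

Lemma spaceH_closed (u : nat -> vfield R) (v : vfield R) :
  (forall n, spaceH (u n)) -> L2field v -> cvgL2 u v -> spaceH v.
Proof.
move=> Hu Sv uv; split => // eps eps0.
have e2 : 0 < eps / 2 by exact: divr_gt0.
have /cvgrPdist_lt /(_ _ e2)[N _ /(_ N (leqnn N))] := uv.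
rewrite /= sub0r normrN ger0_norm ?[_ <= normL2 _]snorm_ge0// => uN.
have [_ /(_ _ e2)[phi Vphi uphi]] := Hu N.
exists phi => //.
have SN := spaceH_L2field (Hu N); have Sphi := calV_L2field Vphi.
apply: le_lt_trans (sdist_triangle vd Sv SN Sphi) _.
by rewrite (snorm_subC vd Sv SN) [eps]splitr; exact: ltrD.
Qed.

Lemma cvgL2_unique (u : nat -> vfield R) (v w : vfield R) :
  (forall n, L2field (u n)) -> L2field v -> L2field w -> cvgL2 u v -> cvgL2 u w ->
  normL2 (v - w) = 0.
Proof.
move=> Su Sv Sw uv uw.
have h : normL2 (u n - v) + normL2 (u n - w) @[n --> \oo] --> (0 + 0 : R) by exact: cvgD.
apply/eqP; rewrite eq_le [0 <= _]snorm_ge0 andbT -[leRHS](addr0 0) -(cvg_lim _ h)//.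
apply: limr_ge; first by apply/cvg_ex; eexists; exact: h.
apply: nearW => n; apply: le_trans (sdist_triangle vd Sv (Su n) Sw) _.
by rewrite (snorm_subC vd Sv (Su n)).
Qed.

Section Eigenbasis.
Variables (e : nat -> vfield R).
Hypotheses (He : forall n, spaceH (e n))
  (oe : forall m n, dotL2 (e m) (e n) = (m == n)%:R).

Let hd : semi_dot (@spaceH R) (@dotL2 R) := spaceH_semi_dot.

Lemma normL2_basis n : normL2 (e n) = 1.
Proof. by rewrite /normL2 oe eqxx sqrtr1. Qed.

Lemma spaceH_comb (c : nat -> R) n : spaceH (\sum_(k < n) c k *: e k).
Proof. by apply: (sd_sum hd) => k _; exact: (sdZ hd). Qed.

Lemma dot_comb (c : nat -> R) n k :
  dotL2 (\sum_(i < n) c i *: e i) (e k) = if (k < n)%N then c k else 0.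
Proof.
rewrite (dot_suml hd)//; last by move=> i _; exact: (sdZ hd).
under eq_bigr do rewrite (dotZl hd)// oe.
case: ltnP => kn.
  rewrite (bigD1 (Ordinal kn))//= eqxx mulr1 big1 ?addr0// => i ik.
  by rewrite (_ : (i : nat) == k = false) ?mulr0//; apply: negbTE; exact: ik.
rewrite big1// => i _; rewrite (_ : (i : nat) == k = false) ?mulr0//.
by apply/negbTE; rewrite ltn_eqF// (leq_trans (ltn_ord i)).
Qed.

Lemma semigroup_basis (lam : nat -> R) (tau : R) n :
  spaceH (semigroup e lam tau (e n)) /\
  normL2 (semigroup e lam tau (e n) - expR (- tau * lam n) *: e n) = 0.
Proof.
set c := expR _.
have sumE N : (n < N)%N ->
    \sum_(k < N) (expR (- tau * lam k) * dotL2 (e n) (e k)) *: e k = c *: e n.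
  move=> nN; rewrite (bigD1 (Ordinal nN))//= oe eqxx mulr1 big1 ?addr0// => i ik.
  rewrite oe (_ : n == i = false) ?mulr0 ?scale0r//.
  by apply: negbTE; rewrite eq_sym; exact: ik.
have Hc : spaceH (c *: e n) by exact: (sdZ hd).
have cc : cvgL2 (fun N => \sum_(k < N) (expR (- tau * lam k) * dotL2 (e n) (e k)) *: e k)
    (c *: e n).
  apply: cvg_near_cst; exists n.+1 => // N /= nN; rewrite sumE//.
  by rewrite subrr [normL2 _](snorm0 vd).
have ex : exists v, [set v | spaceH v /\
   cvgL2 (fun N => \sum_(k < N) (expR (- tau * lam k) * dotL2 (e n) (e k)) *: e k) v] v.
  by exists (c *: e n).
have [Hs cs] := xgetPex 0 ex; split => //.
apply: cvgL2_unique cs cc; [|exact: spaceH_L2field Hs|exact: spaceH_L2field].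
move=> N; apply: spaceH_L2field.
exact: (spaceH_comb (fun k => expR (- tau * lam k) * dotL2 (e n) (e k))).
Qed.

End Eigenbasis.
End SpaceH.

Section Modes.
Context {R : realType} {d : measure_display} {T : measurableType d}.
Variables (P : probability T R) (H t : R) (e : nat -> vfield R) (lam : nat -> R).
Hypotheses (H4 : 4^-1 < H) (H2 : H < 2^-1) (t0 : 0 < t).
Hypotheses (He : forall n, spaceH (e n))
  (oe : forall m n, dotL2 (e m) (e n) = (m == n)%:R).
Local Notation nrm := (snorm (ip P setT)).
Let vd : semi_dot (@L2field R) (@dotL2 R) := dotL2_semi_dot.
Let hd : semi_dot (@spaceH R) (@dotL2 R) := spaceH_semi_dot.

Lemma mode_exists (beta : R -> {RV P >-> R}) n : is_fbm H beta -> 0 < lam n ->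
  exists Y : T -> vfield R,
    is_wiener_integralH H beta t (fun s => semigroup e lam (t - s) (e n)) Y.
Proof.
move=> fbm ln0; have [X _ WX] := wiener_expo_exists H4 t0 ln0 fbm.
exists (fun w => X w *: e n), (expo t (lam n)), (e n), X; split => // s _.
exact: semigroup_basis.
Qed.

(** The factors [phi] and [h] of the integrand are determined up to a scalar:
    evaluating at [s = t], where the semigroup is the identity, shows that
    [phi t *: h] represents [e n], hence that [phi] is [phi t] times the
    exponential. *)
Lemma mode_norm (beta : R -> {RV P >-> R}) n (Y : T -> vfield R) :
  is_fbm H beta -> 0 < lam n ->
  is_wiener_integralH H beta t (fun s => semigroup e lam (t - s) (e n)) Y ->
  exists xi : T -> R, [/\ sqint P setT xi, nrm xi <= 4 * lam n `^ (- H) &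
    forall w, L2field (Y w) /\ normL2 (Y w - xi w *: e n) = 0].
Proof.
move=> fbm ln0 [phi [h [X [Hh hphi WX YE]]]].
have Sh := spaceH_L2field Hh; have Se := spaceH_L2field (He n).
pose E := expo t (lam n).
have Eh s : 0 <= s <= t -> normL2 (E s *: e n - phi s *: h) = 0.
  move=> st; have [Hs ns] := hphi s st.
  have [_ ms] := semigroup_basis He oe lam (t - s) n.
  have Ss := spaceH_L2field Hs.
  have SE := sdZ vd (E s) Se; have Sp := sdZ vd (phi s) Sh.
  apply/eqP; rewrite eq_le [0 <= _]snorm_ge0 andbT.
  apply: le_trans (sdist_triangle vd SE Ss Sp) _.
  by rewrite (snorm_subC vd SE Ss) -!normL2E ms ns addr0.
pose c := phi t.
have ech : normL2 (e n - c *: h) = 0.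
  by have := Eh t; rewrite /E expo_t scale1r; apply; rewrite lexx ltW.
have Sc := sdZ vd c Sh.
have chn : `|c| * normL2 h = 1.
  rewrite normL2E -(snormZ vd)//.
  have e1 := normL2_basis oe n; rewrite normL2E in e1.
  have h1 := snormD vd (sdB vd Se Sc) Sc; rewrite subrK e1 -normL2E ech add0r in h1.
  have h2 := snormB vd Se (sdB vd Se Sc); rewrite subKr e1 -normL2E in h2.
  by apply/eqP; rewrite eq_le h1 andbT -[leRHS]addr0 -ech.
have c0 : c != 0.
  by apply/eqP => c0; move: chn; rewrite c0 normr0 mul0r => /eqP; rewrite eq_sym oner_eq0.
have h0 : normL2 h != 0.
  by apply/eqP => h0; move: chn; rewrite h0 mulr0 => /eqP; rewrite eq_sym oner_eq0.
have phiE s : 0 <= s <= t -> phi s = c * E s.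
  move=> st; apply/eqP; rewrite eq_sym -subr_eq0 -normr_eq0.
  suff : `|c * E s - phi s| * normL2 h = 0.
    by move=> /eqP; rewrite mulf_eq0 (negPf h0) orbF.
  rewrite normL2E -(snormZ vd)//.
  have S1 : L2field (E s *: (e n - c *: h)) by apply: (sdZ vd); exact: (sdB vd).
  have S2 : L2field (E s *: e n - phi s *: h) by apply: (sdB vd); exact: (sdZ vd).
  have -> : (c * E s - phi s) *: h =
      (E s *: e n - phi s *: h) - E s *: (e n - c *: h).
    by rewrite scalerBl scalerBr opprB [RHS]addrC addrA subrK scalerA [E s * c]mulrC.
  apply/eqP; rewrite eq_le snorm_ge0 andbT; apply: le_trans (snormB vd S2 S1) _.
  by rewrite (snormZ vd) -?normL2E ?Eh ?ech ?mulr0 ?addr0//; exact: (sdB vd).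
have [SX nX] := wiener_expo_norm H4 H2 t0 ln0 fbm WX phiE.
have sd := ip_semi_dot P measurableT.
exists (c^-1 *: X); split.
- exact: (sdZ sd).
- rewrite (snormZ sd)// normrV ?unitfE// mulrC ler_pdivrMr ?normr_gt0//.
  by rewrite mulrC.
- move=> w; rewrite YE; split; first exact: (sdZ vd).
  have -> : X w *: h - (c^-1 *: X) w *: e n = - ((c^-1 * X w) *: (e n - c *: h)).
    rewrite scalerBr opprB scalerA mulrAC mulVf// mul1r.
    by [].
  have S1 : L2field (e n - c *: h) by exact: (sdB vd).
  by rewrite normL2E (snormN vd) ?(snormZ vd) -?normL2E ?ech ?mulr0//; exact: (sdZ vd).
Qed.

End Modes.

(** * Convergence of orthogonal series *)

Section PowerSeries.
Context {R : realType}.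

(** Convexity of [x ^ (- eps)], through [1 + y <= exp y] and [ln (1 + y) <= y]. *)
Lemma powR_telescope (eps x : R) : 0 < eps -> 1 <= x ->
  eps * (x + 1) `^ (- (1 + eps)) <= x `^ (- eps) - (x + 1) `^ (- eps).
Proof.
move=> eps0 x1; have x0 : 0 < x by exact: lt_le_trans x1.
have y0 : 0 < x + 1 by rewrite ltr_wpDr.
have -> : (x + 1) `^ (- (1 + eps)) = (x + 1) `^ (- eps) * (x + 1)^-1.
  have -> : - (1 + eps) = - eps + -1 by ring.
  rewrite powRD; last by rewrite (gt_eqF y0) implybT.
  by rewrite powR_inv1// ltW.
have -> : x `^ (- eps) = (x + 1) `^ (- eps) * expR (eps * ln ((x + 1) / x)).
  rewrite /powR !gt_eqF// -expRD ln_div ?posrE//; congr expR; ring.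
rewrite -[X in _ <= _ - X]mulr1 -mulrBr mulrCA ler_wpM2l ?powR_ge0//.
have l1 : (x + 1)^-1 <= ln ((x + 1) / x).
  have -> : (x + 1) / x = (1 + - (x + 1)^-1)^-1.
    rewrite (_ : 1 + - (x + 1)^-1 = x / (x + 1)) ?invf_div//.
    by field; rewrite (gt_eqF y0).
  have z1 : - (x + 1)^-1 > -1.
    by rewrite ltrN2 invf_lt1// ltrDr.
  rewrite lnV ?posrE; last by rewrite -ltrBlDl sub0r.
  by rewrite lerNr; apply: le_ln1Dx.
have := expR_ge1Dx (eps * ln ((x + 1) / x)).
have := ler_wpM2l (ltW eps0) l1.
by lra.
Qed.

Lemma powR_series_bounded (p : R) : 1 < p -> exists K : R,
  forall N, \sum_(0 <= n < N) (n.+1%:R `^ (- p)) <= K.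
Proof.
move=> p1; pose eps := p - 1; have eps0 : 0 < eps by rewrite subr_gt0.
exists (1 + eps^-1) => -[|N].
  by rewrite big_nil addr_ge0// invr_ge0 ltW.
rewrite big_nat_recl// powR1 lerD2l.
have B : \sum_(0 <= n < N) (n.+2%:R `^ (- p) : R) <=
    eps^-1 * \sum_(0 <= n < N) (n.+1%:R `^ (- eps) - n.+2%:R `^ (- eps)).
  rewrite mulr_sumr; apply: ler_sum => n _; rewrite ler_pdivlMl//.
  have := @powR_telescope eps n.+1%:R eps0; rewrite ler1n => /(_ isT).
  rewrite (_ : n.+1%:R + 1 = n.+2%:R :> R); last by rewrite natr1.
  have -> : - (1 + eps) = - p by rewrite /eps addrCA subrr addr0.
  by [].
apply: le_trans B _; rewrite -[leRHS]mulr1 ler_wpM2l ?invr_ge0 ?(ltW eps0)//.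
under eq_bigr do rewrite -opprB; rewrite sumrN.
rewrite (telescope_sumr (fun n => n.+1%:R `^ (- eps) : R))// powR1 opprB.
by rewrite gerBl powR_ge0.
Qed.

Lemma nneseries_bounded (a : nat -> R) (K : R) : (forall n, 0 <= a n) ->
  (forall N, \sum_(0 <= n < N) a n <= K) -> (\sum_(0 <= n <oo) (a n)%:E <= K%:E)%E.
Proof.
move=> a0 aK; apply: lime_le; first by apply: is_cvg_nneseries => n _ _; rewrite lee_fin.
by apply: nearW => N; rewrite sumEFin lee_fin.
Qed.

End PowerSeries.

Section OrthogonalSeries.
Context {R : realType} {d : measure_display} {T : measurableType d}.
Variables (P : probability T R) (e : nat -> vfield R).
Hypothesis basis : orthonormal_basisH e.
Let vd : semi_dot (@L2field R) (@dotL2 R) := dotL2_semi_dot.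
Let hd : semi_dot (@spaceH R) (@dotL2 R) := spaceH_semi_dot.
Let He n : spaceH (e n). Proof. by case: basis. Qed.
Let oe m n : dotL2 (e m) (e n) = (m == n)%:R. Proof. by case: basis. Qed.

Lemma normL2_sqr (u : vfield R) : normL2 u ^+ 2 = dotL2 u u.
Proof. exact: (snorm_sqr vd). Qed.

Lemma normL2_comb (c : nat -> R) n :
  normL2 (\sum_(k < n) c k *: e k) ^+ 2 = \sum_(0 <= k < n) c k ^+ 2.
Proof.
rewrite (snorm_orthogonal hd (fun k : 'I_n => c k) (mu := fun=> 1) (G := fun k : 'I_n => e k))//.
  by rewrite big_mkord; apply: eq_bigr => k _; rewrite mul1r.
by move=> k l; rewrite oe mul1r.
Qed.

Lemma parseval (u : vfield R) : spaceH u ->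
  (\sum_(0 <= k <oo) ((dotL2 u (e k)) ^+ 2)%:E = (normL2 u ^+ 2)%:E)%E.
Proof.
move=> Hu; have [_ _ /(_ u Hu) cu] := basis.
pose c k := dotL2 u (e k).
have Hs n : spaceH (\sum_(k < n) c k *: e k) by exact: spaceH_comb.
have E n : \sum_(0 <= k < n) c k ^+ 2 =
    normL2 u ^+ 2 - normL2 (\sum_(k < n) c k *: e k - u) ^+ 2.
  have us : dotL2 u (\sum_(k < n) c k *: e k) = \sum_(0 <= k < n) c k ^+ 2.
    rewrite (dot_sumr hd)//; last by move=> k _; exact: (sdZ hd).
    by rewrite big_mkord; apply: eq_bigr => k _; rewrite (dotZr hd)// expr2.
  have ss : dotL2 (\sum_(k < n) c k *: e k) (\sum_(k < n) c k *: e k) =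
      \sum_(0 <= k < n) c k ^+ 2 by rewrite -normL2_sqr; exact: normL2_comb.
  have := Hs n; move: us ss; move: (\sum_(k < n) c k *: e k) => s us ss Hsn.
  rewrite (normL2_sqr u) (normL2_sqr (s - u)) (dotBl hd)//; last exact: (sdB hd).
  rewrite !(dotBr hd)// ss (sdC hd s u) us; ring.
apply/cvg_lim => //.
have -> : (fun n => \sum_(0 <= k < n) ((dotL2 u (e k)) ^+ 2)%:E)%E =
    (fun n => (normL2 u ^+ 2 - normL2 (\sum_(k < n) c k *: e k - u) ^+ 2)%:E).
  by apply/funext => n; rewrite sumEFin E.
apply: cvg_EFin; first exact: nearW.
rewrite -[X in _ --> X]subr0; apply: cvgB; first exact: cvg_cst.
by apply/cvg0_sqr => // n; exact: snorm_ge0.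
Qed.

Variable xi : nat -> T -> R.
Hypotheses (Sxi : forall n, sqint P setT (xi n))
  (sumxi : (\sum_(0 <= n <oo) (snorm (ip P setT) (xi n) ^+ 2)%:E < +oo)%E).

Let mxi n : measurable_fun setT (xi n). Proof. by case: (Sxi n). Qed.

Definition sumsq w := (\sum_(0 <= n <oo) ((xi n w) ^+ 2)%:E)%E.

Definition partial_sum n w := \sum_(k < n) xi k w *: e k.

(** The sum of the series where the squared coefficients are summable, zero on
    the remaining null set. *)
Definition series_limit w : vfield R :=
  xget 0 [set v | [/\ (sumsq w < +oo)%E, spaceH v & cvgL2 (partial_sum ^~ w) v]].

Lemma sumsq_ge0 w : (0 <= sumsq w)%E.
Proof. by apply: nneseries_ge0 => n _ _; rewrite lee_fin sqr_ge0. Qed.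

Lemma measurable_sumsq : measurable_fun setT sumsq.
Proof.
apply: ge0_emeasurable_sum => [k w _ _|k _]; first by rewrite lee_fin sqr_ge0.
by apply/measurable_EFinP; exact: measurable_funX.
Qed.

Lemma integral_xi n :
  (\int[P]_w ((xi n w) ^+ 2)%:E = (snorm (ip P setT) (xi n) ^+ 2)%:E)%E.
Proof. exact: integral_sqr. Qed.

Lemma sumsq_ae : {ae P, forall w, (sumsq w < +oo)%E}.
Proof.
have iS : P.-integrable setT sumsq.
  apply/integrableP; split; first exact: measurable_sumsq.
  have -> : (fun w => `|sumsq w|%E) = sumsq.
    by apply/funext => w; rewrite gee0_abs// sumsq_ge0.
  rewrite /sumsq integral_nneseries//.
  - by under eq_eseriesr do rewrite integral_xi.
  - by move=> n; apply/measurable_EFinP; exact: measurable_funX.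
  - by move=> n w _; rewrite lee_fin sqr_ge0.
have := integrable_ae measurableT iS; apply: filterS => w /(_ Logic.I).
by rewrite fin_numElt => /andP[].
Qed.

Lemma partial_sum_spaceH n w : spaceH (partial_sum n w).
Proof. exact: (spaceH_comb He (fun k => xi k w)). Qed.

Lemma partial_sum_cvg w : (sumsq w < +oo)%E ->
  exists2 v, spaceH v & cvgL2 (partial_sum ^~ w) v.
Proof.
move=> wfin; have Hs n := partial_sum_spaceH n w.
pose r n := \sum_(0 <= k < n) xi k w ^+ 2.
have rcv : cvgn r.
  apply: nondecreasing_is_cvgn.
    apply/nondecreasing_seqP => n.
    by rewrite /r big_nat_recr//= lerDl sqr_ge0.
  exists (fine (sumsq w)) => _ [n _ <-].
  rewrite -lee_fin fineK ?ge0_fin_numE ?sumsq_ge0//.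
  rewrite /sumsq (@nneseries_split _ _ 0 n); last by move=> k _; rewrite lee_fin sqr_ge0.
  rewrite add0n sumEFin leeDl//.
  by apply: nneseries_ge0 => k _ _; rewrite lee_fin sqr_ge0.
have dist m n : (n <= m)%N -> normL2 (partial_sum m w - partial_sum n w) ^+ 2 = r m - r n.
  move=> nm; rewrite normL2_sqr (dotBl hd)//; last exact: (sdB hd).
  rewrite !(dotBr hd)// (sdC hd (partial_sum n w) (partial_sum m w)).
  have ss k : dotL2 (partial_sum k w) (partial_sum k w) = r k.
    by rewrite -normL2_sqr; exact: (normL2_comb (fun k => xi k w)).
  rewrite !ss.
  have -> : dotL2 (partial_sum m w) (partial_sum n w) = r n.
    rewrite {2}/partial_sum (dot_sumr hd)//; last by move=> k _; exact: (sdZ hd).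
    rewrite /r big_mkord; apply: eq_bigr => k _.
    rewrite (dotZr hd)// (dot_comb He oe (fun k => xi k w)).
    by rewrite (leq_trans (ltn_ord k) nm) expr2.
  by ring.
have [|v Sv cv] := @L2field_complete _ (partial_sum ^~ w) (fun n => spaceH_L2field (Hs n)).
  move=> eps eps0; have e2 : 0 < eps ^+ 2 / 2 by rewrite divr_gt0// exprn_gt0.
  have /cvgrPdist_lt /(_ _ e2)[N _ NP] := rcv.
  exists N => m n Nm Nn.
  rewrite -ltr_sqr ?nnegrE ?[0 <= normL2 _]snorm_ge0 ?(ltW eps0)//.
  have bnd a b' : (N <= a)%N -> (N <= b')%N -> r a - r b' < eps ^+ 2.
    move=> Na Nb; have := NP a Na; have := NP b' Nb; rewrite /= !ltr_norml.
    by move=> /andP[? ?] /andP[? ?]; lra.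
  have [nm|/ltnW mn] := leqP n m; first by rewrite dist//; exact: bnd.
  rewrite normL2E (snorm_subC hd)// -normL2E dist//; exact: bnd.
by exists v => //; exact: spaceH_closed cv.
Qed.

Lemma series_limit_spaceH w : spaceH (series_limit w).
Proof.
rewrite /series_limit; case: xgetP => [v _ []//|_].
exact: spaceH0.
Qed.

Lemma series_limit_coord k w :
  dotL2 (series_limit w) (e k) = xi k w * \1_[set w | (sumsq w < +oo)%E] w.
Proof.
have [wfin|winf] := pselect (sumsq w < +oo)%E; last first.
  rewrite indicE memNset// mulr0 /series_limit xgetPN; first exact: (dot0l hd).
  by move=> v [].
rewrite indicE mem_set// mulr1.
have [v0 Hv0 cv0] := partial_sum_cvg wfin.
have [_ Hv cv] : [set v | [/\ (sumsq w < +oo)%E, spaceH v & cvgL2 (partial_sum ^~ w) v]]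
    (series_limit w).
  by apply: (xgetPex 0); exists v0.
apply/eqP; rewrite -subr_eq0 -normr_le0; apply/ler_addgt0Pr => eps eps0; rewrite add0r.
have /cvgrPdist_le /(_ _ eps0)[N _ NP] := cv.
pose n := maxn N k.+1.
have := NP n (leq_maxl _ _); rewrite /= sub0r normrN ger0_norm ?[0 <= _]snorm_ge0//.
apply: le_trans.
have Hs := partial_sum_spaceH n w.
have -> : dotL2 (series_limit w) (e k) - xi k w =
    - dotL2 (partial_sum n w - series_limit w) (e k).
  rewrite (dotBl hd)// (dot_comb He oe (fun k => xi k w)) leq_maxr.
  by rewrite opprB.
rewrite normrN; apply: le_trans (cauchy_schwarz hd (sdB hd Hs Hv) (He k)) _.
by rewrite -!normL2E (normL2_basis oe) mulr1.
Qed.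

Lemma measurable_coord k : measurable_fun setT (fun w => dotL2 (series_limit w) (e k)).
Proof.
under eq_fun do rewrite series_limit_coord.
apply: measurable_funM => //; apply: measurable_indic.
rewrite -[X in measurable X]setTI; 
  apply: emeasurable_fun_infty_o => //; exact: measurable_sumsq.
Qed.

Lemma normL2_sub_coord w (u : vfield R) : spaceH u ->
  ((normL2 (series_limit w - u) ^+ 2)%:E =
   \sum_(0 <= k <oo) ((dotL2 (series_limit w) (e k) - dotL2 u (e k)) ^+ 2)%:E)%E.
Proof.
move=> Hu; have Hz := series_limit_spaceH w.
rewrite -parseval; last exact: (sdB hd).
by apply: eq_eseriesr => k _; rewrite (dotBl hd).
Qed.

Lemma measurable_dist (u : vfield R) : spaceH u ->
  measurable_fun setT (fun w => normL2 (series_limit w - u) ^+ 2).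
Proof.
move=> Hu; apply/measurable_EFinP.
rewrite (_ : EFin \o _ = fun w =>
  (\sum_(0 <= k <oo) ((dotL2 (series_limit w) (e k) - dotL2 u (e k)) ^+ 2)%:E)%E).
  apply: ge0_emeasurable_sum => [k w _ _|k _]; first by rewrite lee_fin sqr_ge0.
  apply/measurable_EFinP; apply: measurable_funX.
  by apply: measurable_funB => //; exact: measurable_coord.
by apply/funext => w /=; exact: normL2_sub_coord.
Qed.

Definition rat_comb (q : seq rat) : vfield R :=
  \sum_(k < size q) (ratr (nth 0 q k) : R) *: e k.

Lemma rat_comb_spaceH q : spaceH (rat_comb q).
Proof. exact: (spaceH_comb He (fun k => ratr (nth 0 q k))). Qed.

Lemma rat_comb_dense (u : vfield R) (r : R) : spaceH u -> 0 < r ->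
  exists q, normL2 (u - rat_comb q) < r.
Proof.
move=> Hu r0; have [_ _ /(_ u Hu) cu] := basis.
have r2 : 0 < r / 2 by exact: divr_gt0.
have /cvgrPdist_lt /(_ _ r2)[N _ /(_ N (leqnn N))] := cu.
rewrite /= sub0r normrN ger0_norm ?[0 <= _]snorm_ge0// => uN.
pose delta := r / 2 / N.+1%:R; have delta0 : 0 < delta by rewrite divr_gt0.
have /choice[Q QP] (k : nat) : exists q : rat, `|dotL2 u (e k) - ratr q| <= delta.
  have [|q] := @rat_in_itvoo R (dotL2 u (e k) - delta) (dotL2 u (e k) + delta).
    by lra.
  rewrite in_itv/= => /andP[h1 h2]; exists q.
  by rewrite ler_norml; apply/andP; split; lra.
exists (mkseq Q N).
have qE : rat_comb (mkseq Q N) = \sum_(k < N) (ratr (Q k) : R) *: e k.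
  by rewrite /rat_comb size_mkseq; apply: eq_bigr => k _; rewrite nth_mkseq.
set p := \sum_(k < N) _ in uN.
have Hp : spaceH p by exact: (spaceH_comb He (fun k => dotL2 u (e k))).
have Hq : spaceH (rat_comb (mkseq Q N)) by exact: rat_comb_spaceH.
apply: le_lt_trans (sdist_triangle hd Hu Hp Hq) _.
rewrite (snorm_subC hd Hu Hp) [ltRHS]splitr; apply: ltr_leD => //.
rewrite qE /p -sumrB; under eq_bigr do rewrite -scalerBl.
apply: le_trans (snorm_sum hd _ _) _; first by move=> k _; exact: (sdZ hd).
apply: (@le_trans _ _ (\sum_(k < N) delta)).
  apply: ler_sum => k _; rewrite (snormZ hd)// -normL2E (normL2_basis oe) mulr1.
  exact: QP.
rewrite sumr_const card_ord -[leLHS]mulr_natr.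
rewrite (_ : delta * N%:R = r / 2 * (N%:R / N.+1%:R)); last by rewrite /delta mulrAC mulrA.
by rewrite ler_piMr ?(ltW r2)// ler_pdivrMr// mul1r ler_nat.
Qed.

(** As H is separable, an open set is a countable union of balls around rational
    combinations of the basis, and the distance of the sum to a fixed field is
    measurable by Parseval's identity. *)
Lemma measurable_series_limit (U : set (vfield R)) : openH U ->
  measurable (series_limit @^-1` U).
Proof.
move=> [UH oU].
pose good (qn : seq rat * nat) :=
  forall v, spaceH v -> normL2 (v - rat_comb qn.1) < qn.2.+1%:R^-1 -> U v.
pose B (qn : seq rat * nat) : set T :=
  [set w | normL2 (series_limit w - rat_comb qn.1) ^+ 2 < (qn.2.+1%:R^-1) ^+ 2].
have BE qn w : B qn w <-> normL2 (series_limit w - rat_comb qn.1) < qn.2.+1%:R^-1.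
  by rewrite /B/= ltr_sqr ?nnegrE ?[0 <= normL2 _]snorm_ge0 ?invr_ge0.
rewrite (_ : _ @^-1` _ = \bigcup_qn (if `[< good qn >] then B qn else set0)).
  apply: countable_bigcupT_measurable; first exact: countableP.
  move=> qn; case: asboolP => // _.
  rewrite /B -[X in measurable X]setTI.
  apply: (@measurable_fun_ltr _ _ _ setT _ (cst ((qn.2.+1%:R^-1) ^+ 2)) _ _ measurableT
    [set true]) => //.
  exact: measurable_dist (rat_comb_spaceH _).
apply/seteqP; split => [w Uw|w [qn _]]; last first.
  by case: asboolP => // g /BE; exact: g (series_limit_spaceH w).
have Hz := series_limit_spaceH w.
have [eps eps0 epsU] := oU _ Uw.
have e2 : 0 < eps / 2 by exact: divr_gt0.
have [n _ /(_ n (leqnn n)) ne] := near_infty_natSinv_lt (PosNum e2).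
have [q qw] := @rat_comb_dense (series_limit w) n.+1%:R^-1 Hz (ltac:(by rewrite invr_gt0)).
exists (q, n) => //; case: asboolP => [_|]; first exact/BE.
case=> v Hv /= vq; apply: epsU => //.
have Hq := rat_comb_spaceH q.
apply: le_lt_trans (sdist_triangle hd Hv Hq Hz) _.
rewrite (snorm_subC hd Hq Hz) [eps]splitr.
by apply: ltrD; [exact: lt_trans vq ne | exact: lt_trans qw ne].
Qed.

Lemma integral_coord_le k :
  (\int[P]_w ((dotL2 (series_limit w) (e k)) ^+ 2)%:E <=
    (snorm (ip P setT) (xi k) ^+ 2)%:E)%E.
Proof.
rewrite -integral_xi; apply: ge0_le_integral => //.
- by move=> w _; rewrite lee_fin sqr_ge0.
- by apply/measurable_EFinP; apply: measurable_funX; exact: measurable_coord.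
- by apply/measurable_EFinP; exact: measurable_funX.
- by move=> w _; rewrite series_limit_coord lee_fin exprMn ler_piMr ?sqr_ge0//.
Qed.

Lemma integral_coord_sub k :
  (\int[P]_w ((xi k w - dotL2 (series_limit w) (e k)) ^+ 2)%:E = 0)%E.
Proof.
rewrite -(integral0 P setT); apply: ge0_ae_eq_integral => //.
- apply/measurable_EFinP; apply: measurable_funX; apply: measurable_funB => //.
  exact: measurable_coord.
- by move=> w _; rewrite lee_fin sqr_ge0.
- have := sumsq_ae; apply: filterS => w wfin _.
  by rewrite series_limit_coord indicE mem_set// mulr1 subrr expr0n.
Qed.

Lemma L2H_series_limit : L2H P series_limit.
Proof.
split; [exact: series_limit_spaceH | exact: measurable_series_limit |].
rewrite /sqnormL2H; under eq_integral => w _ do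
  rewrite -(parseval (series_limit_spaceH w)).
rewrite integral_nneseries//.
- apply: le_lt_trans sumxi; apply: lee_nneseries => [k _ _|k _].
    by apply: integral_ge0 => w _; rewrite lee_fin sqr_ge0.
  exact: integral_coord_le.
- by move=> k; apply/measurable_EFinP; apply: measurable_funX; exact: measurable_coord.
- by move=> k w _; rewrite lee_fin sqr_ge0.
Qed.

(** By Parseval's identity the error after [n] terms is the sum over [k >= n] of
    the second moments of the coefficients, the tail of a convergent series. *)
Theorem orthogonal_series_cvg (Y : nat -> T -> vfield R) :
  (forall k w, L2field (Y k w)) ->
  (forall k w, normL2 (Y k w - xi k w *: e k) = 0) ->
  series_cvgL2H P Y.
Proof.
move=> SY YE; exists series_limit; first exact: L2H_series_limit.
pose c n k w := (if (k < n)%N then xi k w else 0) - dotL2 (series_limit w) (e k).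
have mc n k : measurable_fun setT (c n k).
  rewrite /c; case: (k < n)%N; apply: measurable_funB => //; exact: measurable_coord.
have normE n w : ((normL2 (\sum_(k < n) Y k w - series_limit w) ^+ 2)%:E =
    \sum_(0 <= k <oo) ((c n k w) ^+ 2)%:E)%E.
  have Hz := series_limit_spaceH w; have Sz := spaceH_L2field Hz.
  have Hs := partial_sum_spaceH n w; have Ss := spaceH_L2field Hs.
  have SSY : L2field (\sum_(k < n) Y k w) by apply: (sd_sum vd).
  have Sxe k : L2field (xi k w *: e k) by apply: (sdZ vd); exact: spaceH_L2field.
  have d0 : normL2 (\sum_(k < n) Y k w - partial_sum n w) = 0.
    apply/eqP; rewrite eq_le [0 <= _]snorm_ge0 andbT /partial_sum -sumrB.
    apply: le_trans (snorm_sum vd _ _) _; first by move=> k _; exact: (sdB vd).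
    by rewrite big1// => k _; exact: YE.
  have -> : normL2 (\sum_(k < n) Y k w - series_limit w) =
      normL2 (partial_sum n w - series_limit w).
    apply/eqP; rewrite eq_le; apply/andP; split.
      by apply: le_trans (sdist_triangle vd SSY Ss Sz) _; rewrite -!normL2E d0 add0r.
    apply: le_trans (sdist_triangle vd Ss SSY Sz) _.
    by rewrite (snorm_subC vd Ss SSY) -!normL2E d0 add0r.
  rewrite -parseval; last exact: (sdB hd).
  apply: eq_eseriesr => k _; rewrite (dotBl hd)//.
  by rewrite (dot_comb He oe (fun k => xi k w)).
have cS n : (sqnormL2H P (fun w => (\sum_(k < n) Y k w - series_limit w)%R) <=
    \sum_(n <= k <oo) (snorm (ip P setT) (xi k) ^+ 2)%:E)%E.
  rewrite /sqnormL2H; under eq_integral => w _ do rewrite normE.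
  rewrite integral_nneseries//; last 2 first.
  - by move=> k; apply/measurable_EFinP; exact: measurable_funX.
  - by move=> k w _; rewrite lee_fin sqr_ge0.
  rewrite (@nneseries_split _ _ 0 n); last first.
    by move=> k _; apply: integral_ge0 => w _; rewrite lee_fin sqr_ge0.
  rewrite add0n big1_seq ?add0e; last first.
    move=> k; rewrite mem_index_iota => /andP[_ /andP[_ kn]].
    by rewrite /c kn; exact: integral_coord_sub.
  rewrite eseries_cond [leRHS]eseries_cond; apply: lee_nneseries => [k _ _|k /andP[_ nk]].
    by apply: integral_ge0 => w _; rewrite lee_fin sqr_ge0.
  apply: le_trans (integral_coord_le k).
  under eq_integral => w _ do rewrite /c ltnNge nk/= sub0r sqrrN.
  exact: lexx.
have tail0 : (\sum_(n <= k <oo) (snorm (ip P setT) (xi k) ^+ 2)%:E)%E @[n --> \oo] --> 0%E.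
  by apply: nneseries_tail_cvg => // k _; rewrite lee_fin sqr_ge0.
apply: (squeeze_cvge _ (cvg_cst 0%E) tail0).
apply: nearW => n; rewrite cS andbT; apply: integral_ge0 => w _.
by rewrite lee_fin sqr_ge0.
Qed.

End OrthogonalSeries.

(** * The stochastic convolution *)

Section SumOfMoments.
Context {R : realType}.

(** [lam n >= c (n + 1)^2] turns [(lam n)^(- 2 H)] into [(n + 1)^(- 4 H)], which is
    summable exactly because [H > 1/4]. *)
Lemma eigenvalue_powR_bounded (H c : R) (lam : nat -> R) :
  4^-1 < H -> 0 < c -> (forall n, c * n.+1%:R ^+ 2 <= lam n) ->
  exists K, forall N, \sum_(0 <= n < N) (4 * lam n `^ (- H)) ^+ 2 <= K.
Proof.
move=> H4 c0 clam; have H0 : 0 < H by apply: lt_trans H4; rewrite invr_gt0.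
have [|K KP] := @powR_series_bounded R (4 * H).
  by rewrite mulrC -ltr_pdivrMr// div1r.
exists ((4 * c `^ (- H)) ^+ 2 * K) => N.
apply: le_trans (ler_wpM2l (sqr_ge0 _) (KP N)); rewrite mulr_sumr.
apply: ler_sum => n _.
have n0 : 0 < n.+1%:R :> R by rewrite ltr0n.
have cn0 : 0 < c * n.+1%:R ^+ 2 by rewrite mulr_gt0// exprn_gt0.
have -> : n.+1%:R `^ (- (4 * H)) = ((n.+1%:R ^+ 2) `^ (- H)) ^+ 2 :> R.
  rewrite -!powR_mulrn ?powR_ge0 ?(ltW n0)// -!powRrM; congr (_ `^ _); ring.
rewrite -exprMn ler_sqr ?nnegrE ?mulr_ge0 ?powR_ge0//.
rewrite -mulrA -powRM ?sqr_ge0 ?(ltW c0)// ler_wpM2l// !powRN.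
rewrite lef_pV2 ?posrE ?powR_gt0 ?(lt_le_trans cn0 (clam n))//.
by rewrite ge0_ler_powR ?nnegrE ?(ltW H0) ?(ltW cn0) ?(le_trans (ltW cn0) (clam n)).
Qed.

End SumOfMoments.

Unset Implicit Arguments.

Theorem theorem3p5 (R : realType) (d : measure_display) (T : measurableType d)
    (P : probability T R) (H : R)
    (e : nat -> vfield R) (lambda : nat -> R)
    (beta : nat -> R -> {RV P >-> R}) :
  measure_is_complete P ->
  4^-1 < H -> H < 2^-1 ->
  orthonormal_basisH e ->
  0 < lambda 0%N ->
  (forall n, lambda n <= lambda n.+1) ->
  lambda n @[n --> \oo] --> +oo ->
  (forall n, eigenpairA (e n) (lambda n)) ->
  (forall n, is_fbm H (beta n)) ->
  independent_processes beta ->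
  forall t : R, 0 < t ->
    (forall n, exists Y : T -> vfield R,
       is_wiener_integralH H (beta n) t
         (fun s => semigroup e lambda (t - s) (e n)) Y) /\
    (forall Y : nat -> T -> vfield R,
       (forall n, is_wiener_integralH H (beta n) t
          (fun s => semigroup e lambda (t - s) (e n)) (Y n)) ->
       series_cvgL2H P Y).
Proof.
move=> _ H4 H2 basis lam0 lamS _ eA fbm _ t t0.
have [He oe _] := basis.
have [c c0 clam] := eigenvalue_growth He oe lam0 lamS eA.
have ln0 n : 0 < lambda n.
  by apply: lt_le_trans (clam n); rewrite mulr_gt0// exprn_gt0.
split=> [n|Y WY]; first exact: mode_exists.
have /choice[xi xiP] n := mode_norm H4 H2 t0 He oe (fbm n) (ln0 n) (WY n).
have [K KP] := eigenvalue_powR_bounded H4 c0 clam.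
apply: (@orthogonal_series_cvg _ _ _ P e basis xi).
- by move=> n; case: (xiP n).
- apply: (@le_lt_trans _ _ K%:E); last exact: ltry.
  apply: nneseries_bounded => [n|N]; first exact: sqr_ge0.
  apply: le_trans (KP N); apply: ler_sum => n _; have [_ nx _] := xiP n.
  by rewrite ler_sqr ?nnegrE ?snorm_ge0 ?mulr_ge0 ?powR_ge0.
- by move=> n w; case: (xiP n) => _ _ /(_ w)[].
- by move=> n w; case: (xiP n) => _ _ /(_ w)[].
Qed.
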